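(* Let $\Omega \subset \mathbb{R}^d$ ($d \ge 1$) be a convex polytope (with nonempty interior) which is centrally symmetric and all of whose faces of all dimensions are also centrally symmetric. Then there exists a set $\Lambda \subset \mathbb{R}^d$ such that the system of exponential functions $E(\Lambda) = \{e_\lambda\}_{\lambda \in \Lambda}$, $e_\lambda(x) = e^{2\pi i \langle \lambda, x\rangle}$, is a Riesz basis in $L^2(\Omega)$.
   Context: A convex polytope is the convex hull of finitely many points. A convex polytope $\Omega$ is centrally symmetric if $-\Omega$ is a translate of $\Omega$. A system $\{f_n\}$ in a separable Hilbert space $H$ is a Riesz basis if it is the image of an orthonormal basis of $H$ under a bounded, invertible linear operator on $H$. *)

(* Defs.v *)
From mathcomp Require Import all_boot all_order all_algebra.
From mathcomp Require Import all_classical all_reals all_analysis.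
From mathcomp Require Import complex.
Set Implicit Arguments. Unset Strict Implicit. Unset Printing Implicit Defensive.
Import Order.TTheory GRing.Theory Num.Theory.
Import numFieldNormedType.Exports.
Local Open Scope classical_set_scope.
Local Open Scope ring_scope.

Section Defs.
Context {R : realType} {d : nat}.
Local Notation V := 'rV[R]_d.

Definition dotp (x y : V) : R := \sum_(i < d) x ord0 i * y ord0 i.

Definition conv_hull (P : seq V) : set V :=
  [set x | exists w : 'I_(size P) -> R,
     (forall i, 0 <= w i) /\ \sum_i w i = 1 /\ x = \sum_i w i *: P`_i].

Definition is_polytope (Om : set V) : Prop := exists P : seq V, Om = conv_hull P.

Definition centrally_symmetric (A : set V) : Prop :=
  exists c : V, [set - x | x in A] = [set x + c | x in A].

(** Faces (of all dimensions) of a convex set: intersections with a supporting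
    hyperplane  {x | <a,x> = b}  where  Om ⊆ {x | <a,x> <= b}.  (Taking a = 0
    this also yields Om itself and the empty set, both harmless here.) *)
Definition face_of (Om F : set V) : Prop :=
  exists (a : V) (b : R), (forall x, Om x -> dotp a x <= b) /\
    F = Om `&` [set x | dotp a x = b].

(** Lebesgue integral over R^d of a nonnegative function, written as the
    iterated one-dimensional Lebesgue integral (Tonelli). *)
Fixpoint iint (n : nat) : (n.-tuple R -> \bar R) -> \bar R :=
  match n with
  | 0 => fun g => g [tuple]
  | n'.+1 => fun g =>
      (\int[@lebesgue_measure R]_x iint (fun t : n'.-tuple R => g [tuple of x :: t]))%E
  end.

Definition row_of_tuple (t : d.-tuple R) : V := \row_i tnth t i.

Definition leb_int (g : V -> \bar R) : \bar R := iint (fun t => g (row_of_tuple t)).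

(** Borel measurability on R^d (product sigma-algebra on d-tuples). *)
Definition meas (f : V -> R) : Prop :=
  measurable_fun [set: d.-tuple R] (fun t => f (row_of_tuple t)).

Definition Rint (g : V -> R) : R :=
  fine (leb_int (fun x => (Num.max (g x) 0)%:E)) -
  fine (leb_int (fun x => (Num.max (- g x) 0)%:E)).

Definition restr (Om : set V) (f : V -> R[i]) : V -> R[i] :=
  fun x => if `[< Om x >] then f x else 0.

Definition sqmod (z : R[i]) : R := (complex.Re z) ^+ 2 + (complex.Im z) ^+ 2.

Definition L2 (Om : set V) (f : V -> R[i]) : Prop :=
  meas (fun x => complex.Re (restr Om f x)) /\
  meas (fun x => complex.Im (restr Om f x)) /\
  (leb_int (fun x => (sqmod (restr Om f x))%:E) < +oo)%E.

Definition norm2 (Om : set V) (f : V -> R[i]) : R :=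
  fine (leb_int (fun x => (sqmod (restr Om f x))%:E)).

Definition eqH (Om : set V) (f g : V -> R[i]) : Prop :=
  leb_int (fun x => (sqmod (restr Om (fun y => f y - g y) x))%:E) = 0%E.

Definition inner (Om : set V) (f g : V -> R[i]) : R[i] :=
  Complex (Rint (fun x => complex.Re (restr Om f x * Num.conj (restr Om g x))))
          (Rint (fun x => complex.Im (restr Om f x * Num.conj (restr Om g x)))).

Definition orthonormal_basis (Om : set V) (Lam : set V) (u : V -> V -> R[i]) : Prop :=
  (forall l, Lam l -> L2 Om (u l)) /\
  (forall l m, Lam l -> Lam m -> inner Om (u l) (u m) = if l == m then 1 else 0) /\
  (forall f, L2 Om f -> (forall l, Lam l -> inner Om f (u l) = 0) -> eqH Om f (fun=> 0)).

Definition bounded_op (Om : set V) (T : (V -> R[i]) -> (V -> R[i])) : Prop :=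
  (forall f, L2 Om f -> L2 Om (T f)) /\
  (forall f g, L2 Om f -> L2 Om g -> eqH Om f g -> eqH Om (T f) (T g)) /\
  (forall (a : R[i]) f g, L2 Om f -> L2 Om g ->
      eqH Om (T (fun x => a * f x + g x)) (fun x => a * T f x + T g x)) /\
  (exists C : R, forall f, L2 Om f -> norm2 Om (T f) <= C * norm2 Om f).

Definition bounded_invertible (Om : set V) (T : (V -> R[i]) -> (V -> R[i])) : Prop :=
  bounded_op Om T /\
  exists S, bounded_op Om S /\
    forall f, L2 Om f -> eqH Om (S (T f)) f /\ eqH Om (T (S f)) f.

Definition riesz_basis (Om : set V) (Lam : set V) (e : V -> V -> R[i]) : Prop :=
  exists (u : V -> V -> R[i]) (T : (V -> R[i]) -> (V -> R[i])),
    orthonormal_basis Om Lam u /\ bounded_invertible Om T /\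
    forall l, Lam l -> eqH Om (T (u l)) (e l).

Definition expo (lam : V) : V -> R[i] :=
  fun x => Complex (cos (2 * pi * dotp lam x)) (sin (2 * pi * dotp lam x)).

End Defs.

(* Main.v *)
(** A polytope all of whose faces are centrally symmetric is a translate of a
    zonotope: if [[p, p + v]] is an edge, central symmetry carries it from face
    to face, so that every face with normal orthogonal to [v] contains a
    translate of [[0, v]].  A separation argument after projecting along [v]
    then gives [Om = K + [0, 1] v] with [K = Om `&` (Om - v)], and [K] is again a
    polytope with symmetric faces and with fewer vertices.

    A Riesz basis of exponentials for a zonotope is built by induction on the
    number of generators.  After a linear change of variables the zonotope is
    [Z = Z' + [0, 1] e_0].  The set [T = Z `\` Z'] has half-open unit fibres in
    the direction [e_0] over the projection [B] of [Z], which is a zonotope with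
    fewer generators, so the integers times a frequency set of [B] work for [T]:
    the exponentials [exp(2 i pi k x_0)] form an orthonormal basis on every fibre.
    Every [f] in [L^2(Z)] is uniquely [f1 + (g - g(. - e_0))] with [f1] supported
    in [T] and [g] in [Z'].  The Fourier transform of the second summand is
    [(1 - exp(- 2 i pi l_0)) ft g l]: it vanishes on the frequencies of [T], and on
    those of [Z'] the factor is bounded away from [0] after a small perturbation
    of [l_0].  Hence the two frequency sets together work for [Z], the system
    being block triangular. *)

(* Integer frequencies see a function only through its periodization in the direction [e_0]: they
   suffice on fibres of length 1, while the fibres of [Z] have varying lengths, at least 1. What
   they miss is the difference [g - g(. - e_0)], and [g] is recovered as the sum of [f] along a
   column, finite because [Z] is bounded. Triangularity requires two more things: the exponentials
   of [Z'] must stay bounded on functions living off [Z'], and the factor of [g] must not vanish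
   when a frequency of [Z'] has an integer first coordinate. Both [Z'] and [B] lose a generator but
   only [B] loses a dimension, so the induction treats all dimensions at once; degenerate zonotopes
   occur, down to null sets with the empty frequency set. The statement speaks of functions rather
   than classes modulo null sets, so the Hilbert spaces below consist of functions with a seminorm,
   and operators are linear up to elements of norm zero. *)
Require Import Defs.
From HB Require Import structures.
From mathcomp Require Import all_boot all_order all_algebra.
From mathcomp Require Import all_classical all_reals all_analysis.
From mathcomp Require Import complex.
From mathcomp Require Import measurable_realfun.
From mathcomp Require Import ring lra.
Set Implicit Arguments. Unset Strict Implicit. Unset Printing Implicit Defensive.
Import Order.TTheory GRing.Theory Num.Theory.
Import numFieldNormedType.Exports.
Local Open Scope classical_set_scope.
Local Open Scope ring_scope.

(** * Squared modulus *)

Section ComplexModulus.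
Context {R : realType}.
Implicit Types z w : R[i].

Lemma sqmodE z : ((sqmod z)%:C)%C = z * conjc z.
Proof. by rewrite -sqr_normc -add_Re2_Im2. Qed.

Lemma ReD z w : complex.Re (z + w) = complex.Re z + complex.Re w.
Proof. by case: z w => [a b] [c d]. Qed.
Lemma ImD z w : complex.Im (z + w) = complex.Im z + complex.Im w.
Proof. by case: z w => [a b] [c d]. Qed.
Lemma ReN z : complex.Re (- z) = - complex.Re z.
Proof. by case: z => [a b]. Qed.
Lemma ImN z : complex.Im (- z) = - complex.Im z.
Proof. by case: z => [a b]. Qed.
Lemma ReM z w :
  complex.Re (z * w) = complex.Re z * complex.Re w - complex.Im z * complex.Im w.
Proof. by case: z w => [a b] [c d]. Qed.
Lemma ImM z w :
  complex.Im (z * w) = complex.Re z * complex.Im w + complex.Im z * complex.Re w.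
Proof. by case: z w => [a b] [c d]. Qed.
Lemma ReJ z : complex.Re (conjc z) = complex.Re z.
Proof. by case: z => [a b]. Qed.
Lemma ImJ z : complex.Im (conjc z) = - complex.Im z.
Proof. by case: z => [a b]. Qed.

Definition cE := (ReD, ImD, ReN, ImN, ReM, ImM, ReJ, ImJ).

Lemma ceq z w : complex.Re z = complex.Re w -> complex.Im z = complex.Im w -> z = w.
Proof. by case: z w => [a b] [c d] /= -> ->. Qed.

Lemma sqmod_ge0 z : 0 <= sqmod z.
Proof. by rewrite /sqmod addr_ge0 ?sqr_ge0. Qed.

Lemma sqmodM z w : sqmod (z * w) = sqmod z * sqmod w.
Proof. by case: z w => [a b] [c d]; rewrite /sqmod /=; ring. Qed.

Lemma sqmodJ z : sqmod (conjc z) = sqmod z.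
Proof. by case: z => [a b]; rewrite /sqmod /= sqrrN. Qed.

Lemma sqmodN z : sqmod (- z) = sqmod z.
Proof. by case: z => [a b]; rewrite /sqmod /= !sqrrN. Qed.

Lemma sqmod0 : sqmod (0 : R[i]) = 0.
Proof. by rewrite /sqmod /= expr0n /= addr0. Qed.

Lemma sqmod1 : sqmod (1 : R[i]) = 1.
Proof. by rewrite /sqmod /= expr0n expr1n /= addr0. Qed.

Lemma sqmod_real (a : R) : sqmod (a%:C)%C = a ^+ 2.
Proof. by rewrite /sqmod /= expr0n /= addr0. Qed.

Lemma sqmod_eq0 z : sqmod z = 0 -> z = 0.
Proof.
case: z => [a b]; rewrite /sqmod /= => /eqP.
rewrite paddr_eq0 ?sqr_ge0 // !sqrf_eq0 => /andP[/eqP -> /eqP ->].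
by [].
Qed.

Lemma sqmodD z w : sqmod (z + w) <= 2 * sqmod z + 2 * sqmod w.
Proof.
case: z w => [a b] [c d]; rewrite /sqmod /=.
have := sqr_ge0 (a - c); have := sqr_ge0 (b - d); nra.
Qed.

(** The difference of the two sides is [sqmod (t * w - z) / t]. For small [t] the weight of [w] is
    close to 1, whereas [sqmodD] loses a factor 2. *)
Lemma sqmodD_weight (t : R) z w : 0 < t ->
  sqmod (z + w) <= (1 + t) * sqmod w + (1 + t^-1) * sqmod z.
Proof.
case: z w => [a b] [c d] t0; rewrite /sqmod /= -subr_ge0.
have -> : (1 + t) * (c ^+ 2 + d ^+ 2) + (1 + t^-1) * (a ^+ 2 + b ^+ 2) -
  ((a + c) ^+ 2 + (b + d) ^+ 2) =
  ((t * c - a) ^+ 2 + (t * d - b) ^+ 2) / t by field; rewrite gt_eqF.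
by rewrite divr_ge0 ?addr_ge0 ?sqr_ge0 // ltW.
Qed.

Lemma sqmodDr z w :
  sqmod (z + w) = sqmod z + sqmod w + 2 * complex.Re (z * conjc w).
Proof. by case: z w => [a b] [c d]; rewrite /sqmod /=; ring. Qed.

Lemma sqr_Re_le z : complex.Re z ^+ 2 <= sqmod z.
Proof. by rewrite /sqmod lerDl sqr_ge0. Qed.

Lemma sum_cauchy (I : Type) (s : seq I) (a b : I -> R[i]) :
  sqmod (\sum_(i <- s) a i * b i) <=
  (\sum_(i <- s) sqmod (a i)) * (\sum_(i <- s) sqmod (b i)).
Proof.
elim: s => [|i s IH]; first by rewrite !big_nil sqmod0 mul0r.
rewrite !big_cons.
set S := \sum_(j <- s) a j * b j in IH *.
set A := \sum_(j <- s) _ in IH *; set B := \sum_(j <- s) _ in IH *.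
have A0 : 0 <= A by apply: sumr_ge0 => *; exact: sqmod_ge0.
have B0 : 0 <= B by apply: sumr_ge0 => *; exact: sqmod_ge0.
set x := sqmod (a i); set y := sqmod (b i).
have x0 : 0 <= x by exact: sqmod_ge0.
have y0 : 0 <= y by exact: sqmod_ge0.
rewrite sqmodDr sqmodM -/x -/y.
set r := complex.Re _.
have r2 : r ^+ 2 <= x * y * (A * B).
  apply: le_trans (sqr_Re_le _) _.
  by rewrite !(sqmodM, sqmodJ) -/x -/y ler_wpM2l // mulr_ge0.
(* By [r2], [r] is at most the geometric mean of [A * y] and [B * x], hence at most their arithmetic
   mean. *)
have h : 2 * r <= A * y + B * x.
  have h0 : 0 <= A * y + B * x by rewrite addr_ge0 ?mulr_ge0.
  have h1 : (2 * r) ^+ 2 <= (A * y + B * x) ^+ 2.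
    have := sqr_ge0 (A * y - B * x); nra.
  case: (lerP (2 * r) 0) => r0; first exact: le_trans r0 h0.
  by rewrite -(@ler_pXn2r _ 2) // nnegrE // ltW.
nra.
Qed.

End ComplexModulus.

(** * Riesz families in a Hilbert space *)

(** The form is only positive semidefinite, since functions equal almost everywhere are not
    identified; a vanishing squared norm plays the part of equality with 0. Completeness is asked
    for geometrically decreasing increments only, the form in which partial sums and Neumann series
    arise. *)
Record hilb {R : realType} (X : lmodType R[i]) (ip : X -> X -> R[i]) : Prop := Hilb {
  ip_lin : forall a f g h, ip (a *: f + g) h = a * ip f h + ip g h;
  ip_conj : forall f g, ip g f = conjc (ip f g);
  ip_ge0 : forall f, 0 <= complex.Re (ip f f);
  ip_complete : forall (F : nat -> X) (M : R),
    (forall n, complex.Re (ip (F n.+1 - F n) (F n.+1 - F n)) <= M * (4^-1) ^+ n) ->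
    exists f, forall e, 0 < e -> exists N, forall n, (N <= n)%N ->
      complex.Re (ip (F n - f) (F n - f)) <= e }.

Section Hilbert.
Context {R : realType} {X : lmodType R[i]} {ip : X -> X -> R[i]}.
Hypothesis H : hilb ip.
Implicit Types (f g h : X) (a b : R[i]).

(** This is the squared norm, so all constants in bounds below are squares of operator norms. *)
Definition nrm f : R := complex.Re (ip f f).

Lemma ipDl f g h : ip (f + g) h = ip f h + ip g h.
Proof. by have := ip_lin H 1 f g h; rewrite scale1r mul1r. Qed.
Lemma ip0l h : ip 0 h = 0.
Proof. by apply: (addIr (ip 0 h)); rewrite -ipDl !add0r. Qed.
Lemma ipZl a f h : ip (a *: f) h = a * ip f h.
Proof. by have := ip_lin H a f 0 h; rewrite addr0 ip0l addr0. Qed.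
Lemma ipNl f h : ip (- f) h = - ip f h.
Proof. by rewrite -scaleN1r ipZl mulN1r. Qed.
Lemma ipBl f g h : ip (f - g) h = ip f h - ip g h.
Proof. by rewrite ipDl ipNl. Qed.
Lemma ip_suml (I : Type) (s : seq I) (F : I -> X) h :
  ip (\sum_(i <- s) F i) h = \sum_(i <- s) ip (F i) h.
Proof. by elim/big_rec2: _ => [|i x y _ <-]; rewrite ?ip0l ?ipDl. Qed.
Lemma ip_sumlZ (I : Type) (s : seq I) (c : I -> R[i]) (F : I -> X) h :
  ip (\sum_(i <- s) c i *: F i) h = \sum_(i <- s) c i * ip (F i) h.
Proof. by rewrite ip_suml; apply: eq_bigr => i _; rewrite ipZl. Qed.
Lemma ipDr f g h : ip h (f + g) = ip h f + ip h g.
Proof. by rewrite (ip_conj H (f + g)) ipDl rmorphD /= -!(ip_conj H). Qed.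
Lemma ipZr a f h : ip h (a *: f) = conjc a * ip h f.
Proof. by rewrite (ip_conj H (a *: f)) ipZl rmorphM /= -(ip_conj H). Qed.
Lemma ipNr f h : ip h (- f) = - ip h f.
Proof. by rewrite (ip_conj H) ipNl rmorphN /= -(ip_conj H). Qed.

Lemma nrm_ge0 f : 0 <= nrm f. Proof. exact: ip_ge0 H f. Qed.

Lemma ip_self f : ip f f = ((nrm f)%:C)%C.
Proof.
apply: ceq => //=; have /(congr1 (@complex.Im _)) := ip_conj H f f.
by rewrite ImJ => h; lra.
Qed.

Lemma nrm_real f : sqmod (ip f f) = nrm f ^+ 2.
Proof. by rewrite ip_self sqmod_real. Qed.

Lemma nrmDr f g : nrm (f + g) = nrm f + nrm g + 2 * complex.Re (ip f g).
Proof.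
rewrite /nrm ipDl !ipDr !ReD (ip_conj H f g) ReJ; ring.
Qed.

Lemma nrmZ a f : nrm (a *: f) = sqmod a * nrm f.
Proof.
rewrite /nrm ipZl ipZr mulrA -sqmodE ip_self.
by rewrite ReM /= mulr0 subr0.
Qed.

Lemma nrmN f : nrm (- f) = nrm f.
Proof. by rewrite -scaleN1r nrmZ sqmodN sqmod1 mul1r. Qed.
Lemma nrmC f g : nrm (f - g) = nrm (g - f).
Proof. by rewrite -nrmN opprB. Qed.

Lemma nrmD f g : nrm (f + g) <= 2 * nrm f + 2 * nrm g.
Proof.
have := nrm_ge0 (f - g); rewrite nrmDr nrmDr nrmN ipNr ReN; lra.
Qed.

Lemma cauchy_schwarz f g : sqmod (ip f g) <= nrm f * nrm g.
Proof.
set z := ip f g.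
have key (t : R) : 0 <= nrm f + t ^+ 2 * sqmod z * nrm g - 2 * t * sqmod z.
  have := nrm_ge0 (f + (- ((t%:C)%C * z)) *: g).
  rewrite nrmDr nrmZ sqmodN sqmodM sqmod_real ipZr -/z rmorphN rmorphM /=.
  have -> : complex.Re (- (conjc (t%:C)%C * conjc z) * z) = - (t * sqmod z).
    by rewrite mulNr ReN -mulrA [conjc z * z]mulrC -sqmodE ReM /= !(mulr0, subr0, oppr0, mul0r).
  lra.
case: (eqVneq (nrm g) 0) => [g0|g0].
  rewrite g0 mulr0; case: (lerP (sqmod z) 0) => // z0.
  (* When [nrm g = 0] the right side of [key] is affine in [t]; this [t] gives it the value -1. *)
  have := key ((nrm f + 1) / (2 * sqmod z)).
  rewrite g0 mulr0 addr0.
  have -> : 2 * ((nrm f + 1) / (2 * sqmod z)) * sqmod z = nrm f + 1.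
    by field; rewrite gt_eqF.
  by move=> h; exfalso; lra.
have gp : 0 < nrm g by rewrite lt_def g0 nrm_ge0.
have := key ((nrm g)^-1).
have -> : nrm f + (nrm g)^-1 ^+ 2 * sqmod z * nrm g - 2 * (nrm g)^-1 * sqmod z =
   (nrm f * nrm g - sqmod z) / nrm g by field.
by rewrite pmulr_lge0 ?invr_gt0 // subr_ge0.
Qed.

Lemma ip_eq0 f g : nrm f = 0 -> ip f g = 0.
Proof.
move=> f0; apply: sqmod_eq0; apply/eqP; rewrite eq_le sqmod_ge0 andbT.
by apply: le_trans (cauchy_schwarz f g) _; rewrite f0 mul0r.
Qed.

Lemma le_small (x : R) : (forall e, 0 < e -> x <= e) -> x <= 0.
Proof. by move=> h; apply/ler_addgt0Pr => e e0; rewrite add0r; exact: h. Qed.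

Lemma ip_eq_lim f g (c : R[i]) :
  (forall e, 0 < e -> exists2 f', nrm (f - f') <= e & sqmod (ip f' g - c) <= e) ->
  ip f g = c.
Proof.
move=> h; apply/eqP; rewrite -subr_eq0; apply/eqP; apply: sqmod_eq0.
apply/eqP; rewrite eq_le sqmod_ge0 andbT; apply: le_small => e e0.
have k0 : 0 < 2 * nrm g + 2 by have := nrm_ge0 g; lra.
have [|f' h1 h2] := h (e / (2 * nrm g + 2)); first by rewrite divr_gt0.
have -> : ip f g - c = ip (f - f') g + (ip f' g - c) by rewrite ipBl addrA subrK.
apply: le_trans (sqmodD _ _) _.
have h3 : sqmod (ip (f - f') g) <= e / (2 * nrm g + 2) * nrm g.
  by apply: le_trans (cauchy_schwarz _ _) _; rewrite ler_wpM2r ?nrm_ge0.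
have : e = 2 * (e / (2 * nrm g + 2) * nrm g) + 2 * (e / (2 * nrm g + 2)).
  by field; rewrite gt_eqF.
lra.
Qed.

Section Families.
Context {I : choiceType}.
Implicit Types (e u : I -> X) (c : I -> R[i]) (s : seq I).

(** Square summability is expressed by finite duplicate-free lists, so [M] bounds the whole sum
    without an infinite sum over [I]. In these terms [bessel] and [lowerb] are the two frame
    inequalities and [interp] is the solvability of the moment problem. *)
Definition ell2 c (M : R) := forall s, uniq s -> \sum_(i <- s) sqmod (c i) <= M.
Definition bessel e (C : R) := forall f, ell2 (fun i => ip f (e i)) (C * nrm f).
Definition synbound e (C : R) := forall c s, uniq s ->
  nrm (\sum_(i <- s) c i *: e i) <= C * \sum_(i <- s) sqmod (c i).
Definition lowerb e (A : R) := forall f M, ell2 (fun i => ip f (e i)) M -> nrm f <= A * M.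
Definition interp e := forall c M, ell2 c M -> exists f, forall i, ip f (e i) = c i.
Definition biorth e u := forall i j, ip (u i) (e j) = if i == j then 1 else 0.

Lemma sum_sqmod_ge0 s c : 0 <= \sum_(i <- s) sqmod (c i).
Proof. by apply: sumr_ge0 => *; exact: sqmod_ge0. Qed.

Lemma ell2_ge0 c M : ell2 c M -> 0 <= M.
Proof. by move=> /(_ [::] isT); rewrite big_nil. Qed.

(** Synthesis is the adjoint of taking coefficients, so both have the same norm: pair the sum with
    itself and apply Cauchy-Schwarz to the coefficients. *)
Lemma bessel_synbound e C : 0 <= C -> bessel e C -> synbound e C.
Proof.
move=> C0 b c s us; set f := \sum_(i <- s) _.
have h : nrm f ^+ 2 <= (\sum_(i <- s) sqmod (c i)) * (C * nrm f).
  rewrite -nrm_real {1}/f ip_sumlZ; apply: le_trans (sum_cauchy _ _ _) _.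
  rewrite ler_wpM2l ?sum_sqmod_ge0 //; apply: le_trans (b f s us).
  by apply: ler_sum => i _; rewrite (ip_conj H f) sqmodJ.
have := nrm_ge0 f; rewrite le_eqVlt => /orP[/eqP <-|fp].
  by rewrite mulr_ge0 ?sum_sqmod_ge0.
by rewrite -(ler_pM2r fp) -expr2; apply: le_trans h _; rewrite mulrA [_ * C]mulrC.
Qed.

Lemma synbound_bessel e C : 0 <= C -> synbound e C -> bessel e C.
Proof.
move=> C0 b f s us; set S := \sum_(i <- s) _.
have S0 : 0 <= S by exact: sum_sqmod_ge0.
have h : S ^+ 2 <= nrm f * (C * S).
  have : ip f (\sum_(i <- s) ip f (e i) *: e i) = (S%:C)%C.
    rewrite (ip_conj H) ip_sumlZ rmorph_sum raddf_sum /=.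
    by apply: eq_bigr => i _; rewrite rmorphM /= mulrC -(ip_conj H) sqmodE.
  move=> h; have := cauchy_schwarz f (\sum_(i <- s) ip f (e i) *: e i).
  rewrite h sqmod_real => h2; apply: le_trans h2 _.
  by rewrite ler_wpM2l ?nrm_ge0 //; exact: b.
move: S0; rewrite le_eqVlt => /orP[/eqP <-|Sp]; first by rewrite mulr_ge0 ?nrm_ge0.
by rewrite -(ler_pM2r Sp) -expr2; apply: le_trans h _; rewrite mulrCA mulrA.
Qed.

Lemma sum_sub (V : zmodType) s t (F : I -> V) : uniq s -> uniq t -> {subset s <= t} ->
  \sum_(i <- t) F i = \sum_(i <- s) F i + \sum_(i <- [seq i <- t | i \notin s]) F i.
Proof.
move=> us ut st; rewrite (bigID (mem s)) /= -!(big_filter t); congr (_ + _).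
apply: perm_big; apply: uniq_perm; rewrite ?filter_uniq // => i.
by rewrite mem_filter; apply/andP/idP => [[]//|si]; split=> //; exact: st.
Qed.

(** A list whose sum is within [4^-k] of the supremum of all finite sums leaves a tail of at most
    [4^-k]. This is the rate that [ip_complete] accepts. *)
Lemma ell2_exhaust c M : ell2 c M ->
  exists t : nat -> seq I, (forall k, uniq (t k)) /\
    (forall k, {subset t k <= t k.+1}) /\
    forall k s, uniq s -> (forall i, i \in s -> i \notin t k) ->
      \sum_(i <- s) sqmod (c i) <= (4^-1) ^+ k.
Proof.
move=> cM; pose E : set R := [set x | exists2 s, uniq s & x = \sum_(i <- s) sqmod (c i)].
have supE : has_sup E.
  split; first by exists 0; exists [::] => //; rewrite big_nil.
  by exists M => _ [s us ->]; exact: cM.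
have tail (k : nat) : exists2 s, uniq s &
    forall t, uniq t -> (forall i, i \in t -> i \notin s) ->
      \sum_(i <- t) sqmod (c i) <= (4^-1) ^+ k.
  have k0 : 0 < (4^-1 : R) ^+ k by rewrite exprn_gt0 // invr_gt0.
  have [_ [s us ->] hs] := sup_adherent k0 supE.
  exists s => // t ut dst; have : E (\sum_(i <- s ++ t) sqmod (c i)).
    exists (s ++ t) => //; rewrite cat_uniq us ut andbT /=.
    by apply/hasPn => i /dst.
  move=> /(ub_le_sup (proj2 supE)); rewrite big_cat /=; lra.
have /choice[s hs] : forall k : nat, exists s, uniq s /\
   forall t, uniq t -> (forall i, i \in t -> i \notin s) ->
      \sum_(i <- t) sqmod (c i) <= (4^-1) ^+ k.
  by move=> k; have [s us hs] := tail k; exists s.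
(* Accumulating the lists makes them increasing and can only shrink the tails. *)
pose fix t (k : nat) : seq I := if k is k'.+1 then undup (t k' ++ s k) else s 0%N.
have ts k : {subset s k <= t k}.
  by case: k => [|k] i //= si; rewrite mem_undup mem_cat si orbT.
exists t; split; first by case=> [|k] /=; [exact: (hs 0%N).1 | exact: undup_uniq].
split; first by move=> k i /= ti; rewrite mem_undup mem_cat ti.
by move=> k r ur dr; apply: (hs k).2 => // i /dr; apply: contra; exact: ts.
Qed.

(** Convergence is unconditional: every finite list containing [s0] is good, so later arguments may
    enlarge a list by any index they want to test. *)
Lemma synthesis e C c M : 0 <= C -> synbound e C -> ell2 c M ->
  exists f, forall d : R, 0 < d -> exists2 s0, uniq s0 &
    forall s, uniq s -> {subset s0 <= s} -> nrm (f - \sum_(i <- s) c i *: e i) <= d.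
Proof.
move=> C0 b cM; have [t [ut [tS tl]]] := ell2_exhaust cM.
pose F k := \sum_(i <- t k) c i *: e i.
have step k s : uniq s -> {subset t k <= s} ->
    nrm (\sum_(i <- s) c i *: e i - F k) <= C * (4^-1) ^+ k.
  move=> us ks; rewrite (sum_sub _ (ut k) us ks) addrC addKr.
  apply: le_trans (b _ _ (filter_uniq _ us)) _; rewrite ler_wpM2l //.
  by apply: tl; [exact: filter_uniq | move=> i; rewrite mem_filter => /andP[]].
have [f hf] := ip_complete H (fun k => step k (t k.+1) (ut k.+1) (tS k)).
exists f => d d0.
have [N hN] := hf (d / 4) (divr_gt0 d0 (ltr0n _ 4)).
have [N' hN'] : exists N', C * (4^-1) ^+ N' <= d / 4.
  have : (4^-1 : R) ^+ n @[n --> \oo] --> 0.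
    by apply: cvg_expr; rewrite ger0_norm ?invr_ge0 // invf_lt1 // ltr1n.
  move=> /cvgr0Pnorm_lt /(_ (d / 4 / (C + 1))) [|n _ hn].
    by rewrite !divr_gt0 // ltr_wpDl.
  exists n; have := hn n (leqnn n); rewrite /= ger0_norm ?exprn_ge0 ?invr_ge0 // => hh.
  have C1 : 0 < C + 1 by lra.
  have -> : d / 4 = (C + 1) * (d / 4 / (C + 1)) by field; rewrite gt_eqF.
  by apply: ler_pM; rewrite ?exprn_ge0 ?invr_ge0 ?lerDl // ltW.
pose m := maxn N N'.
exists (t m) => // s us ms.
have -> : f - \sum_(i <- s) c i *: e i = (f - F m) + (F m - \sum_(i <- s) c i *: e i).
  by rewrite addrA subrK.
apply: le_trans (nrmD _ _) _; rewrite nrmC [X in _ + 2 * X]nrmC.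
have h1 := hN m (leq_maxl _ _).
have h2 : C * (4^-1) ^+ m <= d / 4.
  apply: le_trans hN'; rewrite ler_wpM2l // ler_wiXn2l ?invr_ge0 ?leq_maxr //.
  by rewrite invf_le1 // ler1n.
have h3 := step m s us ms.
rewrite -/(nrm (F m - f)) in h1; lra.
Qed.

Lemma sum_delta s j (F : I -> R[i]) : uniq s -> j \in s ->
  \sum_(i <- s) F i * (if i == j then 1 else 0) = F j.
Proof.
move=> us js; rewrite (bigD1_seq j) //= eqxx mulr1 big1 ?addr0 // => i /negPf ->.
by rewrite mulr0.
Qed.

Lemma synth_ip e u C c M : 0 <= C -> synbound u C -> ell2 c M -> biorth e u ->
  exists f, (forall d : R, 0 < d -> exists2 s0, uniq s0 &
    forall s, uniq s -> {subset s0 <= s} -> nrm (f - \sum_(i <- s) c i *: u i) <= d) /\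
   forall i, ip f (e i) = c i.
Proof.
move=> C0 b cM bi; have [f hf] := synthesis C0 b cM; exists f; split=> // j.
apply: ip_eq_lim => d d0; have [s0 us0 hs] := hf d d0.
exists (\sum_(i <- undup (j :: s0)) c i *: u i).
  by apply: hs; [exact: undup_uniq | move=> i si; rewrite mem_undup in_cons si orbT].
rewrite ip_sumlZ (eq_bigr (fun i => c i * (if i == j then 1 else 0))).
  by rewrite sum_delta ?undup_uniq ?mem_undup ?mem_head // subrr sqmod0 ltW.
by move=> i _; rewrite bi.
Qed.

Lemma ell2_sum c s : uniq s -> ell2 (fun i => if i \in s then c i else 0)
   (\sum_(i <- s) sqmod (c i)).
Proof.
move=> us r ur; rewrite (bigID (mem s)) /= [X in _ + X]big1 ?addr0; last first.
  by move=> i /negPf ->; rewrite sqmod0.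
rewrite (eq_bigr (fun i => sqmod (c i))); last by move=> i ->.
rewrite -big_filter (@sum_sub _ [seq i <- r | i \in s] s) ?filter_uniq //; last first.
  by move=> i; rewrite mem_filter => /andP[].
by rewrite lerDl sum_sqmod_ge0.
Qed.

(** Against [e], the sum has the coefficients [c i] on [s] and 0 elsewhere, and the lower bound of
    [e] turns these into a bound of the norm. *)
Lemma lowerb_synbound e u A : lowerb e A -> biorth e u -> synbound u A.
Proof.
move=> l bi c s us; apply: l => r ur.
rewrite (eq_bigr (fun i => sqmod (if i \in s then c i else 0))); first exact: ell2_sum.
move=> j _; congr sqmod; rewrite ip_sumlZ (eq_bigr (fun i => c i * (if i == j then 1 else 0))).
  case: ifPn => js; first by rewrite sum_delta.
  rewrite big_seq big1 // => i si; case: eqP => [ij|_]; last by rewrite mulr0.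
  by rewrite -ij si in js.
by move=> i _; rewrite bi.
Qed.

Lemma biorth_interp e u A : 0 <= A -> lowerb e A -> biorth e u -> interp e.
Proof.
move=> A0 l bi c M cM.
by have [f [_ hf]] := synth_ip A0 (lowerb_synbound l bi) cM bi; exists f.
Qed.

Lemma delta_ell2 j : ell2 (fun i : I => if i == j then 1 else 0) 1.
Proof.
move=> s us; case: (boolP (j \in s)) => js.
  rewrite (bigD1_seq j) //= eqxx sqmod1 big1 ?addr0 // => i /negPf ->.
  by rewrite sqmod0.
rewrite big_seq big1 // => i si; case: eqP => [ij|_]; last by rewrite sqmod0.
by rewrite -ij si in js.
Qed.

Lemma interp_biorth e : interp e -> exists u, biorth e u.
Proof.
move=> ie; have /choice[u hu] : forall i : I, exists f, forall j, ip f (e j) =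
    if j == i then 1 else 0 by move=> i; exact: ie (@delta_ell2 i).
by exists u => i j; rewrite hu eq_sym.
Qed.

Lemma lowerb_eq0 e A f : lowerb e A -> (forall i, ip f (e i) = 0) -> nrm f = 0.
Proof.
move=> l f0; apply/eqP; rewrite eq_le nrm_ge0 andbT -(mulr0 A); apply: l => s _.
by rewrite big1 // => i _; rewrite f0 sqmod0.
Qed.

(** The coefficient map of [e] is bounded, bounded below and onto l^2, that is, an isomorphism.
    These three properties can be checked separately for perturbed and glued families, where an
    invertible operator would be awkward to exhibit. *)
Record riesz e (C A : R) : Prop := Riesz {
  riesz_C0 : 0 <= C; riesz_A0 : 0 <= A;
  riesz_bessel : bessel e C; riesz_lower : lowerb e A; riesz_interp : interp e }.

Lemma riesz_expand e u C A f : riesz e C A -> biorth e u ->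
  forall d : R, 0 < d -> exists2 s0, uniq s0 & forall s, uniq s -> {subset s0 <= s} ->
    nrm (f - \sum_(i <- s) ip f (e i) *: u i) <= d.
Proof.
move=> [C0 A0 b l ie] bi d d0.
have [g [hg he]] := synth_ip A0 (lowerb_synbound l bi) (b f) bi.
have fg0 : nrm (f - g) = 0.
  by apply: (lowerb_eq0 l) => i; rewrite ipBl he subrr.
have [s0 us0 hs] := hg (d / 2) (divr_gt0 d0 (ltr0n _ 2)).
exists s0 => // s us ss.
rewrite -{1}[f](subrK g) -addrA; apply: le_trans (nrmD _ _) _.
rewrite fg0; have := hs s us ss; lra.
Qed.

(** Expanding [f] in [u], the product [ip f f] pairs the coefficients of [f] against [e] with those
    against [u]; Cauchy-Schwarz then yields the lower bound of [u] from the upper bound of [e]. The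
    two constants change places. *)
Lemma riesz_dual e u C A : riesz e C A -> biorth e u -> riesz u A C.
Proof.
move=> re bi; have [C0 A0 b l ie] := re.
have su := lowerb_synbound l bi.
have lu : lowerb u C.
  move=> f M fM; have M0 := ell2_ge0 fM.
  suff h : nrm f ^+ 2 <= C * nrm f * M.
    have := nrm_ge0 f; rewrite le_eqVlt => /orP[/eqP <-|fp]; first by rewrite mulr_ge0.
    by rewrite -(ler_pM2r fp) -expr2 mulrAC.
  apply/ler_addgt0Pr => d d0.
  have k0 : 0 < nrm f + 1 by have := nrm_ge0 f; lra.
  (* For small [t], [|(f,f)|^2 <= (1 + t) |(g,f)|^2 + (1 + 1/t) |(f-g,f)|^2]
     with [g] a partial sum of the expansion of [f]. *)
  have [t t0 ht] : exists2 t : R, 0 < t & t * (C * nrm f * M) <= d / 2.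
    have P0 : 0 <= C * nrm f * M by rewrite !mulr_ge0 ?nrm_ge0.
    exists (d / 2 / (C * nrm f * M + 1)); first by rewrite !divr_gt0 // ltr_wpDl.
    by rewrite mulrAC ler_pdivrMr ?ltr_wpDl // ler_wpM2l ?divr_ge0 ?ltW // ltrDl.
  pose k := (1 + t^-1) * (nrm f + 1).
  have kp : 0 < k by rewrite mulr_gt0 // addr_gt0 ?invr_gt0.
  have [s us hs] := riesz_expand f re bi (divr_gt0 (divr_gt0 d0 (ltr0n _ 2)) kp).
  have := hs s us (fun _ => id); set g := \sum_(i <- s) _ => hg.
  have fg : sqmod (ip g f) <= C * nrm f * M.
    rewrite ip_sumlZ; apply: le_trans (sum_cauchy _ _ _) _.
    apply: ler_pM; rewrite ?sum_sqmod_ge0 //; first exact: b.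
    by rewrite (eq_bigr (fun i => sqmod (ip f (u i)))) ?fM // => i _; rewrite (ip_conj H) sqmodJ.
  have dg : sqmod (ip (f - g) f) <= d / 2 / k * nrm f.
    by apply: le_trans (cauchy_schwarz _ _) _; rewrite ler_wpM2r ?nrm_ge0.
  have : sqmod (ip f f) <= (1 + t) * sqmod (ip g f) + (1 + t^-1) * sqmod (ip (f - g) f).
    have {1}-> : ip f f = ip (f - g) f + ip g f by rewrite -ipDl subrK.
    exact: sqmodD_weight.
  rewrite nrm_real => hf; apply: le_trans hf _.
  have t1 : 0 < t^-1 by rewrite invr_gt0.
  have h1 : (1 + t) * sqmod (ip g f) <= (1 + t) * (C * nrm f * M).
    by rewrite ler_wpM2l // addr_ge0 // ltW.
  have h2 : (1 + t^-1) * sqmod (ip (f - g) f) <= (1 + t^-1) * (d / 2 / k * nrm f).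
    by rewrite ler_wpM2l // addr_ge0 // ltW.
  have h3 : (1 + t^-1) * (d / 2 / k * nrm f) <= d / 2.
    have -> : (1 + t^-1) * (d / 2 / k * nrm f) = d / 2 * (nrm f / (nrm f + 1)).
      by rewrite /k; field; rewrite !gt_eqF //= addr_gt0.
    by rewrite ger_pMr ?divr_gt0 // ler_pdivrMr // mul1r lerDl ler01.
  lra.
split=> //; first exact: synbound_bessel su.
apply: (biorth_interp C0 lu (u := e)) => i j.
by rewrite (ip_conj H) bi eq_sym; case: eqP; rewrite ?conjc1 ?conjc0.
Qed.

Lemma riesz_biorth e C A : riesz e C A -> exists u, biorth e u.
Proof. by case=> _ _ _ _ /interp_biorth. Qed.

Lemma onb_nrm u s f : biorth u u -> uniq s ->
  nrm (f - \sum_(i <- s) ip f (u i) *: u i) = nrm f - \sum_(i <- s) sqmod (ip f (u i)).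
Proof.
move=> o us; set g := \sum_(i <- s) _.
have gu j : j \in s -> ip g (u j) = ip f (u j).
  move=> js; rewrite ip_sumlZ -[RHS](@sum_delta s j (fun i => ip f (u i))) //.
  by apply: eq_bigr => i _; rewrite o.
have gx h : ip g h = \sum_(i <- s) ip f (u i) * conjc (ip h (u i)).
  by rewrite ip_sumlZ; apply: eq_bigr => i _; rewrite (ip_conj H h).
have gf : ip g f = ((\sum_(i <- s) sqmod (ip f (u i)))%:C)%C.
  by rewrite gx rmorph_sum /=; apply: eq_bigr => i _; rewrite sqmodE.
have gg : ip g g = ((\sum_(i <- s) sqmod (ip f (u i)))%:C)%C.
  rewrite gx rmorph_sum /= big_seq [RHS]big_seq; apply: eq_bigr => i si.
  by rewrite sqmodE gu.
rewrite nrmDr nrmN ipNr ReN (ip_conj H g) ReJ gf /nrm gg /=; lra.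
Qed.

Lemma onb_bessel u : biorth u u -> bessel u 1.
Proof. by move=> o f s us; rewrite mul1r -subr_ge0 -onb_nrm //; exact: nrm_ge0. Qed.

Lemma onb_riesz u : biorth u u ->
  (forall f, (forall i, ip f (u i) = 0) -> nrm f = 0) -> riesz u 1 1.
Proof.
move=> o cu; have b := onb_bessel o.
have l : lowerb u 1.
  move=> f M fM.
  have [g [hg gu]] := synth_ip ler01 (bessel_synbound ler01 b) (b f) o.
  have fg0 : nrm (f - g) = 0 by apply: cu => i; rewrite ipBl gu subrr.
  rewrite mul1r; apply/ler_addgt0Pr => d d0.
  have [s us hs] := hg (d / 2) (divr_gt0 d0 (ltr0n _ 2)).
  have := onb_nrm f o us; rewrite -{1}[f](subrK g) -addrA.
  have := nrmD (f - g) (g - \sum_(i <- s) ip f (u i) *: u i).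
  have := fM s us; have := hs s us (fun _ => id); rewrite fg0; lra.
by split=> //; apply: biorth_interp o.
Qed.

(** The two coefficient maps differ by at most [d] in squared norm. In the lower bound the error
    [2 * d * A] is at most 1/8 and can be absorbed; surjectivity is a Neumann series whose squared
    residuals decay like [16^-k], faster than the [4^-k] that completeness asks for. *)
Lemma riesz_perturb e e' C A (d : R) : riesz e C A -> 0 <= d ->
  (forall f, ell2 (fun i => ip f (e i) - ip f (e' i)) (d * nrm f)) ->
  d * A <= 16^-1 ->
  riesz e' (2 * C + 2 * d) (4 * A).
Proof.
move=> [C0 A0 b l ie] d0 he dA.
have l' : lowerb e' (4 * A).
  move=> f M fM; have M0 := ell2_ge0 fM.
  have h : ell2 (fun i => ip f (e i)) (2 * (d * nrm f) + 2 * M).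
    move=> s us; have h1 := he f s us; have h2 := fM s us.
    apply: (@le_trans _ _ (2 * \sum_(i <- s) sqmod (ip f (e i) - ip f (e' i)) +
       2 * \sum_(i <- s) sqmod (ip f (e' i)))); last by lra.
    rewrite !mulr_sumr -big_split /=; apply: ler_sum => i _.
    by rewrite -{1}[ip f (e i)](subrK (ip f (e' i))); exact: sqmodD.
  have h1 := l f _ h; have h2 := nrm_ge0 f.
  have : d * A * nrm f <= 16^-1 * nrm f by rewrite ler_wpM2r.
  nra.
split=> //; [by lra|by lra| |].
  move=> f s us; have h1 := b f s us; have h2 := he f s us.
  apply: (@le_trans _ _ (2 * \sum_(i <- s) sqmod (ip f (e i)) +
     2 * \sum_(i <- s) sqmod (ip f (e i) - ip f (e' i)))); last by nra.
  rewrite !mulr_sumr -big_split /=; apply: ler_sum => i _.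
  have {1}-> : ip f (e' i) = ip f (e i) - (ip f (e i) - ip f (e' i)).
    by rewrite opprB addrC subrK.
  by apply: le_trans (sqmodD _ _) _; rewrite sqmodN.
move=> c M cM; have M0 := ell2_ge0 cM.
(* A right inverse of the coefficient map of [e], with the default value 0 off l^2. *)
have /choice[S hS] : forall c, exists f, forall M, ell2 c M -> forall i, ip f (e i) = c i.
  move=> c'; case: (pselect (exists M, ell2 c' M)) => [[M' /ie[f hf]]|nM].
    by exists f.
  by exists 0 => M' hM'; case: nM; exists M'.
(* The residual after [k] corrections: [c] minus the coefficients of the partial sum [F k] against
   [e'], as [Fe] confirms. *)
pose r k : I -> R[i] :=
  iter k (fun c' i => ip (S c') (e i) - ip (S c') (e' i)) c.
have rM k : ell2 (r k) (M * (16^-1) ^+ k) /\ nrm (S (r k)) <= A * (M * (16^-1) ^+ k).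
  have q0 n : 0 <= M * (16^-1 : R) ^+ n by rewrite mulr_ge0 ?exprn_ge0 ?invr_ge0.
  have aux c' M' : ell2 c' M' -> nrm (S c') <= A * M'.
    move=> hc; apply: l => s us.
    by rewrite (eq_bigr (fun i => sqmod (c' i))) ?hc // => i _; rewrite (hS _ _ hc).
  elim: k => [|k [IH1 IH2]]; first by rewrite expr0 mulr1; split=> //; exact: aux.
  have h : ell2 (r k.+1) (M * (16^-1) ^+ k.+1).
    move=> s us; apply: le_trans (he (S (r k)) s us) _.
    apply: (@le_trans _ _ (d * (A * (M * (16^-1) ^+ k)))); first by rewrite ler_wpM2l.
    have -> : M * (16^-1) ^+ k.+1 = 16^-1 * (M * (16^-1) ^+ k) by rewrite exprS mulrCA.
    by rewrite mulrA; apply: ler_wpM2r.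
  by split=> //; exact: aux.
pose F k := \sum_(j < k) S (r j).
have FM k : nrm (F k.+1 - F k) <= (A * M) * (4^-1) ^+ k.
  have -> : F k.+1 - F k = S (r k).
    by rewrite /F big_ord_recr /= [X in X - _]addrC addrK.
  apply: le_trans (rM k).2 _.
  rewrite mulrA ler_wpM2l ?mulr_ge0 // lerXn2r ?nnegrE ?invr_ge0 //.
  by rewrite lef_pV2 ?posrE // ler_nat.
have [f hf] := ip_complete H FM.
exists f => i; apply: ip_eq_lim => eps eps0.
have [N hN] := hf eps eps0.
have Fe k : ip (F k) (e' i) - c i = - r k i.
  elim: k => [|k IH]; first by rewrite /F big_ord0 ip0l sub0r.
  rewrite /F big_ord_recr /= ipDl -/(F k) addrAC IH.
  by rewrite (hS _ _ (rM k).1) opprB addrC.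
have [N' hN'] : exists N', M * (16^-1) ^+ N' <= eps.
  have : (16^-1 : R) ^+ n @[n --> \oo] --> 0.
    by apply: cvg_expr; rewrite ger0_norm ?invr_ge0 // invf_lt1 // ltr1n.
  move=> /cvgr0Pnorm_lt /(_ (eps / (M + 1))) [|n _ hn].
    by rewrite divr_gt0 // ltr_wpDl.
  exists n; have := hn n (leqnn n); rewrite /= ger0_norm ?exprn_ge0 ?invr_ge0 // => hh.
  have M1 : 0 < M + 1 by lra.
  have -> : eps = (M + 1) * (eps / (M + 1)) by field; rewrite gt_eqF.
  by apply: ler_pM; rewrite ?exprn_ge0 ?invr_ge0 ?lerDl // ltW.
exists (F (maxn N N')).
  by rewrite nrmC; apply: hN; rewrite leq_maxl.
rewrite Fe sqmodN; have := (rM (maxn N N')).1 [:: i] isT; rewrite big_seq1 => h.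
apply: le_trans h _; apply: le_trans hN'; rewrite ler_wpM2l //.
by rewrite ler_wiXn2l ?invr_ge0 ?leq_maxr // invf_le1 // ler1n.
Qed.

End Families.
End Hilbert.

(** * Complex-valued square-integrable functions *)

Lemma geom_sum_le {R : realType} (r : R) (n m : nat) : 0 <= r < 1 ->
  \sum_(n <= k < m) r ^+ k <= r ^+ n / (1 - r).
Proof.
move=> /andP[r0 r1]; case: (leqP n m) => [nm|/ltnW mn]; last first.
  by rewrite big_geq // divr_ge0 ?exprn_ge0 // subr_ge0 ltW.
have -> : \sum_(n <= k < m) r ^+ k = (r ^+ n - r ^+ m) / (1 - r).
  have r1' : 1 - r != 0 by rewrite subr_eq0 eq_sym lt_eqF.
  elim: m nm => [|m IH]; first by rewrite leqn0 => /eqP ->; rewrite big_geq // subrr mul0r.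
  rewrite leq_eqVlt => /orP[/eqP <-|]; first by rewrite big_geq // subrr mul0r.
  by rewrite ltnS => nm; rewrite big_nat_recr //= IH // exprS; field.
rewrite ler_wpM2r ?invr_ge0 ?subr_ge0 ?(ltW r1) //.
by rewrite gerDl oppr_le0 exprn_ge0.
Qed.

Section L2space.
Context {R : realType} {dsp : measure_display} {T : measurableType dsp}.
Variable mu : {measure set T -> \bar R}.
Implicit Types f g h : T -> R[i].

Definition mfunc f :=
  measurable_fun [set: T] (fun x => complex.Re (f x)) /\
  measurable_fun [set: T] (fun x => complex.Im (f x)).

Lemma mfuncD f g : mfunc f -> mfunc g -> mfunc (fun x => f x + g x).
Proof.
move=> [f1 f2] [g1 g2]; split.
  rewrite (_ : (fun x => _) = (fun x => complex.Re (f x)) \+ (fun x => complex.Re (g x))).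
    exact: measurable_funD.
  by apply/funext => x; rewrite ReD.
rewrite (_ : (fun x => _) = (fun x => complex.Im (f x)) \+ (fun x => complex.Im (g x))).
  exact: measurable_funD.
by apply/funext => x; rewrite ImD.
Qed.

Lemma mfuncM f g : mfunc f -> mfunc g -> mfunc (fun x => f x * g x).
Proof.
move=> [f1 f2] [g1 g2]; split.
  rewrite (_ : (fun x => _) = ((fun x => complex.Re (f x)) \* (fun x => complex.Re (g x))) \-
     ((fun x => complex.Im (f x)) \* (fun x => complex.Im (g x)))).
    by apply: measurable_funB; apply: measurable_realfun.measurable_funM.
  by apply/funext => x; rewrite ReM.
rewrite (_ : (fun x => _) = ((fun x => complex.Re (f x)) \* (fun x => complex.Im (g x))) \+
     ((fun x => complex.Im (f x)) \* (fun x => complex.Re (g x)))).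
  by apply: measurable_funD; apply: measurable_realfun.measurable_funM.
by apply/funext => x; rewrite ImM.
Qed.

Lemma mfunc_cst (a : R[i]) : mfunc (fun=> a).
Proof. by split; exact: measurable_cst. Qed.

Lemma mfuncJ f : mfunc f -> mfunc (fun x => conjc (f x)).
Proof.
move=> [f1 f2]; split.
  by rewrite (_ : (fun x => _) = (fun x => complex.Re (f x))) //; apply/funext => x; rewrite ReJ.
rewrite (_ : (fun x => _) = \- (fun x => complex.Im (f x))).
  exact: measurable_funN.
by apply/funext => x; rewrite ImJ.
Qed.

Lemma mfunc_sqmod f : mfunc f -> measurable_fun [set: T] (fun x => sqmod (f x)).
Proof.
move=> [f1 f2]; rewrite /sqmod; apply: measurable_funD;
  exact: measurable_funX.
Qed.

Lemma mfunc_Esqmod f : mfunc f -> measurable_fun [set: T] (EFin \o (fun x => sqmod (f x))).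
Proof. by move=> mf; apply/measurable_EFinP; exact: mfunc_sqmod. Qed.

Definition L2mu f := mfunc f /\ (\int[mu]_x (sqmod (f x))%:E < +oo)%E.

Definition cintegrable f :=
  mu.-integrable [set: T] (EFin \o (fun x => complex.Re (f x))) /\
  mu.-integrable [set: T] (EFin \o (fun x => complex.Im (f x))).

Definition cint f : R[i] :=
  Complex (\int[mu]_x complex.Re (f x)) (\int[mu]_x complex.Im (f x)).

Lemma cintD f g : cintegrable f -> cintegrable g ->
  cint (fun x => f x + g x) = cint f + cint g.
Proof.
move=> [f1 f2] [g1 g2]; apply: ceq; rewrite /= ?ReD ?ImD /=.
  by rewrite -RintegralD //; apply: eq_Rintegral => x _; rewrite ReD.
by rewrite -RintegralD //; apply: eq_Rintegral => x _; rewrite ImD.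
Qed.

Lemma cintegrableD f g : cintegrable f -> cintegrable g -> cintegrable (fun x => f x + g x).
Proof.
move=> [f1 f2] [g1 g2]; split.
  rewrite (_ : _ \o _ = (EFin \o (fun x => complex.Re (f x))) \+ (EFin \o (fun x => complex.Re (g x))))%E.
    exact: integrableD.
  by apply/funext => x /=; rewrite ReD.
rewrite (_ : _ \o _ = (EFin \o (fun x => complex.Im (f x))) \+ (EFin \o (fun x => complex.Im (g x))))%E.
  exact: integrableD.
by apply/funext => x /=; rewrite ImD.
Qed.

Lemma cintegrableZ (a : R[i]) f : cintegrable f -> cintegrable (fun x => a * f x).
Proof.
move=> [f1 f2]; have m := @measurableT _ T; split.
  rewrite (_ : _ \o _ = (fun x => (complex.Re a)%:E * (EFin \o (fun x => complex.Re (f x))) x) \-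
    (fun x => (complex.Im a)%:E * (EFin \o (fun x => complex.Im (f x))) x))%E.
    by apply: integrableB => //; exact: integrableZl.
  by apply/funext => x /=; rewrite ReM.
rewrite (_ : _ \o _ = (fun x => (complex.Re a)%:E * (EFin \o (fun x => complex.Im (f x))) x) \+
    (fun x => (complex.Im a)%:E * (EFin \o (fun x => complex.Re (f x))) x))%E.
  by apply: integrableD => //; exact: integrableZl.
by apply/funext => x /=; rewrite ImM.
Qed.

Lemma cintZ (a : R[i]) f : cintegrable f -> cint (fun x => a * f x) = a * cint f.
Proof.
move=> [f1 f2]; have m := @measurableT _ T.
have iZ k (g : T -> R) : mu.-integrable [set: T] (EFin \o g) ->
   mu.-integrable [set: T] (EFin \o (fun x => k * g x)).
  by move=> ig; exact: (integrableZl m k ig).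
apply: ceq; rewrite /= ?ReM ?ImM /=.
  rewrite -!RintegralZl // -RintegralB ?iZ //.
  by apply: eq_Rintegral => x _; rewrite ReM.
rewrite -!RintegralZl // -RintegralD ?iZ //.
by apply: eq_Rintegral => x _; rewrite ImM.
Qed.

Lemma cintJ f : cintegrable f -> cint (fun x => conjc (f x)) = conjc (cint f).
Proof.
move=> [f1 f2]; apply: ceq; rewrite /= ?ReJ ?ImJ /=.
  by apply: eq_Rintegral => x _; rewrite ReJ.
rewrite -[RHS]mulN1r -RintegralZl //; apply: eq_Rintegral => x _.
by rewrite ImJ mulN1r.
Qed.

Lemma eq_cint f g : f =1 g -> cint f = cint g.
Proof. by move=> /funext ->. Qed.

Lemma cint0 : cint (fun=> 0) = 0.
Proof. by rewrite /cint /Rintegral !integral0. Qed.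

Lemma L2muD f g : L2mu f -> L2mu g -> L2mu (fun x => f x + g x).
Proof.
move=> [mf lf] [mg lg]; split; first exact: mfuncD.
apply: (@le_lt_trans _ _ (\int[mu]_x (2%:E * (sqmod (f x))%:E + 2%:E * (sqmod (g x))%:E))%E).
  apply: ge0_le_integral => //.
  - by move=> x _; rewrite lee_fin sqmod_ge0.
  - by apply: mfunc_Esqmod; exact: mfuncD.
  - apply: emeasurable_funD; apply: emeasurable_funM => //; exact: mfunc_Esqmod.
  - by move=> x _; rewrite -!EFinM -EFinD lee_fin sqmodD.
rewrite ge0_integralD //; first last.
- apply: emeasurable_funM => //; exact: mfunc_Esqmod.
- by move=> x _; rewrite -EFinM lee_fin mulr_ge0 ?sqmod_ge0.
- apply: emeasurable_funM => //; exact: mfunc_Esqmod.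
- by move=> x _; rewrite -EFinM lee_fin mulr_ge0 ?sqmod_ge0.
rewrite !ge0_integralZl ?lee_fin //; try (by move=> x _; rewrite lee_fin sqmod_ge0);
  try exact: mfunc_Esqmod.
by rewrite lte_add_pinfty // lte_mul_pinfty ?lee_fin.
Qed.

Lemma L2mu_le f g (C : R) : mfunc f -> 0 <= C -> L2mu g ->
  (forall x, sqmod (f x) <= C * sqmod (g x)) -> L2mu f.
Proof.
move=> mf C0 [mg lg] h; split=> //.
apply: (@le_lt_trans _ _ (\int[mu]_x (C%:E * (sqmod (g x))%:E))%E).
  apply: ge0_le_integral => //.
  - by move=> x _; rewrite lee_fin sqmod_ge0.
  - exact: mfunc_Esqmod.
  - apply: emeasurable_funM => //; exact: mfunc_Esqmod.
  - by move=> x _; rewrite -!EFinM lee_fin.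
rewrite ge0_integralZl ?lee_fin //; try (by move=> x _; rewrite lee_fin sqmod_ge0);
  try exact: mfunc_Esqmod.
by rewrite lte_mul_pinfty ?lee_fin.
Qed.

Lemma L2muZ (a : R[i]) f : L2mu f -> L2mu (fun x => a * f x).
Proof.
move=> lf; apply: (L2mu_le (C := sqmod a) _ _ lf); rewrite ?sqmod_ge0 //.
  by apply: mfuncM; [exact: mfunc_cst | exact: lf.1].
by move=> x; rewrite sqmodM.
Qed.

Lemma L2mu0 : L2mu (fun=> 0).
Proof.
split; first exact: mfunc_cst.
by rewrite sqmod0 integral0.
Qed.

Lemma L2mu_int f : L2mu f -> (\int[mu]_x (sqmod (f x))%:E)%E =
  (fine (\int[mu]_x (sqmod (f x))%:E))%:E.
Proof.
move=> [_ lf]; rewrite fineK // ge0_fin_numE // integral_ge0 // => x _.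
by rewrite lee_fin sqmod_ge0.
Qed.

Lemma L2mu_integrable f : L2mu f -> mu.-integrable [set: T] (fun x => (sqmod (f x))%:E).
Proof.
move=> [mf lf]; apply/integrableP; split; first exact: mfunc_Esqmod.
under eq_integral do rewrite gee0_abs ?lee_fin ?sqmod_ge0 //.
by [].
Qed.

Lemma cintegrable_le f (h : T -> R) : mfunc f ->
  mu.-integrable [set: T] (EFin \o h) -> (forall x, sqmod (f x) <= h x ^+ 2) -> cintegrable f.
Proof.
move=> [f1 f2] ih hf; split; apply: (le_integrable _ _ _ ih) => //.
- exact/measurable_EFinP.
- move=> x _ /=; rewrite lee_fin -sqrtr_sqr -(sqrtr_sqr (h x)) ler_wsqrtr //.
  by apply: le_trans (hf x); exact: sqr_Re_le.
- exact/measurable_EFinP.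
- move=> x _ /=; rewrite lee_fin -sqrtr_sqr -(sqrtr_sqr (h x)) ler_wsqrtr //.
  by apply: le_trans (hf x); rewrite /sqmod lerDr sqr_ge0.
Qed.

Lemma L2mu_cintegrable f g : L2mu f -> L2mu g -> cintegrable (fun x => f x * conjc (g x)).
Proof.
move=> lf lg; apply: (@cintegrable_le _ (fun x => sqmod (f x) + sqmod (g x))).
- by apply: mfuncM; [exact: lf.1 | apply: mfuncJ; exact: lg.1].
- have := integrableD (@measurableT _ T) (L2mu_integrable lf) (L2mu_integrable lg).
  by congr (_.-integrable _ _).
- move=> x; rewrite sqmodM sqmodJ.
  have := sqmod_ge0 (f x); have := sqmod_ge0 (g x); nra.
Qed.

Definition L2ip f g := cint (fun x => f x * conjc (g x)).

Lemma L2ip_self f : L2mu f -> complex.Re (L2ip f f) = fine (\int[mu]_x (sqmod (f x))%:E).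
Proof.
move=> lf; rewrite /L2ip /cint /= /Rintegral; congr fine; apply: eq_integral => x _.
by rewrite -sqmodE.
Qed.

End L2space.

Lemma geom_small {R : realType} (M r e : R) : 0 <= M -> 0 <= r < 1 -> 0 < e ->
  exists N, forall n, (N <= n)%N -> M * r ^+ n <= e.
Proof.
move=> M0 /andP[r0 r1] e0.
have : (r ^+ n @[n --> \oo] --> (0 : R)) by apply: cvg_expr; rewrite ger0_norm.
move=> /cvgr0Pnorm_lt /(_ (e / (M + 1))) [|N _ hN]; first by rewrite divr_gt0 // ltr_wpDl.
exists N => n Nn; have := hN n Nn; rewrite /= ger0_norm ?exprn_ge0 // => h.
have -> : e = (M + 1) * (e / (M + 1)) by field; rewrite gt_eqF // ltr_wpDl.
by apply: ler_pM; rewrite ?exprn_ge0 ?lerDl // ltW.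
Qed.

(** * Completeness of L^2 (Riesz-Fischer) *)

Section L2Complete.
Context {R : realType} {dsp : measure_display} {T : measurableType dsp}.
Variable mu : {measure set T -> \bar R}.

Lemma mfunc_indic (A : set T) : measurable A ->
  mfunc (fun t => if `[< A t >] then 1 else 0 : R[i]).
Proof.
move=> mA; split; last first.
  rewrite (_ : (fun t => _) = cst 0) //.
  by apply/funext => t; case: ifP.
rewrite (_ : (fun t => _) = \1_A) //; apply/funext => t.
by rewrite indicE /mem /= /in_set /= ; case: ifP => h; rewrite /in_mem /= h.
Qed.

Lemma mfuncN (f : T -> R[i]) : mfunc f -> mfunc (fun t => - f t).
Proof.
move=> mf; rewrite (_ : (fun t => _) = (fun t => (- 1) * f t)).
  by apply: mfuncM => //; exact: mfunc_cst.
by apply/funext => t; rewrite mulN1r.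
Qed.

Lemma L2muB (f g : T -> R[i]) : L2mu mu f -> L2mu mu g -> L2mu mu (fun t => f t - g t).
Proof.
move=> lf lg; rewrite (_ : (fun t => _) = (fun t => f t + (- 1) * g t)).
  by apply: L2muD => //; exact: L2muZ.
by apply/funext => t; rewrite mulN1r.
Qed.

Lemma real_cauchy_cvg (x : nat -> R) (B : R) : 0 <= B ->
  (forall n m, (n <= m)%N -> (x m - x n) ^+ 2 <= B * (4 / 9) ^+ n) ->
  cvgn x.
Proof.
move=> B0 h; apply/cauchy_cvgP/cauchyP => e e0.
have q1 : 0 <= (4 / 9 : R) < 1 by apply/andP; split; lra.
have q2 : 0 < (e / 2) ^+ 2 by rewrite exprn_gt0 // divr_gt0.
have [N hN] := geom_small B0 q1 q2.
exists (x N); exists N => // m /= Nm.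
have := le_trans (h N m Nm) (hN N (leqnn N)).
rewrite -ball_normE /ball_ /= distrC => h2.
rewrite (@le_lt_trans _ _ (e / 2)) //; last by rewrite gtr_pMr // invf_lt1 // ltr1n.
rewrite -(@ler_pXn2r _ 2) ?nnegrE ?divr_ge0 ?(ltW e0) //.
rewrite real_normK ?num_real //; apply: h2.
Qed.

(** The squared increments are of order [4^-n]; weighting them by [(9/4)^n] leaves a convergent
    series of integrals, hence a function [G] finite almost everywhere, and [G] controls
    [sqmod (a m t - a n t)] with the geometric rate [(4/9)^n]. The second conclusion keeps the limit
    supported where the sequence is. *)
Lemma L2mu_complete (a : nat -> T -> R[i]) (M : R) :
  (forall n, L2mu mu (a n)) ->
  (forall n, fine (\int[mu]_t (sqmod (a n.+1 t - a n t))%:E) <= M * (4^-1) ^+ n) ->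
  exists f, [/\ L2mu mu f, (forall t, (forall n, a n t = 0) -> f t = 0) &
    forall n, fine (\int[mu]_t (sqmod (a n t - f t))%:E) <= 8 * M * (4 / 9) ^+ n].
Proof.
move=> la ha.
pose g n t := a n.+1 t - a n t.
have lg n : L2mu mu (g n).
  exact: L2muB.
have M0 : 0 <= M.
  have := ha 0%N; rewrite expr0 mulr1; apply: le_trans; apply: fine_ge0.
  by apply: integral_ge0 => t _; rewrite lee_fin sqmod_ge0.
pose w n t : \bar R := ((9 / 4) ^+ n * sqmod (g n t))%:E.
have w0 n t : (0 <= w n t)%E.
  by rewrite lee_fin mulr_ge0 ?exprn_ge0 ?divr_ge0 ?sqmod_ge0.
have mw n : measurable_fun [set: T] (w n).
  by apply/measurable_EFinP; apply: measurable_funM => //; apply: mfunc_sqmod; exact: (lg n).1.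
pose G t := (\sum_(0 <= n <oo) w n t)%E.
have G0 t : (0 <= G t)%E by exact: nneseries_ge0.
have mG : measurable_fun [set: T] G.
  by apply: ge0_emeasurable_sum.
have iG : (\int[mu]_t G t <= (3 * M)%:E)%E.
  rewrite /G integral_nneseries //.
  apply: lime_le; first by apply: is_cvg_nneseries => n _ _; exact: integral_ge0.
  apply: nearW => N.
  have -> : (\sum_(0 <= n < N) \int[mu]_t w n t =
     (\sum_(0 <= n < N) (9 / 4) ^+ n * fine (\int[mu]_t (sqmod (g n t))%:E))%:E)%E.
    rewrite -sumEFin; apply: eq_bigr => n _.
    rewrite EFinM -(L2mu_int (lg n)) -ge0_integralZl //.
    - by apply: mfunc_Esqmod; exact: (lg n).1.
    - by move=> t _; rewrite lee_fin sqmod_ge0.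
  rewrite lee_fin.
  apply: (@le_trans _ _ (\sum_(0 <= n < N) M * (9 / 16) ^+ n)).
    apply: ler_sum => n _.
    have -> : M * (9 / 16) ^+ n = (9 / 4) ^+ n * (M * (4^-1) ^+ n) :> R.
      by rewrite mulrCA -exprMn; congr (_ * _ ^+ _); field.
    by rewrite ler_wpM2l ?exprn_ge0 ?divr_ge0 //; exact: ha.
  rewrite -mulr_sumr [3 * M]mulrC ler_wpM2l //.
  have q1 : 0 <= (9 / 16 : R) < 1 by apply/andP; split; lra.
  by apply: le_trans (geom_sum_le 0 N q1) _; rewrite expr0 ler_pdivrMr; lra.
(* Cauchy-Schwarz with weights (2/3)^k. *)
have key t n m : (n <= m)%N -> ((sqmod (a m t - a n t))%:E <= (2 * (4 / 9) ^+ n)%:E * G t)%E.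
  move=> nm.
  have -> : a m t - a n t =
     \sum_(n <= k < m) ((((2 / 3) ^+ k)%:C)%C : R[i]) * ((((3 / 2) ^+ k)%:C)%C * g k t).
    rewrite (eq_bigr (fun k => a k.+1 t - a k t)); first by rewrite telescope_sumr.
    move=> k _; rewrite mulrA -rmorphM /= -exprMn.
    by rewrite (_ : 2 / 3 * (3 / 2) = 1 :> R) ?expr1n ?mul1r //; field.
  apply: (@le_trans _ _ ((2 * (4 / 9) ^+ n) * \sum_(n <= k < m) (9 / 4) ^+ k * sqmod (g k t))%:E).
    rewrite lee_fin; apply: le_trans (sum_cauchy _ _ _) _.
    apply: ler_pM; [by apply: sumr_ge0 => *; exact: sqmod_ge0| by apply: sumr_ge0 => *; exact: sqmod_ge0| |].
      rewrite (eq_bigr (fun k => (4 / 9) ^+ k)); last first.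
        by move=> k _; rewrite sqmod_real exprAC; congr (_ ^+ _); field.
      have q1 : 0 <= (4 / 9 : R) < 1 by apply/andP; split; lra.
      apply: le_trans (geom_sum_le n m q1) _.
      have : 0 <= (4 / 9 : R) ^+ n by rewrite exprn_ge0 // divr_ge0.
      by rewrite ler_pdivrMr; lra.
    apply: ler_sum => k _; rewrite sqmodM sqmod_real exprAC.
    by rewrite (_ : (3 / 2) ^+ 2 = 9 / 4 :> R) //; field.
  rewrite EFinM lee_wpmul2l ?lee_fin ?mulr_ge0 ?exprn_ge0 ?divr_ge0 //.
  rewrite -sumEFin; apply: le_trans (nneseries_lim_ge m _); last by move=> k _ _; exact: w0.
  by rewrite [leRHS](@big_cat_nat _ _ _ n) //= leeDr // sume_ge0.
pose E := [set t | (G t < +oo)%E].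
have mE : measurable E.
  have := emeasurable_fun_infty_o (measurableT) mG (+oo)%E.
  by rewrite setTI.
(* Where [G] is infinite the sequence is replaced by 0, so that a limit exists at every point and is
   measurable; the estimate [bound] is trivial there. *)
pose b n t : R[i] := a n t * (if `[< E t >] then 1 else 0).
have mone : mfunc (fun t => if `[< E t >] then 1 else 0 : R[i]).
  exact: mfunc_indic.
have mb n : mfunc (b n) by apply: mfuncM => //; exact: (la n).1.
have bcvg t : exists z : R[i], complex.Re (b n t) @[n --> \oo] --> complex.Re z /\
    complex.Im (b n t) @[n --> \oo] --> complex.Im z.
  rewrite /b; case: asboolP => Et; last first.
    by exists 0; split; under eq_fun do rewrite mulr0; exact: cvg_cst.
  have GF : G t \is a fin_num by rewrite ge0_fin_numE.
  have h n m : (n <= m)%N -> sqmod (a m t - a n t) <= 2 * fine (G t) * (4 / 9) ^+ n.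
    move=> nm; have := key t n m nm; rewrite -[X in (_ * X)%E](fineK GF) -EFinM lee_fin.
    by rewrite mulrAC.
  have B0 : 0 <= 2 * fine (G t) by rewrite mulr_ge0 // fine_ge0.
  have cr : cvgn (fun n => complex.Re (a n t)).
    apply: (real_cauchy_cvg B0) => n m nm; apply: le_trans (h n m nm).
    by rewrite -ReN -ReD; exact: sqr_Re_le.
  have ci : cvgn (fun n => complex.Im (a n t)).
    apply: (real_cauchy_cvg B0) => n m nm; apply: le_trans (h n m nm).
    by rewrite -ImN -ImD /sqmod lerDr sqr_ge0.
  exists (Complex (limn (fun n => complex.Re (a n t))) (limn (fun n => complex.Im (a n t)))).
  by split; under eq_fun do rewrite mulr1.
have /choice[f hf] := bcvg.
have mf : mfunc f.
  split.
    apply: (@measurable_fun_cvg _ _ _ _ (fun n t => complex.Re (b n t))); first by move=> n; exact: (mb n).1.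
    by move=> t _; exact: (hf t).1.
  apply: (@measurable_fun_cvg _ _ _ _ (fun n t => complex.Im (b n t))); first by move=> n; exact: (mb n).2.
  by move=> t _; exact: (hf t).2.
have bound n t : ((sqmod (a n t - f t))%:E <= (2 * (4 / 9) ^+ n)%:E * G t)%E.
  have [Et|Et] := pselect (E t); last first.
    have -> : G t = +oo%E by apply/eqP; rewrite -leye_eq leNgt; apply/negP.
    by rewrite gt0_muley ?leey // lte_fin mulr_gt0 // exprn_gt0 // divr_gt0.
  have GF : G t \is a fin_num by rewrite ge0_fin_numE.
  rewrite -[X in (_ * X)%E](fineK GF) -EFinM lee_fin.
  have [] := hf t; rewrite /b (asboolT Et).
  under eq_fun do rewrite mulr1; move=> hr; under eq_fun do rewrite mulr1; move=> hi.
  have cr : (complex.Re (a n t) - complex.Re (a m t)) ^+ 2 + (complex.Im (a n t) - complex.Im (a m t)) ^+ 2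
     @[m --> \oo] --> (complex.Re (a n t) - complex.Re (f t)) ^+ 2 +
       (complex.Im (a n t) - complex.Im (f t)) ^+ 2.
    by apply: cvgD; rewrite !expr2; apply: cvgM; apply: cvgB => //; exact: cvg_cst.
  have -> : sqmod (a n t - f t) = (complex.Re (a n t) - complex.Re (f t)) ^+ 2 +
       (complex.Im (a n t) - complex.Im (f t)) ^+ 2 by rewrite /sqmod ReD ImD ReN ImN.
  rewrite -(cvg_lim _ cr) //; apply: limr_le; first by apply/cvg_ex; eexists; exact: cr.
  exists n => // m /= nm; have := key t n m nm.
  rewrite -[X in (_ * X)%E](fineK GF) -EFinM lee_fin; apply: le_trans.
  by rewrite -sqmodN opprB /sqmod !(ReD, ImD, ReN, ImN).
have ibound n : (\int[mu]_t (sqmod (a n t - f t))%:E <= (8 * M * (4 / 9) ^+ n)%:E)%E.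
  apply: (@le_trans _ _ (\int[mu]_t ((2 * (4 / 9) ^+ n)%:E * G t))%E).
    apply: ge0_le_integral => //.
    - by move=> t _; rewrite lee_fin sqmod_ge0.
    - apply: mfunc_Esqmod; apply: mfuncD; first exact: (la n).1.
      exact: mfuncN.
    - exact: emeasurable_funM.
  have p0 : 0 <= 2 * (4 / 9 : R) ^+ n by rewrite mulr_ge0 // exprn_ge0 // divr_ge0.
  rewrite ge0_integralZl // ?lee_fin //.
  apply: (@le_trans _ _ ((2 * (4 / 9) ^+ n)%:E * (3 * M)%:E)%E).
    by rewrite lee_wpmul2l ?lee_fin.
  by rewrite -EFinM lee_fin; nra.
exists f; split.
- have l0 : L2mu mu (fun t => a 0%N t - f t).
    split; first by apply: mfuncD; [exact: (la 0%N).1 | exact: mfuncN].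
    by apply: le_lt_trans (ibound 0%N) _; rewrite ltry.
  rewrite (_ : f = (fun t => a 0%N t - (a 0%N t - f t))); first exact: L2muB.
  by apply/funext => t; rewrite opprB addrC subrK.
- move=> t at0; apply: ceq.
    have := (hf t).1; rewrite /b; under eq_fun do rewrite at0 mul0r.
    by move=> /cvg_lim <- //; exact: lim_cst.
  have := (hf t).2; rewrite /b; under eq_fun do rewrite at0 mul0r.
  by move=> /cvg_lim <- //; exact: lim_cst.
- move=> n; rewrite -lee_fin fineK ?ibound // ge0_fin_numE.
    by apply: le_lt_trans (ibound n) _; rewrite ltry.
  by apply: integral_ge0 => t _; rewrite lee_fin sqmod_ge0.
Qed.

End L2Complete.

(** * L^2 of a set as a Hilbert space *)

Section L2Hilbert.
Context {R : realType} {dsp : measure_display} {T : measurableType dsp}.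
Variable mu : {measure set T -> \bar R}.
Context {S : Type}.
Variables (phi : T -> S) (psi : S -> T).
Hypothesis phiK : cancel phi psi.
Variable A : set S.

Definition rs (f : S -> R[i]) : S -> R[i] := fun x => if `[< A x >] then f x else 0.

Definition L2S (f : S -> R[i]) : Prop := L2mu mu (fun t => rs f (phi t)).

Lemma rsD a f g x : rs (fun x => a * f x + g x) x = a * rs f x + rs g x.
Proof. by rewrite /rs; case: ifP; rewrite ?mulr0 ?addr0. Qed.

Lemma L2S_lin a f g : L2S f -> L2S g -> L2S (fun x => a * f x + g x).
Proof.
move=> lf lg; rewrite /L2S; under eq_fun do rewrite rsD.
by apply: L2muD => //; exact: L2muZ.
Qed.

Definition L2pred : {pred S -> R[i]^o} := fun f => `[< L2S f >].

Fact L2pred_submod : submod_closed L2pred.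
Proof.
split.
  apply/asboolP; rewrite /L2S (_ : (fun t => _) = (fun=> 0)); first exact: L2mu0.
  by apply/funext => t; rewrite /rs; case: ifP.
by move=> a f g /asboolP lf /asboolP lg; apply/asboolP; exact: L2S_lin.
Qed.

HB.instance Definition _ := GRing.isSubmodClosed.Build _ _ L2pred L2pred_submod.

(** A subtype of the functions on [S], not a quotient. Values off [A] are arbitrary and invisible to
    the form, which cuts them off through [rs]. *)
Record L2t := MkL2 { l2val : S -> R[i]^o; l2P : l2val \in L2pred }.

HB.instance Definition _ := [isSub for l2val].
HB.instance Definition _ := [Choice of L2t by <:].
HB.instance Definition _ := [SubChoice_isSubLmodule of L2t by <:].

Lemma l2inP (f : L2t) : L2S (l2val f).
Proof. exact/asboolP/(l2P f). Qed.

Definition mkL2 f (lf : L2S f) : L2t := MkL2 (introT (asboolP _) lf).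

Definition sip (f g : S -> R[i]) : R[i] :=
  L2ip mu (fun t => rs f (phi t)) (fun t => rs g (phi t)).
Definition l2ip (f g : L2t) : R[i] := sip (l2val f) (l2val g).

Lemma sip_lin a f g h : L2S f -> L2S g -> L2S h ->
  sip (fun x => a * f x + g x) h = a * sip f h + sip g h.
Proof.
move=> lf lg lh; rewrite /sip /L2ip.
transitivity (cint mu (fun t => a * (rs f (phi t) * conjc (rs h (phi t))) +
  rs g (phi t) * conjc (rs h (phi t)))).
  by apply: eq_cint => t; rewrite rsD mulrDl mulrA.
have ifh := L2mu_cintegrable lf lh; have igh := L2mu_cintegrable lg lh.
by rewrite cintD ?cintZ //; exact: cintegrableZ.
Qed.

Lemma sip_conj f g : L2S f -> L2S g -> sip g f = conjc (sip f g).
Proof.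
move=> lf lg; rewrite /sip /L2ip -cintJ; last exact: L2mu_cintegrable.
by apply: eq_cint => t; rewrite rmorphM /= conjcK mulrC.
Qed.

Lemma sip_self f : L2S f ->
  complex.Re (sip f f) = fine (\int[mu]_t (sqmod (rs f (phi t)))%:E).
Proof. exact: L2ip_self. Qed.

Lemma l2_hilb : @hilb R (L2t : lmodType R[i]) l2ip.
Proof.
split.
- by move=> a f g h; apply: sip_lin; exact: l2inP.
- by move=> f g; apply: sip_conj; exact: l2inP.
- move=> f; rewrite /l2ip sip_self; last exact: l2inP.
  by apply: fine_ge0; apply: integral_ge0 => t _; rewrite lee_fin sqmod_ge0.
move=> F M hF.
pose a n t := rs (l2val (F n)) (phi t).
have rsB f g x : rs (fun y => f y - g y) x = rs f x - rs g x.
  by rewrite /rs; case: ifP; rewrite ?subr0.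
have la n : L2mu mu (a n) by exact: l2inP.
have [|f [lf f0 hf]] := @L2mu_complete _ _ _ mu a M la.
  move=> n; apply: le_trans (hF n).
  rewrite /l2ip sip_self; last exact: l2inP.
  by under [in leRHS]eq_integral do rewrite rsB.
have fA t : rs (f \o psi) (phi t) = f t.
  rewrite /rs /= phiK; case: ifPn => // nA; rewrite f0 // => n.
  by rewrite /a /rs (negbTE nA).
have lF : L2S (f \o psi) by rewrite /L2S; under eq_fun do rewrite fA.
exists (mkL2 lF) => e e0.
have M0 : 0 <= 8 * M.
  have := hf 0%N; rewrite expr0 mulr1; apply: le_trans; apply: fine_ge0.
  by apply: integral_ge0 => t _; rewrite lee_fin sqmod_ge0.
have q1 : 0 <= (4 / 9 : R) < 1 by apply/andP; split; lra.
have [N hN] := geom_small M0 q1 e0; exists N => n Nn.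
apply: le_trans (hN n Nn); apply: le_trans (hf n).
rewrite /l2ip sip_self; last exact: l2inP.
by under [in leLHS]eq_integral do rewrite rsB fA.
Qed.

End L2Hilbert.

(** * Lebesgue measure on tuples *)

Section PushforwardIso.
Context {d1 d2 : measure_display} {T1 : measurableType d1} {T2 : measurableType d2} {R : realType}.
Variables (nu : {measure set T1 -> \bar R}) (f : T1 -> T2) (g : T2 -> T1).
Hypothesis snu : sigma_finite [set: T1] nu.
Hypotheses (mf : measurable_fun [set: T1] f) (mg : measurable_fun [set: T2] g).
Hypotheses (fK : cancel f g) (gK : cancel g f).

Definition pushiso (_ : cancel g f) : set T2 -> \bar R := pushforward nu f.

Fact pushiso0 : pushiso gK set0 = 0%E.
Proof. by rewrite /pushiso /pushforward preimage_set0 measure0. Qed.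

Fact pushiso_ge0 A : (0 <= pushiso gK A)%E.
Proof. exact: measure_ge0. Qed.

Fact pushiso_sigma_additive : semi_sigma_additive (pushiso gK).
Proof.
move=> F mF tF mUF; rewrite /pushiso /pushforward preimage_bigcup.
apply: measure_semi_sigma_additive.
- by move=> n; rewrite -[X in measurable X]setTI; exact: mf.
- apply/trivIsetP => /= i j _ _ ij; rewrite -preimage_setI.
  by move/trivIsetP : tF => /(_ _ _ _ _ ij) ->//; rewrite preimage_set0.
- by rewrite -preimage_bigcup -[X in measurable X]setTI; exact: mf.
Qed.

HB.instance Definition _ := isMeasure.Build _ _ _ (pushiso gK)
  pushiso0 pushiso_ge0 pushiso_sigma_additive.

Fact pushiso_sigma_finite : sigma_finite [set: T2] (pushiso gK).
Proof.
have [F FT mF] := snu; exists (fun n => g @^-1` F n).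
  by rewrite -preimage_bigcup -FT preimage_setT.
move=> n; split; first by rewrite -[X in measurable X]setTI; apply: mg => //; exact: (mF n).1.
rewrite /pushiso /pushforward (_ : f @^-1` (g @^-1` F n) = F n); first exact: (mF n).2.
by apply/seteqP; split => x /=; rewrite fK.
Qed.

HB.instance Definition _ := Measure_isSigmaFinite.Build _ _ _ (pushiso gK) pushiso_sigma_finite.

(** The inverse [g] carries the pieces of finite measure over to [T2], so the image measure is again
    sigma-finite and can enter a further product. *)
Lemma ex_pushforward : exists mu : {sigma_finite_measure set T2 -> \bar R},
  forall h : T2 -> \bar R, measurable_fun [set: T2] h -> (forall x, 0 <= h x)%E ->
    (\int[mu]_x h x = \int[nu]_x h (f x))%E.
Proof.
exists [the {sigma_finite_measure set T2 -> \bar R} of pushiso gK] => h mh h0.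
transitivity (\int[pushforward nu f]_x h x)%E; last by rewrite ge0_integral_pushforward.
by apply: eq_measure_integral => A mA _.
Qed.
End PushforwardIso.

Lemma product_sigma_finite d1 d2 (T1 : measurableType d1) (T2 : measurableType d2)
    (R : realType) (m1 : {sigma_finite_measure set T1 -> \bar R})
    (m2 : {sigma_finite_measure set T2 -> \bar R}) : sigma_finite setT (m1 \x m2)%E.
Proof.
have /sigma_finiteP[F [TF ndF Foo]] := sigma_finiteT m1.
have /sigma_finiteP[G [TG ndG Goo]] := sigma_finiteT m2.
exists (fun n => F n `*` G n).
  apply/seteqP; split=> [[x y] _|//].
  have [n _ Fx] : (\bigcup_i F i) x by rewrite -TF.
  have [k _ Gy] : (\bigcup_i G i) y by rewrite -TG.
  exists (maxn n k) => //; split => /=.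
    by move: x Fx; exact/subsetPset/ndF/leq_maxl.
  by move: y Gy; exact/subsetPset/ndG/leq_maxr.
move=> k; have [? ?] := Foo k; have [? ?] := Goo k.
split; first exact: measurableX.
by rewrite product_measure1E // lte_mul_pinfty // ge0_fin_numE.
Qed.

Section TupleMeasure.
Context {R : realType}.

Definition tcons n (p : measurableTypeR R * n.-tuple R) : n.+1.-tuple R := [tuple of p.1 :: p.2].

Lemma measurable_tcons n : measurable_fun [set: measurableTypeR R * n.-tuple R] (@tcons n).
Proof.
have h : measurable_fun [set: measurableTypeR R * n.-tuple R] (fun p => (p.1 : R)).
  exact: (@measurable_fst _ _ (measurableTypeR R) (n.-tuple R)).
exact: (measurable_cons h (@measurable_snd _ _ _ _)).
Qed.

Definition tuncons n (t : n.+1.-tuple R) : measurableTypeR R * n.-tuple R := (thead t, [tuple of behead t]).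

Lemma tconsK n : cancel (@tcons n) (@tuncons n).
Proof. by move=> [x t]; rewrite /tuncons /tcons theadE; congr pair; apply: val_inj. Qed.
Lemma tunconsK n : cancel (@tuncons n) (@tcons n).
Proof. by move=> t; rewrite /tcons [RHS]tuple_eta. Qed.

Lemma measurable_tuncons n : measurable_fun [set: n.+1.-tuple R] (@tuncons n).
Proof.
apply/measurable_fun_pairP; split.
  exact: (@measurable_tnth _ _ _ ord0 : measurable_fun _ (fun t : n.+1.-tuple R => thead t : R)).
exact: measurable_behead.
Qed.

Lemma measurable_tcons_sect d (T : measurableType d) n (g : n.+1.-tuple R -> T) (x : R) :
  measurable_fun [set: n.+1.-tuple R] g ->
  measurable_fun [set: n.-tuple R] (fun t => g (tcons (x, t))).
Proof.
move=> mg; apply: (measurableT_comp mg).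
have h : measurable_fun [set: n.-tuple R] (cst x : _ -> R) by [].
exact: (measurable_cons h (@measurable_id _ _ _)).
Qed.

(** The statement integrates over R^d by iteration, without a measure. The measure follows the same
    recursion, a Dirac mass in dimension 0 and then the image of a product under [tcons]; Tonelli's
    theorem identifies the two integrals. *)
Lemma ex_tuple_measure n : exists mu : {sigma_finite_measure set (n.-tuple R) -> \bar R},
  forall g : n.-tuple R -> \bar R, measurable_fun [set: n.-tuple R] g -> (forall x, 0 <= g x)%E ->
    iint g = (\int[mu]_x g x)%E.
Proof.
elim: n => [|n [mu IH]].
  exists [the {sigma_finite_measure set (0.-tuple R) -> \bar R} of \d_([tuple] : 0.-tuple R)].
  by move=> g mg g0 /=; rewrite integral_dirac // diracT mul1e.
have [mu' hmu'] := ex_pushforward (product_sigma_finite (@lebesgue_measure R) mu)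
  (@measurable_tcons n) (@measurable_tuncons n) (@tconsK n) (@tunconsK n).
exists mu' => g mg g0 /=.
rewrite hmu' // fubini_tonelli1 /=; last first.
- by move=> x; exact: g0.
- by apply: measurableT_comp => //; exact: measurable_tcons.
apply: eq_integral => x _; rewrite /fubini_F /= IH //.
exact: measurable_tcons_sect.
Qed.

Definition tmu n : {sigma_finite_measure set (n.-tuple R) -> \bar R} :=
  sval (cid (ex_tuple_measure n)).

Lemma iintE n (g : n.-tuple R -> \bar R) : measurable_fun [set: n.-tuple R] g ->
  (forall x, 0 <= g x)%E -> iint g = (\int[tmu n]_x g x)%E.
Proof. exact: (svalP (cid (ex_tuple_measure n))). Qed.

Lemma ge0_integral_tcons n (g : n.+1.-tuple R -> \bar R) :
  measurable_fun [set: n.+1.-tuple R] g -> (forall x, 0 <= g x)%E ->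
  (\int[tmu n.+1]_x g x = \int[(@lebesgue_measure R \x tmu n)]_p g (tcons p))%E.
Proof.
move=> mg g0; rewrite -iintE // fubini_tonelli1 /=; last first.
- by move=> x; exact: g0.
- by apply: measurableT_comp => //; exact: measurable_tcons.
apply: eq_integral => x _; rewrite /fubini_F /= -iintE //.
exact: measurable_tcons_sect.
Qed.

Lemma integral_tcons n (g : n.+1.-tuple R -> \bar R) :
  measurable_fun [set: n.+1.-tuple R] g ->
  (\int[tmu n.+1]_x g x = \int[(@lebesgue_measure R \x tmu n)]_p g (tcons p))%E.
Proof.
move=> mg; rewrite [LHS]integralE [RHS]integralE.
have h1 := measurable_funepos mg; have h2 := measurable_funeneg mg.
by congr (_ - _)%E; rewrite ge0_integral_tcons //; apply: eq_integral => p _; rewrite !(funeposE, funenegE).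
Qed.

End TupleMeasure.

(** * Fubini's theorem for complex functions and for tuples *)

Section ComplexFubini.
Context {d1 d2 : measure_display} {T1 : measurableType d1} {T2 : measurableType d2} {R : realType}.
Variables (m1 : {sigma_finite_measure set T1 -> \bar R}) (m2 : {sigma_finite_measure set T2 -> \bar R}).

Lemma integrable_inner (f : T1 * T2 -> \bar R) :
  (m1 \x m2)%E.-integrable [set: T1 * T2] f ->
  m2.-integrable [set: T2] (fun y => \int[m1]_x f (x, y))%E.
Proof.
move=> fi; have mf := measurable_int _ fi.
have mG := measurable_fubini_G fi.
apply/integrableP; split=> //.
have := (integrable21ltyP m1 m2 mf).1 fi; apply: le_lt_trans.
have maf : measurable_fun [set: T1 * T2] (fun z => `|f z|%E) by exact: measurableT_comp.
apply: ge0_le_integral => //.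
- exact: measurableT_comp.
- exact: (@measurable_fun_fubini_tonelli_G _ _ T1 T2 R m1 (abse \o f) maf (fun x => abse_ge0 _)).
- move=> y _; apply: le_abse_integral => //; exact: measurableT_comp.
Qed.

Lemma Rfubini (f : T1 * T2 -> R) :
  (m1 \x m2)%E.-integrable [set: T1 * T2] (EFin \o f) ->
  m2.-integrable [set: T2] (EFin \o (fun y => \int[m1]_x f (x, y))) /\
  \int[(m1 \x m2)%E]_z f z = \int[m2]_y \int[m1]_x f (x, y).
Proof.
move=> fi; have Gi := integrable_inner fi.
pose G y := (\int[m1]_x (f (x, y))%:E)%E.
have mG : measurable_fun [set: T2] G by exact: measurable_fubini_G fi.
have mfG : measurable_fun [set: T2] (EFin \o (fun y => \int[m1]_x f (x, y))).
  by apply/measurable_EFinP; apply: measurableT_comp => //; exact: measurable_fine.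
(* The real-valued integral applies [fine], which alters the inner integral only where it is
   infinite, on a null set. *)
have ae : ae_eq m2 [set: T2] (EFin \o (fun y => \int[m1]_x f (x, y))) G.
  have := integrable_ae measurableT Gi; apply: filterS => y h _ /=.
  by rewrite /Rintegral fineK //; exact: h.
split; last by rewrite /Rintegral -(integral21_prod_meas1 fi); congr fine; rewrite -(ae_eq_integral _ _ _ _ _ ae).
apply/integrableP; split=> //.
have /integrableP[_] := Gi; congr (_ < _)%E.
apply: ae_eq_integral => //; [exact: measurableT_comp|exact: measurableT_comp|].
apply: filterS ae => y h yT; have -> := h yT; by [].
Qed.

Lemma cint_fubini (f : T1 * T2 -> R[i]) : cintegrable (m1 \x m2)%E f ->
  cintegrable m2 (fun y => cint m1 (fun x => f (x, y))) /\
  cint (m1 \x m2)%E f = cint m2 (fun y => cint m1 (fun x => f (x, y))).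
Proof.
move=> [f1 f2]; have [i1 e1] := Rfubini f1; have [i2 e2] := Rfubini f2.
by split; [split | rewrite /cint /= e1 e2].
Qed.

End ComplexFubini.

Section TupleFubini.
Context {R : realType}.
Let leb := @lebesgue_measure R.

Lemma integrable_tcons n (g : n.+1.-tuple R -> \bar R) :
  (tmu n.+1).-integrable [set: n.+1.-tuple R] g ->
  (leb \x tmu n)%E.-integrable [set: measurableTypeR R * n.-tuple R] (g \o @tcons R n).
Proof.
move=> /integrableP[mg gi]; apply/integrableP; split.
  by apply: measurableT_comp => //; exact: measurable_tcons.
by move: gi; rewrite ge0_integral_tcons //; exact: measurableT_comp.
Qed.

Lemma cint_tcons n (f : n.+1.-tuple R -> R[i]) : cintegrable (tmu n.+1) f ->
  cintegrable (tmu n) (fun y => cint leb (fun x => f (tcons (x, y)))) /\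
  cint (tmu n.+1) f = cint (tmu n) (fun y => cint leb (fun x => f (tcons (x, y)))).
Proof.
move=> [f1 f2]; have h1 := integrable_tcons f1; have h2 := integrable_tcons f2.
have [h e] := @cint_fubini _ _ _ _ R leb (tmu n) (f \o @tcons R n) (conj h1 h2).
split=> //; rewrite -e /cint; congr Complex; rewrite /Rintegral integral_tcons //.
  exact: (measurable_int _ f1).
exact: (measurable_int _ f2).
Qed.

Lemma ge0_integral_tcons2 n (g : n.+1.-tuple R -> \bar R) :
  measurable_fun [set: n.+1.-tuple R] g -> (forall x, 0 <= g x)%E ->
  (\int[tmu n.+1]_x g x = \int[tmu n]_y \int[leb]_x g (tcons (x, y)))%E.
Proof.
move=> mg g0; rewrite ge0_integral_tcons // fubini_tonelli2 //.
by apply: measurableT_comp => //; exact: measurable_tcons.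
Qed.

Lemma measurable_tcons_sect2 d (T : measurableType d) n (g : n.+1.-tuple R -> T) (y : n.-tuple R) :
  measurable_fun [set: n.+1.-tuple R] g ->
  measurable_fun [set: measurableTypeR R] (fun x => g (tcons (x, y))).
Proof.
move=> mg; apply: (measurableT_comp mg).
have h : measurable_fun [set: measurableTypeR R] (fun x => (x : R)) by exact: measurable_id.
exact: (measurable_cons h (measurable_cst y)).
Qed.

End TupleFubini.

(** * Fourier series on an interval of length one *)

Section Characters1.
Context {R : realType}.
Implicit Types r x : R.

(** The character exp(2 i pi r). *)
Definition ch1 r : R[i] := Complex (cos (2 * pi * r)) (sin (2 * pi * r)).

Lemma ch1E r : ch1 r = Complex (cos (2 * pi * r)) (sin (2 * pi * r)).
Proof. by []. Qed.

Lemma ch1D r x : ch1 (r + x) = ch1 r * ch1 x.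
Proof.
by apply: ceq; rewrite ?ReM ?ImM /ch1 /= mulrDr ?cosD ?sinD // addrC [_ * sin _]mulrC mulrC.
Qed.

Lemma ch10 : ch1 0 = 1.
Proof. by rewrite /ch1 mulr0 cos0 sin0. Qed.

Lemma ch1N r : ch1 (- r) = conjc (ch1 r).
Proof. by apply: ceq; rewrite ?ReJ ?ImJ /ch1 /= mulrN ?cosN ?sinN. Qed.

Lemma sqmod_ch1 r : sqmod (ch1 r) = 1.
Proof. by rewrite /sqmod /= cos2Dsin2. Qed.

Lemma ch1_nat (n : nat) : ch1 n%:R = 1.
Proof.
elim: n => [|n IH]; first exact: ch10.
rewrite -natr1 ch1D IH mul1r /ch1 mulr1 [2 * pi]mulrC -[pi * 2]/(pi * 2%:R) mulr_natr.
by rewrite cos2pi sin2pi.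
Qed.

Lemma ch1_int (n : int) : ch1 n%:~R = 1.
Proof.
case: n => n; first exact: ch1_nat.
by rewrite NegzE mulrNz ch1N ch1_nat conjc1.
Qed.

Lemma mfunc_ch1 d (T : measurableType d) (g : T -> R) :
  measurable_fun [set: T] g -> mfunc (fun t => ch1 (g t)).
Proof.
move=> mg.
have mg' : measurable_fun [set: T] (fun t => 2 * pi * g t) by exact: measurable_funM.
split; rewrite /ch1 /=.
  apply: (@measurableT_comp _ _ _ _ _ _ cos _ _ _ mg').
  by apply: continuous_measurable_fun => z; exact: continuous_cos.
apply: (@measurableT_comp _ _ _ _ _ _ sin _ _ _ mg').
by apply: continuous_measurable_fun => z; exact: continuous_sin.
Qed.

Lemma is_derive_sinM (c x : R) : is_derive x 1 (fun x => sin (c * x)) (c * cos (c * x)).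
Proof.
have h : is_derive x 1 (fun x => c * x) (c * 1) by apply: is_deriveZ.
have := @is_derive1_comp R sin (fun x => c * x) x _ _ (is_derive_sin _) h.
by rewrite mulr1 mulrC.
Qed.

Lemma is_derive_cosM (c x : R) : is_derive x 1 (fun x => cos (c * x)) (- (c * sin (c * x))).
Proof.
have h : is_derive x 1 (fun x => c * x) (c * 1) by apply: is_deriveZ.
have := @is_derive1_comp R cos (fun x => c * x) x _ _ (is_derive_cos _) h.
by rewrite mulr1 mulNr mulrC.
Qed.

Lemma integral_deriv (f F : R -> R) (a b : R) : a < b -> continuous f ->
  (forall x, is_derive x 1 F (f x)) ->
  \int[lebesgue_measure]_(x in `]a, b]) f x = F b - F a.
Proof.
move=> ab cf dF.
have cF x : {for x, continuous F}.
  by apply/differentiable_continuous/derivable1_diffP; have [] := dF x.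
rewrite /Rintegral integral_itv_obnd_cbnd; last first.
  apply/measurable_EFinP; apply: (measurable_funS measurableT) => //.
  exact: continuous_measurable_fun.
rewrite (@continuous_FTC2 _ f F) //.
- exact: continuous_subspaceT.
- split.
  + by move=> x _; have [] := dF x.
  + by apply: cvg_at_right_filter; exact: cF.
  + by apply: cvg_at_left_filter; exact: cF.
- by move=> x _; rewrite derive1E; have [_ ->] := dF x.
Qed.

End Characters1.

#[global] Opaque ch1.

Section BoundedMultiplier.
Context {R : realType} {dsp : measure_display} {T : measurableType dsp}.
Variable mu : {measure set T -> \bar R}.

Lemma cintegrable_mfunc (g : T -> R[i]) : cintegrable mu g -> mfunc g.
Proof.
by case=> g1 g2; split; apply/measurable_EFinP; [exact: (measurable_int _ g1)|exact: (measurable_int _ g2)].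
Qed.

Lemma cintegrable_bounded (g f : T -> R[i]) (M : R) : cintegrable mu g -> mfunc f ->
  (forall x, sqmod (f x) <= M) -> cintegrable mu (fun x => g x * f x).
Proof.
move=> cg mf fM; have mg := cintegrable_mfunc cg.
have [g1 g2] := cg.
apply: (@cintegrable_le _ _ _ _ _ (fun x => (M + 1) * (`|complex.Re (g x)| + `|complex.Im (g x)|))).
- exact: mfuncM.
- have h := integrableD (@measurableT _ T) (integrable_abse g1) (integrable_abse g2).
  have := integrableZl (@measurableT _ T) (M + 1) h.
  by congr (_.-integrable _ _).
- move=> x; rewrite sqmodM mulrC exprMn.
  have M0 : 0 <= M by apply: le_trans (fM x); exact: sqmod_ge0.
  apply: ler_pM; rewrite ?sqmod_ge0 //.
    by apply: le_trans (fM x) _; nra.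
  rewrite /sqmod -(real_normK (num_real (complex.Re _))) -(real_normK (num_real (complex.Im _))).
  have := normr_ge0 (complex.Re (g x)); have := normr_ge0 (complex.Im (g x)); nra.
Qed.

Lemma cint_rs (A : set T) (f : T -> R[i]) : cint mu (rs A f) =
  Complex (\int[mu]_(x in A) complex.Re (f x)) (\int[mu]_(x in A) complex.Im (f x)).
Proof.
rewrite /cint; congr Complex; rewrite [RHS]Rintegral_mkcond; apply: eq_Rintegral => x _;
  by rewrite /rs patchE /mem /= /in_mem /= /in_set; case: ifP.
Qed.

Lemma mfunc_rs (A : set T) (f : T -> R[i]) : measurable A -> mfunc f -> mfunc (rs A f).
Proof.
move=> mA mf; rewrite (_ : rs A f = fun x => f x * (if `[< A x >] then 1 else 0)).
  by apply: mfuncM => //; exact: mfunc_indic.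
by apply/funext => x; rewrite /rs; case: ifP; rewrite ?mulr1 ?mulr0.
Qed.

Lemma L2mu_rs (A : set T) (f : T -> R[i]) (M : R) : measurable A -> (mu A < +oo)%E ->
  mfunc f -> 0 <= M -> (forall x, sqmod (f x) <= M) -> L2mu mu (rs A f).
Proof.
move=> mA Aoo mf M0 fM; have mAf := mfunc_rs mA mf; split=> //.
apply: (@le_lt_trans _ _ (\int[mu]_x (M%:E * (\1_A x)%:E))%E).
  apply: ge0_le_integral => //.
  - by move=> x _; rewrite lee_fin sqmod_ge0.
  - exact: mfunc_Esqmod.
  - by apply/measurable_EFinP; apply: measurable_funM => //; exact: measurable_indic.
  - move=> x _; rewrite -EFinM lee_fin /rs indicE; case: asboolP => h.
      by rewrite mem_set // mulr1.
    by rewrite sqmod0 mulr_ge0.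
rewrite ge0_integralZl ?lee_fin //; last by apply/measurable_EFinP; exact: measurable_indic.
by rewrite integral_indic // setIT lte_mul_pinfty ?lee_fin.
Qed.

End BoundedMultiplier.

Lemma bernoulli_le {R : realType} (x : R) (m : nat) : -1 <= x -> 1 + m%:R * x <= (1 + x) ^+ m.
Proof.
move=> x1; elim: m => [|m IH]; first by rewrite mul0r addr0 expr0.
rewrite exprS; apply: (@le_trans _ _ ((1 + x) * (1 + m%:R * x))).
  rewrite -natr1; have : 0 <= m%:R * x ^+ 2 by rewrite mulr_ge0 ?sqr_ge0.
  nra.
by rewrite ler_wpM2l //; lra.
Qed.

(* [(1 - u^n)^(2^n)] approximates the indicator of [u < 1/2] on [0, 1]. *)
Lemma step_approx_lo {R : realType} (u : R) : 0 <= u < 2^-1 ->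
  (1 - u ^+ n) ^+ (2 ^ n) @[n --> \oo] --> (1 : R).
Proof.
move=> /andP[u0 u2].
have c : (1 - (2 * u) ^+ n) @[n --> \oo] --> (1 : R).
  rewrite -[X in _ --> X]subr0; apply: cvgB; first exact: cvg_cst.
  by apply: cvg_expr; rewrite ger0_norm; lra.
have c1 : (fun _ : nat => 1 : R) @ \oo --> (1 : R) by exact: cvg_cst.
apply: (squeeze_cvgr _ c c1); apply: nearW => n.
have un0 : 0 <= u ^+ n by rewrite exprn_ge0.
have un1 : u ^+ n <= 1 by rewrite exprn_ile1 //; lra.
apply/andP; split; last by rewrite exprn_ile1 //; lra.
apply: le_trans (bernoulli_le (2 ^ n) _); last by lra.
by rewrite exprMn natrX mulrN.
Qed.

(** The product of [(1 - u^n)^(2^n)] and [(1 + u^n)^(2^n)] is at most 1, and by Bernoulli the second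
    factor is at least [(2 u)^n], which tends to infinity. *)
Lemma step_approx_hi {R : realType} (u : R) : 2^-1 < u <= 1 ->
  (1 - u ^+ n) ^+ (2 ^ n) @[n --> \oo] --> (0 : R).
Proof.
move=> /andP[u2 u1].
have c : ((2 * u)^-1 ^+ n) @[n --> \oo] --> (0 : R).
  by apply: cvg_expr; rewrite ger0_norm ?invr_ge0 ?invf_lt1 //; lra.
have c0 : (fun _ : nat => 0 : R) @ \oo --> (0 : R) by exact: cvg_cst.
apply: (squeeze_cvgr _ c0 c); apply: nearW => n.
have un0 : 0 <= u ^+ n by rewrite exprn_ge0 //; lra.
have un1 : u ^+ n <= 1 by rewrite exprn_ile1 //; lra.
apply/andP; split; first by rewrite exprn_ge0 //; lra.
have p0 : 0 < (2 * u) ^+ n by rewrite exprn_gt0 //; lra.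
rewrite exprVn -(ler_pM2r p0) mulVf ?gt_eqF //.
apply: (@le_trans _ _ ((1 - u ^+ n) ^+ (2 ^ n) * (1 + u ^+ n) ^+ (2 ^ n))).
  rewrite ler_wpM2l ?exprn_ge0 //; first lra.
  apply: le_trans (bernoulli_le (2 ^ n) _); last by lra.
  by rewrite exprMn natrX; lra.
rewrite -exprMn exprn_ile1 //; nra.
Qed.

(** On the circle of length 1, []b, y[] is the arc of radius [(y - b) / 2] around its midpoint, and
    the cosine of the distance to the midpoint separates the arc from the rest of the period. *)
Lemma cos_arc {R : realType} (b y x : R) : b < y < b + 1 -> b < x < b + 1 ->
  (x < y -> cos (2 * pi * ((y - b) / 2)) < cos (2 * pi * (x - (b + y) / 2))) /\
  (y < x -> cos (2 * pi * (x - (b + y) / 2)) < cos (2 * pi * ((y - b) / 2))).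
Proof.
move=> /andP[by1 by2] /andP[bx1 bx2].
have p0 := pi_gt0 R.
have decr (s t : R) : 0 <= s -> s < t -> t <= 2^-1 -> cos (2 * pi * t) < cos (2 * pi * s).
  move=> s0 st t2; rewrite ltr_cos; first by rewrite ltr_pM2l // mulr_gt0.
    by rewrite in_itv /=; apply/andP; split; nra.
  by rewrite in_itv /=; apply/andP; split; nra.
split=> xy.
  case: (lerP 0 (x - (b + y) / 2)) => h; first by apply: decr; lra.
  by rewrite -[X in _ < X]cosN -mulrN; apply: decr; lra.
case: (lerP (x - (b + y) / 2) 2^-1) => h; first by apply: decr; lra.
(* Beyond half a period the distance is measured the other way round the circle. *)
have -> : cos (2 * pi * (x - (b + y) / 2)) = cos (2 * pi * (1 - (x - (b + y) / 2))).
  move: (x - _) => z; rewrite [in RHS]mulrBr mulr1 cosB [2 * pi]mulrC mulr_natr cos2pi sin2pi.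
  by rewrite mul1r mul0r addr0.
by apply: decr; lra.
Qed.

Lemma itv_oc_lty {R : realType} (a b : R) : (@lebesgue_measure R [set` `]a, b]] < +oo)%E.
Proof. by rewrite lebesgue_measure_itv /=; case: ifP => // _; rewrite -EFinB ltry. Qed.

Section Fourier.
Context {R : realType}.
Local Notation leb := (@lebesgue_measure R).
Variable b : R.
Let A : set (measurableTypeR R) := [set` `]b, b + 1]].

Lemma unit_itv_measurable : measurable A. Proof. exact: measurable_itv. Qed.

Lemma unit_itv_measure : leb A = 1%E.
Proof.
rewrite /A lebesgue_measure_itv /= lte_fin ltrDl ltr01.
by rewrite -EFinB addrC addKr.
Qed.

Lemma exp_orth (k : int) :
  cint leb (rs A (fun x => ch1 (k%:~R * x))) = if k == 0 then 1 else 0.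
Proof.
rewrite cint_rs; case: eqP => [->|/eqP k0].
  have -> : \int[leb]_(x in A) complex.Re (ch1 (0%:~R * x)) = 1.
    rewrite (@eq_Rintegral _ _ _ _ _ (cst 1)); last by move=> x _; rewrite mul0r ch10.
    rewrite Rintegral_cst ?mul1r; last exact: unit_itv_measurable.
    exact: (congr1 fine unit_itv_measure).
  rewrite (@eq_Rintegral _ _ _ _ _ (cst 0)); last by move=> x _; rewrite mul0r ch10.
  by rewrite Rintegral_cst ?mul0r //; exact: unit_itv_measurable.
have bb : b < b + 1 by rewrite ltrDl.
have p0 := pi_gt0 R.
pose c : R := 2 * pi * k%:~R.
have c0 : c != 0 by rewrite !mulf_neq0 // ?intr_eq0 // gt_eqF.
have per : ch1 (k%:~R * (b + 1)) = ch1 (k%:~R * b) by rewrite mulrDr mulr1 ch1D ch1_int mulr1.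
have [pc ps] : cos (c * (b + 1)) = cos (c * b) /\ sin (c * (b + 1)) = sin (c * b).
  by move: per; rewrite !ch1E !mulrA => -[].
congr Complex.
  rewrite (@eq_Rintegral _ _ _ _ _ (fun x : measurableTypeR R => cos (c * x))); last first.
    by move=> x _; rewrite ch1E /= mulrA.
  have cC : continuous (fun x : R => cos (c * x)).
    move=> x; apply: continuous_comp; last exact: continuous_cos.
    exact: mulrl_continuous.
  have dC (x : R) : is_derive x 1 (fun x => c^-1 * sin (c * x)) (cos (c * x)).
    have := @is_deriveZ _ _ _ (fun x => sin (c * x)) c^-1 x 1 _ (is_derive_sinM c x).
    by rewrite /GRing.scale /= mulrA mulVf // mul1r.
  by apply: etrans (integral_deriv bb cC dC) _; rewrite ps subrr.
rewrite (@eq_Rintegral _ _ _ _ _ (fun x : measurableTypeR R => sin (c * x))); last first.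
  by move=> x _; rewrite ch1E /= mulrA.
have cS : continuous (fun x : R => sin (c * x)).
  move=> x; apply: continuous_comp; last exact: continuous_sin.
  exact: mulrl_continuous.
have dS (x : R) : is_derive x 1 (fun x => (- c^-1) * cos (c * x)) (sin (c * x)).
  have := @is_deriveZ _ _ _ (fun x => cos (c * x)) (- c^-1) x 1 _ (is_derive_cosM c x).
  by rewrite /GRing.scale /= mulrNN mulrA mulVf // mul1r.
by apply: etrans (integral_deriv bb cS dS) _; rewrite pc subrr.
Qed.

Section Complete.
Variable g : measurableTypeR R -> R[i].
Hypothesis cg : cintegrable leb g.
Hypothesis gA : forall x, ~ A x -> g x = 0.
Hypothesis g0 : forall k : int, cint leb (fun x => g x * ch1 (k%:~R * x)) = 0.

(** The bounded multipliers [f] for which [g * f] remains orthogonal to every character. They form a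
    vector space containing 1 and stable under characters, hence all trigonometric polynomials. *)
Let N (f : R -> R[i]) := [/\ mfunc (f : measurableTypeR R -> R[i]),
  exists M, forall x, sqmod (f x) <= M &
  forall k : int, cint leb (fun x => g x * (f x * ch1 (k%:~R * x))) = 0].

Let mch (k : R) : mfunc (fun x : measurableTypeR R => ch1 (k * x)).
Proof.
apply: (@mfunc_ch1 R _ (measurableTypeR R) (fun x => k * x)).
by apply: measurable_funM => //; exact: measurable_id.
Qed.

Let N_int f k : N f -> cintegrable leb (fun x => g x * (f x * ch1 (k * x))).
Proof.
move=> [mf [M fM] _]; apply: (@cintegrable_bounded _ _ _ _ _ _ M) => //.
  by apply: mfuncM.
by move=> x; rewrite sqmodM sqmod_ch1 mulr1.
Qed.

Let N1 : N (fun=> 1).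
Proof.
split; [exact: mfunc_cst|by exists 1 => x; rewrite sqmod1|move=> k].
by rewrite -[RHS](g0 k); apply: eq_cint => x; rewrite mul1r.
Qed.

Let ND f h : N f -> N h -> N (fun x => f x + h x).
Proof.
move=> Nf Nh; have [mf [M fM] f0] := Nf; have [mh [K hK] h0] := Nh; split.
- exact: mfuncD.
- exists (2 * M + 2 * K) => x; apply: le_trans (sqmodD _ _) _.
  by apply: lerD; rewrite ler_wpM2l.
- move=> k; transitivity (cint leb (fun x => g x * (f x * ch1 (k%:~R * x)) + g x * (h x * ch1 (k%:~R * x)))).
    by apply: eq_cint => x; rewrite mulrDl mulrDr.
  by rewrite cintD ?f0 ?h0 ?addr0 //; exact: N_int.
Qed.

Let NZ (a : R[i]) f : N f -> N (fun x => a * f x).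
Proof.
move=> Nf; have [mf [M fM] f0] := Nf; split.
- by apply: mfuncM => //; exact: mfunc_cst.
- by exists (sqmod a * M) => x; rewrite sqmodM ler_wpM2l ?sqmod_ge0.
- move=> k; transitivity (cint leb (fun x => a * (g x * (f x * ch1 (k%:~R * x))))).
    by apply: eq_cint => x; rewrite -mulrA mulrCA.
  by rewrite cintZ ?f0 ?mulr0 //; exact: N_int.
Qed.

Let Nch (n : int) f : N f -> N (fun x => ch1 (n%:~R * x) * f x).
Proof.
move=> Nf; have [mf [M fM] f0] := Nf; split.
- exact: mfuncM.
- by exists M => x; rewrite sqmodM sqmod_ch1 mul1r.
- move=> k; rewrite -(f0 (n + k)); apply: eq_cint => x.
  by rewrite intrD mulrDl ch1D mulrA [f x * _]mulrCA !mulrA.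
Qed.

(** A trigonometric polynomial of degree 1 which, for [s] a cosine, has values in [0, 1] and is
    below 1/2 exactly where [cos (2 * pi * (x - t))] exceeds [s]. Feeding it to the step
    approximation cuts out an arc by trigonometric polynomials. *)
Let tau (s t : R) x : R := 2^-1 + (s - cos (2 * pi * (x - t))) / 4.

Let tauE s t x : ((tau s t x)%:C)%C =
  ((2^-1 + s / 4)%:C)%C + (((- 8^-1)%:C)%C * ch1 (- t)) * ch1 (1%:~R * x) +
  (((- 8^-1)%:C)%C * ch1 t) * ch1 ((- 1)%:~R * x) :> R[i].
Proof.
rewrite -!mulrA -!ch1D mul1r mulN1r /tau.
have -> : t - x = - (x - t) by rewrite opprB.
rewrite [- t + x]addrC ch1N; apply: ceq; rewrite !(cE, ch1E) /=; last by lra.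
by lra.
Qed.

Let Ntau s t f : N f -> N (fun x => ((tau s t x)%:C)%C * f x).
Proof.
move=> Nf; under eq_fun do rewrite tauE 2!mulrDl -!mulrA.
apply: (ND (ND _ _)); [exact: NZ | do 2 apply: NZ; exact: Nch | do 2 apply: NZ; exact: Nch].
Qed.

Let NtauX s t f n : N f -> N (fun x => ((tau s t x ^+ n)%:C)%C * f x).
Proof.
move=> Nf; elim: n => [|n IH].
  by under eq_fun do rewrite expr0 mul1r.
under eq_fun do rewrite exprS rmorphM /= -mulrA; exact: Ntau.
Qed.

Let Nstep s t n m : N (fun x => (((1 - tau s t x ^+ n) ^+ m)%:C)%C).
Proof.
elim: m => [|m IH]; first by under eq_fun do rewrite expr0.
have h x : (((1 - tau s t x ^+ n) ^+ m.+1)%:C)%C =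
  (((1 - tau s t x ^+ n) ^+ m)%:C)%C + (- 1) * (((tau s t x ^+ n)%:C)%C * (((1 - tau s t x ^+ n) ^+ m)%:C)%C) :> R[i].
  by rewrite mulN1r -rmorphM -rmorphB /= exprS mulrBl mul1r.
under eq_fun do rewrite h.
by apply: ND => //; apply: NZ; exact: NtauX.
Qed.

(** The polynomials [q n] are orthogonal to [g] and tend to the indicator of []b, y[], except
    perhaps at [y] and [b + 1]; dominated convergence with [|h|] as majorant passes to the limit. *)
Let part_int (h : R -> R) : (h = (fun x => complex.Re (g x)) \/ h = (fun x => complex.Im (g x))) ->
  forall y, b < y < b + 1 -> \int[leb]_(x in [set` `]b, y[]) h x = 0.
Proof.
move=> hE y /andP[by1 by2].
have hi : leb.-integrable [set: measurableTypeR R] (EFin \o h).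
  by case: hE => ->; [exact: cg.1 | exact: cg.2].
have hA x : ~ A x -> h x = 0 by move=> nA; case: hE => ->; rewrite gA.
pose s := cos (2 * pi * ((y - b) / 2)); pose t := (b + y) / 2.
pose q n x := (1 - tau s t x ^+ n) ^+ (2 ^ n).
have q0 n : \int[leb]_x (h x * q n x) = 0.
  have [_ _ /(_ 0)] := Nstep s t n (2 ^ n).
  rewrite /cint => -[r0 i0]; case: hE => ->.
    rewrite -[RHS]r0; apply: eq_Rintegral => x _.
    by rewrite mul0r ch10 mulr1 ReM /= mulr0 subr0.
  rewrite -[RHS]i0; apply: eq_Rintegral => x _.
  by rewrite mul0r ch10 mulr1 ImM /= mulr0 add0r.
have tau01 x : 0 <= tau s t x <= 1.
  have := cos_geN1 (2 * pi * ((y - b) / 2)); have := cos_le1 (2 * pi * ((y - b) / 2)).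
  have := cos_geN1 (2 * pi * (x - t)); have := cos_le1 (2 * pi * (x - t)).
  by rewrite /tau /s => *; apply/andP; split; lra.
pose J : set (measurableTypeR R) := [set` `]b, y[].
have mJ : measurable J by exact: measurable_itv.
have mh : measurable_fun [set: measurableTypeR R] h by apply/measurable_EFinP; exact: (measurable_int _ hi).
have mq n : measurable_fun [set: measurableTypeR R] (q n).
  have [[mq _] _ _] := Nstep s t n (2 ^ n); exact: mq.
have lim : \forall x \ae leb, (h x * q n x)%:E @[n --> \oo] --> (h x * \1_J x)%:E.
  exists [set y; b + 1]; split; first exact: measurableU.
    apply: countable_lebesgue_measure0; apply: finite_set_countable; exact: finite_set2.
  move=> x /= nx; apply: contrapT => /not_orP[xy xb]; apply: nx.
  apply: cvg_EFin; first exact: nearW.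
  case: (pselect (A x)) => Ax; last first.
    by rewrite hA // mul0r; under eq_fun do rewrite /= mul0r; exact: cvg_cst.
  apply: cvgM; first exact: cvg_cst.
  have xb1 : b < x < b + 1.
    move: Ax; rewrite /A /= in_itv /= => /andP[-> ]; rewrite le_eqVlt => /orP[/eqP //|->//].
  have [cl cr] := cos_arc (introT andP (conj by1 by2)) xb1.
  have /andP[t0 t1] := tau01 x.
  case: (ltgtP x y) => // [xly|yx].
    have -> : \1_J x = 1 :> R by rewrite indicE mem_set // /J /= in_itv /= xly (andP xb1).1.
    apply: step_approx_lo; rewrite t0 /tau /=; have := cl xly; rewrite -/s -/t; lra.
  have -> : \1_J x = 0 :> R.
    rewrite indicE memNset // /J /= in_itv /= => /andP[_]; by rewrite ltNge (ltW yx).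
  apply: step_approx_hi; rewrite t1 andbT /tau /=; have := cr yx; rewrite -/s -/t; lra.
have mhJ : measurable_fun [set: measurableTypeR R] (EFin \o (fun x => h x * \1_J x)).
  by apply/measurable_EFinP; apply: measurable_funM => //; exact: measurable_indic.
have mhq n : measurable_fun [set: measurableTypeR R] (EFin \o (fun x => h x * q n x)).
  by apply/measurable_EFinP; apply: measurable_funM.
have dom x (n : nat) : (`|(EFin \o (fun x => h x * q n x)%R) x| <= (abse \o (EFin \o h)) x)%E.
  have /andP[t0 t1] := tau01 x.
  have u0 : 0 <= tau s t x ^+ n by rewrite exprn_ge0.
  have u1 : tau s t x ^+ n <= 1 by rewrite exprn_ile1.
  rewrite /= lee_fin normrM -[leRHS]mulr1 ler_wpM2l //.
  by rewrite ger0_norm /q ?exprn_ile1 ?exprn_ge0 //; lra.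
have lim' : \forall x \ae leb, setT x -> (h x * q n x)%:E @[n --> \oo] --> (h x * \1_J x)%:E.
  by apply: (@filterS _ _ (ae_filter_ringOfSetsType leb)) lim.
have dom' : \forall x \ae leb, forall n : nat, setT x ->
    (`|(EFin \o (fun x => h x * q n x)%R) x| <= (abse \o (EFin \o h)) x)%E.
  by apply: nearW => x n _; exact: dom.
have [hiJ _ cvg] := @dominated_convergence _ _ R leb setT measurableT
  (fun n => EFin \o (fun x => h x * q n x)) (EFin \o (fun x => h x * \1_J x))
  (abse \o (EFin \o h)) mhq mhJ lim' (integrable_abse hi)
  dom'.
have eq0 n : (\int[leb]_x (EFin \o (fun x => h x * q n x)%R) x = 0)%E.
  have hqi : leb.-integrable [set: measurableTypeR R] (EFin \o (fun x => h x * q n x)).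
    by apply: (le_integrable _ _ _ (integrable_abse hi)) => // x _; rewrite /= normr_id; exact: dom.
  have fin := integrable_fin_num measurableT hqi.
  by rewrite -(fineK fin); congr EFin; exact: q0.
have {cvg} cvg : (fun _ : nat => 0%E : \bar R) @ \oo --> (\int[leb]_x (EFin \o (fun x => h x * \1_J x)%R) x)%E.
  by move: cvg; under eq_fun do rewrite eq0.
have J0 : (\int[leb]_x (EFin \o (fun x => h x * \1_J x)%R) x = 0)%E.
  by rewrite -(cvg_lim _ cvg) // lim_cst.
rewrite Rintegral_mkcond /Rintegral -[RHS]/(fine 0%E) -J0; congr fine.
apply: eq_integral => x _; rewrite /= patchE indicE; case: ifP => _ /=; by rewrite ?mulr1 ?mulr0.
Qed.

(** The primitive of [h] starting at [b] vanishes on the whole interval, and Lebesgue's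
    differentiation theorem recovers [h] from it almost everywhere. *)
Let part_ae0 (h : R -> R) : (h = (fun x => complex.Re (g x)) \/ h = (fun x => complex.Im (g x))) ->
  \forall x \ae leb, h x = 0.
Proof.
move=> hE; have hi : leb.-integrable [set: measurableTypeR R] (EFin \o h).
  by case: hE => ->; [exact: cg.1 | exact: cg.2].
have hA x : ~ A x -> h x = 0 by move=> nA; case: hE => ->; rewrite gA.
have hiy (y : itv_bound R) : leb.-integrable [set` Interval (BRight b) y] (EFin \o h).
  by apply: integrableS hi.
have lih : locally_integrable [set: R] h.
  split => //.
  - by apply/measurable_EFinP; exact: (measurable_int _ hi).
  - exact: openT.
  - move=> K _ cK; have /integrableP[_] := hi; apply: le_lt_trans.
    apply: ge0_subset_integral => //; first by apply: compact_measurable.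
    exact: (measurable_int _ (integrable_abse hi)).
have F1 := FTC1 (fun y => hiy (BRight y)) lih.
have e0 : \forall x \ae leb, x <> b + 1.
  exists [set b + 1]; split; [exact: measurable_set1|by rewrite lebesgue_measure_set1|].
  by move=> x /= /contrapT.
apply: (@filterS2 _ _ (ae_filter_ringOfSetsType leb)) F1 e0 => x hx xb.
case: (pselect (A x)) => Ax; last by rewrite hA.
have xbb : b < x < b + 1.
  by move: Ax; rewrite /A /= in_itv /= => /andP[-> ]; rewrite le_eqVlt => /orP[/eqP //|->//].
have [|_ <-] := hx; first exact: (andP xbb).1.
rewrite derive1E (@near_eq_derive _ _ _ _ (cst 0 : R -> R)) ?derive_cst //.
have oU : open [set` `]b, (b + 1)[] by exact: interval_open.
have := open_nbhs_nbhs (conj oU (_ : [set` `]b, (b + 1)[] x)).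
move=> /(_ _) nb; near=> y.
have yb : y \in `]b, b + 1[ by near: y; apply: nb; rewrite /= in_itv.
rewrite /= -Rintegral_itv_bndo_bndc; last exact: hiy.
by apply: part_int => //; move: yb; rewrite in_itv.
Unshelve. all: by end_near.
Qed.

Lemma fourier_ae0 : \forall x \ae leb, g x = 0.
Proof.
have h1 := part_ae0 (or_introl erefl); have h2 := part_ae0 (or_intror erefl).
by apply: (@filterS2 _ _ (ae_filter_ringOfSetsType leb)) h1 h2 => x r i; apply: ceq.
Qed.

End Complete.
End Fourier.

(** The enumeration 0, -1, 1, -2, 2, ... of the integers, by which Fourier series become series over
    [nat]. *)
Definition nu (k : nat) : int := if odd k then - (k./2.+1)%:Z else (k./2)%:Z.

Lemma nu_inj : injective nu.
Proof.
move=> k l; rewrite -(odd_double_half k) -(odd_double_half l) /nu !oddD !odd_double !addbF.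
case: (odd k) (odd l) => [] [] /=; rewrite ?add0n ?add1n ?doubleK ?uphalf_double.
- by move=> /oppr_inj [->].
- by case.
- by case.
- by case=> ->.
Qed.

Lemma nu_surj (z : int) : exists k, nu k = z.
Proof.
case: z => n; first by exists n.*2; rewrite /nu odd_double doubleK.
by exists n.*2.+1; rewrite /nu /= odd_double /= uphalf_double NegzE.
Qed.

(** * Parseval's identity and Bessel's inequality *)

Section Parseval.
Context {R : realType}.
Local Notation leb := (@lebesgue_measure R).
Local Notation RR := (measurableTypeR R).
Implicit Types g : RR -> R[i].

Definition fcoef g (k : nat) : R[i] := cint leb (fun x => g x * conjc (ch1 ((nu k)%:~R * x))).

Lemma ch1_mul_mfunc (a : R) : mfunc (fun x : RR => ch1 (a * x)).
Proof.
apply: (@mfunc_ch1 R _ RR (fun x => a * x)).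
by apply: measurable_funM => //; exact: measurable_id.
Qed.

Section OnUnit.
Variable b : R.
Let A : set RR := [set` `]b, b + 1]].
Let X : lmodType R[i] := L2t leb (@idfun RR) A.
Let ip : X -> X -> R[i] := @l2ip R _ _ leb RR idfun A.
Let H : hilb ip := @l2_hilb R _ RR leb RR idfun idfun (fun x => erefl) A.

Lemma rs_id (g : RR -> R[i]) : (forall x, ~ A x -> g x = 0) -> rs A g = g.
Proof.
by move=> g0; apply/funext => x; rewrite /rs; case: asboolP => // nA; rewrite g0.
Qed.

Lemma exp_L2 (k : nat) : L2S leb (@idfun RR) A (fun x => ch1 ((nu k)%:~R * x)).
Proof.
apply: (L2mu_rs (M := 1)) => //; [exact: unit_itv_measurable|exact: itv_oc_lty|exact: ch1_mul_mfunc|].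
by move=> x; rewrite sqmod_ch1.
Qed.

Let u k : X := mkL2 (exp_L2 k).

Let ipu (f : X) k : ip f (u k) = fcoef (rs A (l2val f)) k.
Proof.
apply: eq_cint => x; rewrite /= {2}/rs; case: asboolP => Ax //.
by rewrite /rs (asboolF Ax) !mul0r.
Qed.

Let biu : biorth u u (ip := ip).
Proof.
move=> i j; rewrite ipu /fcoef.
transitivity (cint leb (rs A (fun x => ch1 ((nu i - nu j)%:~R * x)))).
  apply: eq_cint => x; rewrite /rs /=; case: asboolP => Ax; last by rewrite mul0r.
  by rewrite -ch1N -ch1D rmorphB /= mulrBl.
rewrite exp_orth subr_eq0; congr (if _ then _ else _).
by apply/eqP/eqP => [/nu_inj|->].
Qed.

Let compl (f : X) : (forall i, ip f (u i) = 0) -> nrm f (ip := ip) = 0.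
Proof.
move=> f0; pose g : RR -> R[i] := rs A (l2val f).
have gA x : ~ A x -> g x = 0 by move=> nA; rewrite /g /rs (asboolF nA).
have lg : L2mu leb g := l2inP f.
have cg : cintegrable leb g.
  have := L2mu_cintegrable lg (exp_L2 0%N).
  congr (cintegrable _ _); apply/funext => x.
  rewrite /rs /=; case: asboolP => Ax; first by rewrite mul0r ch10 conjc1 mulr1.
  by rewrite gA // mul0r.
have g0 (k : int) : cint leb (fun x => g x * ch1 (k%:~R * x)) = 0.
  have [l hl] := nu_surj (- k); rewrite -[RHS](f0 l) ipu; apply: eq_cint => x.
  by rewrite hl mulrNz mulNr ch1N conjcK.
have ae := fourier_ae0 cg gA g0.
rewrite /nrm /ip /l2ip sip_self; last exact: lg.
have -> // : (\int[leb]_t (sqmod (rs A (l2val f) (idfun t)))%:E = 0)%E.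
transitivity (\int[leb]_t (cst 0%E t : \bar R))%E; last by rewrite integral0.
apply: ae_eq_integral => //; first by apply: mfunc_Esqmod; exact: lg.1.
apply: (@filterS _ _ (ae_filter_ringOfSetsType leb)) ae => x gx _ /=.
by move: gx; rewrite /g => ->; rewrite sqmod0.
Qed.

(** Stated in the extended reals, ready to be integrated over the fibres term by term in
    [nr_fc_le]. *)
Lemma parseval g : L2mu leb g -> (forall x, ~ A x -> g x = 0) ->
  (\int[leb]_x (sqmod (g x))%:E = \sum_(0 <= k <oo) (sqmod (fcoef g k))%:E)%E.
Proof.
move=> lg gA; have lg' : L2S leb (@idfun RR) A g by rewrite /L2S rs_id.
pose f : X := mkL2 lg'.
have [_ _ bs lo _] := onb_riesz H biu compl.
have fE k : ip f (u k) = fcoef g k by rewrite ipu /= rs_id.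
have nE : nrm f (ip := ip) = fine (\int[leb]_x (sqmod (g x))%:E).
  by rewrite /nrm /ip /l2ip sip_self //= rs_id.
rewrite (L2mu_int lg) -nE; apply/eqP; rewrite eq_le; apply/andP; split.
  have [Soo|Soo] := eqVneq (\sum_(0 <= k <oo) (sqmod (fcoef g k))%:E)%E +oo%E.
    by rewrite Soo leey.
  have S0 : (0 <= \sum_(0 <= k <oo) (sqmod (fcoef g k))%:E)%E.
    by apply: nneseries_ge0 => k _ _; rewrite lee_fin sqmod_ge0.
  have SF : (\sum_(0 <= k <oo) (sqmod (fcoef g k))%:E)%E \is a fin_num.
    by rewrite ge0_fin_numE // ltey.
  rewrite -(fineK SF) lee_fin -[leRHS]mul1r; apply: lo => s us.
  rewrite -lee_fin fineK //.
  pose n := (\max_(i <- s) i).+1.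
  have sn : {subset s <= iota 0 n}.
    by move=> i si; rewrite mem_iota add0n leq0n ltnS /=; exact: leq_bigmax_seq.
  apply: (@le_trans _ _ (\sum_(0 <= k < n) (sqmod (fcoef g k))%:E)%E); last first.
    by apply: nneseries_lim_ge => k _ _; rewrite lee_fin sqmod_ge0.
  rewrite sumEFin lee_fin /index_iota subn0 (sum_sub _ us (iota_uniq _ _) sn).
  rewrite (eq_bigr (fun i => sqmod (fcoef g i))); last by move=> i _; rewrite fE.
  by rewrite lerDl sumr_ge0 // => *; exact: sqmod_ge0.
apply: lime_le; first by apply: is_cvg_nneseries => k _ _; rewrite lee_fin sqmod_ge0.
apply: nearW => N; rewrite sumEFin lee_fin; have := bs f (iota 0 (N - 0)) (iota_uniq _ _).
by rewrite mul1r; apply: le_trans; apply: ler_sum => k _; rewrite fE.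
Qed.

Lemma bessel_unit g N : L2mu leb g -> (forall x, ~ A x -> g x = 0) ->
  \sum_(k < N) sqmod (fcoef g k) <= fine (\int[leb]_x (sqmod (g x))%:E).
Proof.
move=> lg gA; rewrite -lee_fin -(L2mu_int lg) (parseval lg gA) -sumEFin.
rewrite -(big_mkord xpredT (fun k => (sqmod (fcoef g k))%:E)).
by apply: nneseries_lim_ge => k _ _; rewrite lee_fin sqmod_ge0.
Qed.

End OnUnit.

(** Cutting [g] into [2 K] unit intervals writes each coefficient as a sum of [2 K] coefficients, to
    which the unit case applies; Cauchy-Schwarz for this sum costs the factor [K.*2]. *)
Lemma bessel_interval g (K N : nat) : L2mu leb g ->
  (forall x, ~ [set` `](- K%:R), K%:R]] x -> g x = 0) ->
  \sum_(k < N) sqmod (fcoef g k) <= (K.*2)%:R * fine (\int[leb]_x (sqmod (g x))%:E).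
Proof.
move=> lg gK.
pose B (j : nat) : set RR := [set` `](j%:R - K%:R), (j%:R - K%:R + 1)]].
pose p j := rs (B j) g.
have mB j : measurable (B j) by exact: measurable_itv.
have lp j : L2mu leb (p j).
  apply: (L2mu_le (C := 1) _ _ lg) => //; first by apply: mfunc_rs => //; exact: lg.1.
  by move=> x; rewrite mul1r /p /rs; case: ifP => _; rewrite ?sqmod0 ?sqmod_ge0.
have pB j x : ~ B j x -> p j x = 0 by move=> nB; rewrite /p /rs (asboolF nB).
have part x (n : nat) : \sum_(j < n) (if `[< B j x >] then 1 else 0) =
    (if `[< - K%:R < x <= n%:R - K%:R >] then 1 else 0) :> R.
  elim: n => [|n IH].
    rewrite big_ord0 asboolF // sub0r => /andP[h1 h2]; lra.
  rewrite big_ord_recr /= IH /B /= in_itv /= -natr1.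
  have n0 := ler0n R n.
  case: asboolP => h1; case: asboolP => h2; case: asboolP => h3; rewrite ?addr0 ?add0r //; exfalso.
  - by move: h1 h2 => /andP[? ?] /andP[? ?]; lra.
  - by move: h1 h2 => /andP[? ?] /andP[? ?]; lra.
  - by apply: h3; move: h1 => /andP[? ?]; apply/andP; split; lra.
  - by apply: h3; move: h2 => /andP[? ?]; apply/andP; split; lra.
  - move: h3 => /andP[h3 h4]; case: (lerP x (n%:R - K%:R)) => h5.
      by apply: h1; rewrite h3.
    by apply: h2; apply/andP; split; lra.
have gE x : g x = \sum_(j < K.*2) p j x.
  rewrite (eq_bigr (fun j : 'I_(K.*2) => g x * ((if `[< B j x >] then 1 else 0)%:C)%C)); last first.
    by move=> j _; rewrite /p /rs; case: ifP => _; rewrite ?mulr1 ?mulr0.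
  rewrite -mulr_sumr -rmorph_sum /= part -addnn natrD addrK; case: asboolP => h; first by rewrite mulr1.
  by rewrite mulr0 gK //= in_itv.
have cp j k : cintegrable leb (fun x => p j x * conjc (ch1 ((nu k)%:~R * x))).
  apply: (@cintegrable_bounded _ _ _ _ _ _ 1).
  - have := L2mu_cintegrable (lp j) (exp_L2 (j%:R - K%:R) 0%N).
    congr (cintegrable _ _); apply/funext => x.
    rewrite /rs /=; case: asboolP => Bx; first by rewrite mul0r ch10 conjc1 mulr1.
    by rewrite pB // mul0r.
  - by apply: mfuncJ; exact: ch1_mul_mfunc.
  - by move=> x; rewrite sqmodJ sqmod_ch1.
have fE k : fcoef g k = \sum_(j < K.*2) fcoef (p j) k.
  have aux n : cintegrable leb (fun x => \sum_(j < n) p j x * conjc (ch1 ((nu k)%:~R * x))) /\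
     cint leb (fun x => \sum_(j < n) p j x * conjc (ch1 ((nu k)%:~R * x))) = \sum_(j < n) fcoef (p j) k.
    elim: n => [|n [IH1 IH2]].
      under eq_fun do rewrite big_ord0; rewrite big_ord0; split.
        by split; rewrite (_ : _ \o _ = cst 0%E) ?integrable0.
      exact: cint0.
    under eq_fun do rewrite big_ord_recr /=; rewrite big_ord_recr /= -IH2.
    split; first exact: cintegrableD.
    by rewrite cintD.
  rewrite -(aux _).2; apply: eq_cint => x; rewrite gE mulr_suml.
  by [].
have nE : fine (\int[leb]_x (sqmod (g x))%:E) = \sum_(j < K.*2) fine (\int[leb]_x (sqmod (p j x))%:E).
  apply: EFin_inj; rewrite -(L2mu_int lg) -sumEFin.
  rewrite (eq_bigr (fun j : 'I_K.*2 => (\int[leb]_x (sqmod (p j x))%:E)%E)); last first.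
    by move=> j _; rewrite -(L2mu_int (lp j)).
  rewrite -ge0_integral_sum //; last 2 first.
  - by move=> j; apply: mfunc_Esqmod; exact: (lp j).1.
  - by move=> j x _; rewrite lee_fin sqmod_ge0.
  apply: eq_integral => x _; rewrite sumEFin; congr EFin.
  rewrite (eq_bigr (fun j : 'I_(K.*2) => sqmod (g x) * (if `[< B j x >] then 1 else 0))); last first.
    by move=> j _; rewrite /p /rs; case: ifP => _; rewrite ?mulr1 ?mulr0 ?sqmod0.
  rewrite -mulr_sumr part -addnn natrD addrK; case: asboolP => h; first by rewrite mulr1.
  by rewrite mulr0 gK ?sqmod0 //= in_itv.
rewrite nE mulr_sumr.
apply: (@le_trans _ _ (\sum_(k < N) (K.*2)%:R * \sum_(j < K.*2) sqmod (fcoef (p j) k))).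
  apply: ler_sum => k _; rewrite fE.
  have := @sum_cauchy R 'I_(K.*2) (index_enum _) (fun=> 1) (fun j => fcoef (p j) k).
  rewrite (eq_bigr (fun j : 'I_(K.*2) => fcoef (p j) k)) => [|j _]; last by rewrite mul1r.
  move=> h; apply: le_trans h _; rewrite (eq_bigr (fun=> 1)) => [|j _]; last exact: sqmod1.
  by rewrite sumr_const card_ord.
rewrite -!mulr_sumr ler_wpM2l // exchange_big /=; apply: ler_sum => j _.
exact: bessel_unit (lp j) (@pB j).
Qed.

End Parseval.

Section TupleL2.
Context {R : realType}.
Local Notation leb := (@lebesgue_measure R).

Definition dott d (l t : d.-tuple R) : R := \sum_(i < d) tnth l i * tnth t i.
Definition ch d (l t : d.-tuple R) : R[i] := ch1 (dott l t).

Lemma dott_tcons d (a x : R) (l y : d.-tuple R) :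
  dott (tcons (a, l)) (tcons (x, y)) = a * x + dott l y.
Proof.
rewrite /dott big_ord_recl /= !tnth0; congr (_ + _).
by apply: eq_bigr => i _; rewrite !tnthS.
Qed.

Lemma ch_tcons d (a x : R) (l y : d.-tuple R) :
  ch (tcons (a, l)) (tcons (x, y)) = ch1 (a * x) * ch l y.
Proof. by rewrite /ch dott_tcons ch1D. Qed.

Lemma mfunc_ch d (l : d.-tuple R) : mfunc (ch l).
Proof.
apply: mfunc_ch1; apply: measurable_sum => i.
by apply: measurable_funM => //; exact: measurable_tnth.
Qed.

Lemma sqmod_ch d (l t : d.-tuple R) : sqmod (ch l t) = 1.
Proof. exact: sqmod_ch1. Qed.

Definition box d (K : nat) : set (d.-tuple R) :=
  [set t | forall i, - K%:R < tnth t i <= K%:R].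

Lemma box_tcons d K (x : R) (y : d.-tuple R) :
  box K (tcons (x, y)) <-> - K%:R < x <= K%:R /\ box K y.
Proof.
split=> [h|[h1 h2] i].
  split; first by have := h ord0; rewrite tnth0.
  by move=> i; have := h (lift ord0 i); rewrite tnthS.
by case: (unliftP ord0 i) => [j ->|->]; rewrite ?tnthS ?tnth0.
Qed.

Lemma measurable_box d K : measurable (@box d K).
Proof.
rewrite (_ : box K = \bigcap_(i in [set: 'I_d]) ((fun t => tnth t i) @^-1` [set` `]- K%:R, K%:R]])); last first.
  apply/seteqP; split=> t h i => [_|]; first by rewrite /= in_itv /=; exact: h.
  by have := h i I; rewrite /= in_itv.
apply: fin_bigcap_measurable => // i _.
by rewrite -[X in measurable X]setTI; apply: measurable_tnth.
Qed.

Lemma box_measure d K : (tmu d (@box d K) < +oo)%E.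
Proof.
have E n : tmu n (@box n K) = (\int[tmu n]_t (\1_(@box n K) t)%:E)%E.
  by rewrite integral_indic ?setIT //; exact: measurable_box.
have m n : measurable_fun [set: n.-tuple R] (fun t => (\1_(@box n K) t)%:E : \bar R).
  by apply/measurable_EFinP; apply: measurable_indic; exact: measurable_box.
have p n (t : n.-tuple R) : (0 <= (\1_(@box n K) t)%:E :> \bar R)%E.
  by rewrite lee_fin indicE ler0n.
elim: d => [|d IH]; first by rewrite E -iintE //= ltry.
rewrite E ge0_integral_tcons2 //.
pose J : set (measurableTypeR R) := [set` `](- K%:R), K%:R]].
have mJ : measurable J by exact: measurable_itv.
have [c c0 JE] : exists2 c : R, 0 <= c & leb J = c%:E.
  exists (fine (leb J)); first exact/fine_ge0/measure_ge0.
  rewrite fineK // ge0_fin_numE ?measure_ge0 //.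
  by rewrite /J lebesgue_measure_itv /=; case: ifP => // _; rewrite -EFinB ltry.
rewrite (_ : (\int[tmu d]_y _ = \int[tmu d]_y (c%:E * (\1_(@box d K) y)%:E))%E); last first.
  apply: eq_integral => y _.
  transitivity (\int[leb]_x ((\1_J x)%:E * (\1_(@box d K) y)%:E))%E.
    apply: eq_integral => x _; rewrite -EFinM !indicE -natrM mulnb; congr ((nat_of_bool _)%:R%:E).
    apply/idP/andP => [|[]]; rewrite !inE.
      by move=> /box_tcons[h1 h2]; split => //; rewrite /J /= in_itv.
    by rewrite /J /= in_itv /= => h1 h2; apply/box_tcons.
  rewrite ge0_integralZr //.
  - by congr (_ * _)%E; rewrite integral_indic // setIT; exact: JE.
  - by apply/measurable_EFinP; exact: measurable_indic.
rewrite ge0_integralZl ?lee_fin //; last exact: m.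
by apply: lte_mul_pinfty; rewrite ?lee_fin //; move: IH; rewrite E.
Qed.

(** * Fourier transforms of functions supported in bounded sets *)

Section Dim.
Variable d : nat.
Local Notation T := (d.-tuple R).
Implicit Types (f g : T -> R[i]) (A : set T) (l : T).

(** Vanishing off [A] is required at every point, so that inclusions of sets carry over at once and
    functions with disjoint supports have product 0 pointwise. *)
Definition L2on A f := L2mu (tmu d) f /\ forall t, ~ A t -> f t = 0.
Definition pr f g : R[i] := L2ip (tmu d) f g.
Definition ft f l : R[i] := pr f (ch l).
Definition nr f : R := fine (\int[tmu d]_t (sqmod (f t))%:E).

Lemma nr_ge0 f : 0 <= nr f.
Proof. by apply: fine_ge0; apply: integral_ge0 => t _; rewrite lee_fin sqmod_ge0. Qed.

Lemma L2on_sub A B f : A `<=` B -> L2on A f -> L2on B f.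
Proof. by move=> AB [lf f0]; split=> // t nB; apply: f0 => /AB. Qed.

Lemma L2onD A f g : L2on A f -> L2on A g -> L2on A (fun t => f t + g t).
Proof.
move=> [lf f0] [lg g0]; split; first exact: L2muD.
by move=> t nA; rewrite f0 // g0 // addr0.
Qed.
Lemma L2onB A f g : L2on A f -> L2on A g -> L2on A (fun t => f t - g t).
Proof.
move=> [lf f0] [lg g0]; split; first exact: L2muB.
by move=> t nA; rewrite f0 // g0 // subr0.
Qed.

Lemma L2on_rs A B f : measurable A -> L2on B f -> L2on (A `&` B) (rs A f).
Proof.
move=> mA [lf f0]; split.
  apply: (L2mu_le (C := 1) _ _ lf) => //; first by apply: mfunc_rs => //; exact: lf.1.
  by move=> x; rewrite mul1r /rs; case: ifP => _; rewrite ?sqmod0 ?sqmod_ge0.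
move=> t nAB; rewrite /rs; case: asboolP => // At; apply: f0 => Bt; exact: nAB.
Qed.

Lemma L2on_bmul A f g (M : R) : L2on A f -> mfunc g -> (forall t, sqmod (g t) <= M) ->
  L2on A (fun t => f t * g t).
Proof.
move=> [lf f0] mg gM; split; last by move=> t /f0 ->; rewrite mul0r.
case: (pselect (exists t : T, True)) => [[t0 _]|n].
  apply: (L2mu_le (C := M) _ _ lf).
  - by apply: mfuncM => //; exact: lf.1.
  - by apply: le_trans (gM t0); exact: sqmod_ge0.
  - by move=> t; rewrite sqmodM mulrC ler_wpM2r ?sqmod_ge0.
rewrite (_ : (fun t => _) = (fun=> 0)); first exact: L2mu0.
by apply/funext => t; case: n; exists t.
Qed.

Lemma cst_L2on (c : R[i]) K : L2on (box K) (rs (box K) (fun=> c)).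
Proof.
split; last by move=> t nA; rewrite /rs (asboolF nA).
by apply: (L2mu_rs (@measurable_box d K) (box_measure d K) (mfunc_cst c) (sqmod_ge0 c)).
Qed.

Lemma L2on_integrable K f : L2on (box K) f -> cintegrable (tmu d) f.
Proof.
move=> [lf f0]; have := L2mu_cintegrable lf (cst_L2on 1 K).1.
congr (cintegrable _ _); apply/funext => t; rewrite /rs; case: asboolP => h.
  by rewrite conjc1 mulr1.
by rewrite f0 // mul0r.
Qed.

Lemma L2on_bmul_integrable K f g (M : R) : L2on (box K) f -> mfunc g ->
  (forall t, sqmod (g t) <= M) -> cintegrable (tmu d) (fun t => f t * g t).
Proof. by move=> lf mg gM; exact: L2on_integrable (L2on_bmul lf mg gM). Qed.

Lemma ft_integrable K f l : L2on (box K) f ->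
  cintegrable (tmu d) (fun t => f t * conjc (ch l t)).
Proof.
move=> lf; apply: (L2on_bmul_integrable (M := 1) lf); first by apply: mfuncJ; exact: mfunc_ch.
by move=> t; rewrite sqmodJ sqmod_ch.
Qed.

Lemma ftD K f g l : L2on (box K) f -> L2on (box K) g ->
  ft (fun t => f t + g t) l = ft f l + ft g l.
Proof.
move=> lf lg; rewrite /ft /pr /L2ip -cintD; try exact: ft_integrable lf; try exact: ft_integrable lg.
by apply: eq_cint => t; rewrite mulrDl.
Qed.

Lemma ftZ K f (a : R[i]) l : L2on (box K) f -> ft (fun t => a * f t) l = a * ft f l.
Proof.
move=> lf; rewrite /ft /pr /L2ip -cintZ; last exact: ft_integrable lf.
by apply: eq_cint => t; rewrite mulrA.
Qed.

Lemma ftB K f g l : L2on (box K) f -> L2on (box K) g ->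
  ft (fun t => f t - g t) l = ft f l - ft g l.
Proof.
move=> lf lg; rewrite -mulN1r -(ftZ _ _ lg) -(ftD _ lf).
  by apply: eq_cint => t; rewrite mulN1r.
by have := L2onB lf (L2onD lf lg); congr (L2on _ _); apply/funext => t; rewrite opprD addrA subrr add0r mulN1r.
Qed.

Lemma nrE f : L2mu (tmu d) f -> (\int[tmu d]_t (sqmod (f t))%:E)%E = (nr f)%:E.
Proof. by move=> lf; exact: L2mu_int. Qed.

Lemma nrD f g : L2mu (tmu d) f -> L2mu (tmu d) g ->
  nr (fun t => f t + g t) <= 2 * nr f + 2 * nr g.
Proof.
move=> lf lg; rewrite -lee_fin -(nrE (L2muD lf lg)) EFinD !EFinM -!nrE //.
have mf := mfunc_Esqmod lf.1; have mg := mfunc_Esqmod lg.1.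
rewrite -!ge0_integralZl //; try (by move=> t _; rewrite lee_fin sqmod_ge0).
rewrite -ge0_integralD //; try (by move=> t _; rewrite -EFinM lee_fin mulr_ge0 ?sqmod_ge0);
  try exact: emeasurable_funM.
apply: ge0_le_integral => //.
- by move=> t _; rewrite lee_fin sqmod_ge0.
- by apply: mfunc_Esqmod; exact: mfuncD lf.1 lg.1.
- by apply: emeasurable_funD; exact: emeasurable_funM.
- by move=> t _; rewrite -!EFinM -EFinD lee_fin sqmodD.
Qed.

Lemma nr_le f g (C : R) : 0 <= C -> L2mu (tmu d) f -> L2mu (tmu d) g ->
  (forall t, sqmod (f t) <= C * sqmod (g t)) -> nr f <= C * nr g.
Proof.
move=> C0 lf lg h; rewrite -lee_fin EFinM -!nrE //.
have mf := mfunc_Esqmod lf.1; have mg := mfunc_Esqmod lg.1.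
rewrite -ge0_integralZl //; last by move=> t _; rewrite lee_fin sqmod_ge0.
apply: ge0_le_integral => //.
- by move=> t _; rewrite lee_fin sqmod_ge0.
- exact: emeasurable_funM.
- by move=> t _; rewrite -EFinM lee_fin.
Qed.

Lemma nrN f : nr (fun t => - f t) = nr f.
Proof. by congr fine; apply: eq_integral => t _; rewrite sqmodN. Qed.

End Dim.
End TupleL2.

(* The exponentials with frequencies [lam] form a Riesz basis of [L^2(A)]: the upper and lower
   frame bounds and the interpolation of [l^2] data replace the invertible operator, and [u] is an
   orthonormal basis with the same index set.  The upper bound is required on every box, because
   [lam] is also applied to functions supported outside [A] when two sets are glued. *)
Record rb {R : realType} d (A : set (d.-tuple R)) (I : choiceType) (lam : I -> d.-tuple R)
    (u : I -> d.-tuple R -> R[i]) : Prop := Rb {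
  rb_u : forall i, L2on A (u i);
  rb_orth : forall i j, pr (u i) (u j) = if i == j then 1 else 0;
  rb_compl : forall f, L2on A f -> (forall i, pr f (u i) = 0) -> nr f = 0;
  rb_bessel : forall K, exists2 C : R, 0 <= C &
    forall f, L2on (box K) f -> ell2 (fun i => ft f (lam i)) (C * nr f);
  rb_lower : exists2 B : R, 0 <= B &
    forall f M, L2on A f -> ell2 (fun i => ft f (lam i)) M -> nr f <= B * M;
  rb_interp : forall c M, ell2 c M -> exists2 f, L2on A f & forall i, ft f (lam i) = c i }.

(** * L^2(A) as a Hilbert space, with its exponentials as a Riesz family *)

Section Bridge.
Context {R : realType} {d K : nat}.
Local Notation T := (d.-tuple R).
Variable A : set T.
Hypotheses (mA : measurable A) (AK : A `<=` box K).
Implicit Types (f h : T -> R[i]) (l : T).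

Definition XA : lmodType R[i] := L2t (tmu d) (@idfun T) A.
Definition ipA : XA -> XA -> R[i] := @l2ip R _ _ (tmu d) T idfun A.
Definition HA : hilb ipA := @l2_hilb R _ T (tmu d) T idfun idfun (fun x => erefl) A.

Lemma rsA f : (forall t, ~ A t -> f t = 0) -> rs A f = f.
Proof. by move=> f0; apply/funext => t; rewrite /rs; case: asboolP => // nA; rewrite f0. Qed.

Lemma XA_L2on (f : XA) : L2on A (rs A (l2val f)).
Proof. by split; [exact: l2inP f | move=> t nA; rewrite /rs (asboolF nA)]. Qed.

Lemma L2on_L2S f : L2on A f -> L2S (tmu d) (@idfun T) A f.
Proof. by case=> lf f0; rewrite /L2S rsA. Qed.

Lemma nrm_XA (f : XA) : nrm f (ip := ipA) = nr (rs A (l2val f)).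
Proof. by rewrite /nrm /ipA /l2ip sip_self //; exact: l2inP f. Qed.

Lemma ch_L2S l : L2S (tmu d) (@idfun T) A (ch l).
Proof.
have Aoo : (tmu d A < +oo)%E.
  apply: le_lt_trans (box_measure d K); apply: le_measure; rewrite ?inE //.
  exact: measurable_box.
by apply: (L2mu_rs (M := 1) mA Aoo (mfunc_ch l)) => // t; rewrite sqmod_ch.
Qed.

Definition chX l : XA := mkL2 (ch_L2S l).

Lemma ip_chX (f : XA) l : ipA f (chX l) = ft (rs A (l2val f)) l.
Proof.
apply: eq_cint => t; rewrite /= {2}/rs; case: asboolP => At //.
by rewrite /rs (asboolF At) !mul0r.
Qed.

Section Family.
Context {I : choiceType}.
Variable lam : I -> T.

Lemma chX_riesz (C B : R) : 0 <= C -> 0 <= B ->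
  (forall f, L2on (box K) f -> ell2 (fun i => ft f (lam i)) (C * nr f)) ->
  (forall f M, L2on A f -> ell2 (fun i => ft f (lam i)) M -> nr f <= B * M) ->
  (forall c M, ell2 c M -> exists2 f, L2on A f & forall i, ft f (lam i) = c i) ->
  riesz (fun i => chX (lam i)) C B (ip := ipA).
Proof.
move=> C0 B0 hC hB hi; split=> //.
- move=> f s us; rewrite nrm_XA; under eq_bigr do rewrite ip_chX.
  by apply: hC us; exact: L2on_sub AK (XA_L2on f).
- move=> f M fM; rewrite nrm_XA; apply: hB; first exact: XA_L2on.
  by move=> s us; have := fM s us; under eq_bigr do rewrite ip_chX.
- move=> c M cM; have [f lf hf] := hi c M cM.
  by exists (mkL2 (L2on_L2S lf)) => i; rewrite ip_chX /= (rsA lf.2).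
Qed.

Lemma chX_lower (B : R) : lowerb (fun i => chX (lam i)) B (ip := ipA) ->
  forall f M, L2on A f -> ell2 (fun i => ft f (lam i)) M -> nr f <= B * M.
Proof.
move=> hB f M lf fM; have := hB (mkL2 (L2on_L2S lf)) M.
rewrite nrm_XA /= (rsA lf.2); apply => s us.
by under eq_bigr do rewrite ip_chX /= (rsA lf.2); exact: fM.
Qed.

Lemma chX_interp : interp (fun i => chX (lam i)) (ip := ipA) ->
  forall c M, ell2 c M -> exists2 f, L2on A f & forall i, ft f (lam i) = c i.
Proof.
move=> hi c M /hi[f hf]; exists (rs A (l2val f)); first exact: XA_L2on.
by move=> i; rewrite -ip_chX.
Qed.

Lemma chX_biorth (h : I -> T -> R[i]) (B : R) : 0 <= B -> (forall i, L2on A (h i)) ->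
  (forall i j, ft (h i) (lam j) = if i == j then 1 else 0) ->
  (forall f M, L2on A f -> ell2 (fun i => ft f (lam i)) M -> nr f <= B * M) ->
  forall c M, ell2 c M -> exists2 f, L2on A f & forall i, ft f (lam i) = c i.
Proof.
move=> B0 lh hh hB; apply: chX_interp.
apply: (biorth_interp HA B0 (u := fun i => mkL2 (L2on_L2S (lh i)))).
  move=> f M fM; rewrite nrm_XA; apply: hB; first exact: XA_L2on.
  by move=> s us; have := fM s us; under eq_bigr do rewrite ip_chX.
by move=> i j; rewrite ip_chX /= (rsA (lh i).2).
Qed.

End Family.
End Bridge.

(** * Small perturbations of the first coordinate of the frequencies *)

Lemma ch1_small {R : realType} (e : R) (K : nat) : 0 < e -> exists2 eps : R, 0 < eps < 2^-1 &
  forall x, - K%:R < x <= K%:R -> sqmod (1 - conjc (ch1 (eps * x))) <= e.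
Proof.
move=> e0; pose f (r : R) := (1 - cos (2 * pi * r)) ^+ 2 + sin (2 * pi * r) ^+ 2.
have cf : {for 0, continuous f}.
  have c1 : {for 0, continuous (fun r : R => cos (2 * pi * r))}.
    by apply: continuous_comp; [exact: mulrl_continuous|exact: continuous_cos].
  have c2 : {for 0, continuous (fun r : R => sin (2 * pi * r))}.
    by apply: continuous_comp; [exact: mulrl_continuous|exact: continuous_sin].
  by apply: cvgD; rewrite /= !expr2; apply: cvgM => //; apply: cvgB => //; exact: cvg_cst.
have f0 : f 0 = 0 by rewrite /f mulr0 cos0 sin0 subrr expr0n addr0.
move/cvgrPdist_lt : cf => /(_ _ (divr_gt0 e0 (ltr0n _ 2))).
rewrite near_nbhs => /nbhs_ballP[r /= r0 hr].
exists (Num.min (4^-1) (r / 2 / (K%:R + 1))).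
  have h1 : (0 : R) < r / 2 / (K%:R + 1) by rewrite !divr_gt0 // ltr_wpDl.
  rewrite lt_min h1 andbT; apply/andP; split; first lra.
  by rewrite gt_min; apply/orP; left; lra.
move=> x /andP[x1 x2].
have K0 : 0 <= K%:R :> R by [].
set eps := Num.min _ _.
have e1 : 0 < eps.
  have h1 : (0 : R) < r / 2 / (K%:R + 1) by rewrite !divr_gt0 // ltr_wpDl.
  by rewrite lt_min h1 andbT invr_gt0.
have e2 : eps * (K%:R + 1) <= r / 2.
  by rewrite -ler_pdivlMr ?ltr_wpDl // /eps ge_min lexx orbT.
have hx : ball (0 : R) r (eps * x).
  rewrite -ball_normE /ball_ /= sub0r normrN normrM (gtr0_norm e1).
  have : `|x| <= K%:R by rewrite ler_norml; apply/andP; split; lra.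
  move=> xK; have : eps * `|x| <= eps * (K%:R + 1) by rewrite ler_wpM2l ?ltW //; lra.
  lra.
have := hr _ hx; rewrite /= f0 sub0r normrN => h.
have -> : sqmod (1 - conjc (ch1 (eps * x))) = f (eps * x).
  by rewrite ch1E /sqmod /= opprK add0r.
apply: le_trans (ler_norm _) _; lra.
Qed.

Lemma ch1_neq1 {R : realType} (e : R) : 0 < e < 2^-1 -> 0 < sqmod (1 - conjc (ch1 e)).
Proof.
move=> /andP[e0 e1]; rewrite lt_def sqmod_ge0 andbT; apply/eqP => /sqmod_eq0.
rewrite ch1E => /(congr1 (@complex.Re _)) /= h.
have p0 := pi_gt0 R.
have : cos (2 * pi * e) < cos 0.
  rewrite ltr_cos ?in_itv /= ?lexx ?ltW ?mulr_gt0 //; nra.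
rewrite cos0; lra.
Qed.

Section Perturbation.
Context {R : realType} {d K : nat}.
Local Notation T := (d.+1.-tuple R).
Variable A : set T.
Hypotheses (mA : measurable A) (AK : A `<=` box K).
Implicit Types (f : T -> R[i]) (l : T).

Definition shift0 (e : R) l : T := tcons (thead l + e, [tuple of behead l]).

Lemma shift0_tcons e a (l : d.-tuple R) : shift0 e [tuple of a :: l] = tcons (a + e, l).
Proof. by rewrite /shift0 theadE; congr tcons; congr pair; apply: val_inj. Qed.

Lemma dott_shift0 e l t : dott (shift0 e l) t = dott l t + e * thead t.
Proof.
case/tupleP: l => a l; case/tupleP: t => x t.
rewrite shift0_tcons !(dott_tcons _ x) /= theadE; ring.
Qed.

(** Only frequencies whose factor [1 - exp(- 2 i pi l_0)] has squared modulus below [kappa] are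
    moved, all by the same [e]. Such a move changes the factor by a number of squared modulus
    [4 * kappa], which leaves at least [kappa]. The shift [e] is taken small in terms of the frame
    bounds and the box. *)
Lemma rb_perturb (I : choiceType) (lam : I -> T) u : rb A lam u ->
  exists2 kappa : R, 0 < kappa & exists2 lam' : I -> T, rb A lam' u &
    forall i, kappa <= sqmod (1 - conjc (ch1 (thead (lam' i)))).
Proof.
move=> [hu ho hc hb [B B0 hl] hi].
have [C C0 hC] := hb K.
(* Chosen so that [C * del * B] stays below the threshold 1/16 of [riesz_perturb]. *)
pose del : R := (16 * (C * B + 1))^-1.
have CB0 : 0 <= C * B by rewrite mulr_ge0.
have del0 : 0 < del by rewrite invr_gt0 mulr_gt0 // ltr_wpDl.
have [e /[dup] e01 /andP[e0 e1] he] := ch1_small K del0.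
pose kappa := sqmod (1 - conjc (ch1 e)) / 4.
have k0 : 0 < kappa by rewrite divr_gt0 // ch1_neq1.
pose lam' i := if kappa <= sqmod (1 - conjc (ch1 (thead (lam i)))) then lam i
  else shift0 e (lam i).
exists kappa => //; exists lam'; last first.
  move=> i; rewrite /lam'; case: ifPn => // /negbTE hk.
  rewrite /shift0 theadE ch1D; move/negbT: hk; rewrite -ltNge => hk.
  set z := conjc (ch1 _) in hk; rewrite rmorphM /= -/z.
  have := sqmodD (1 - z * conjc (ch1 e)) (- (1 - z)).
  have -> : 1 - z * conjc (ch1 e) + - (1 - z) = z * (1 - conjc (ch1 e)).
    by ring.
  rewrite sqmodM sqmodN {1}/z sqmodJ sqmod_ch1 mul1r.
  have : sqmod (1 - conjc (ch1 e)) = 4 * kappa by rewrite /kappa; field.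
  lra.
(* Moving a frequency by [e] amounts to modulating the function; the difference of the two
   coefficients is a coefficient of [f * w], and [w] is small on the box. *)
pose w (t : T) : R[i] := 1 - conjc (ch1 (e * thead t)).
have mth : measurable_fun [set: T] (fun t => thead t : R).
  by rewrite (_ : (fun t => thead t : R) = fun t => tnth t ord0) //; exact: measurable_tnth.
have mw : mfunc w.
  apply: mfuncD; first exact: mfunc_cst.
  apply: mfuncN; apply: mfuncJ; apply: mfunc_ch1.
  by apply: measurable_funM.
have w4 t : sqmod (w t) <= 4.
  have := sqmodD 1 (- conjc (ch1 (e * thead t))).
  rewrite sqmod1 sqmodN sqmodJ sqmod_ch1 /w; lra.
have ftw f i : L2on (box K) f -> ft f (lam i) - ft f (lam' i) =
    if kappa <= sqmod (1 - conjc (ch1 (thead (lam i)))) then 0 else ft (fun t => f t * w t) (lam i).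
  move=> lf; rewrite /lam'; case: ifP => _; first by rewrite subrr.
  rewrite /ft /pr /L2ip -mulN1r -cintZ; last exact: ft_integrable lf.
  rewrite -cintD; [|exact: ft_integrable lf|by apply: cintegrableZ; exact: ft_integrable lf].
  apply: eq_cint => t; rewrite /ch dott_shift0 ch1D rmorphM /= /w; ring.
have hw f : L2on (box K) f -> nr (fun t => f t * w t) <= del * nr f.
  move=> lf; have lfw := L2on_bmul lf mw w4.
  apply: nr_le; [exact: ltW|exact: lfw.1|exact: lf.1|move=> t].
  rewrite sqmodM mulrC; case: (pselect (box K t)) => bt.
    by rewrite ler_wpM2r ?sqmod_ge0 // he //; exact: bt ord0.
  by rewrite lf.2 // sqmod0 !mulr0.
have hd f : L2on (box K) f ->
    ell2 (fun i => ft f (lam i) - ft f (lam' i)) (C * del * nr f).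
  move=> lf s us; rewrite -mulrA.
  apply: le_trans (_ : C * nr (fun t => f t * w t) <= _); last by rewrite ler_wpM2l // hw.
  apply: le_trans (hC _ (L2on_bmul lf mw w4) s us).
  apply: ler_sum => i _; rewrite ftw //; case: ifP => _ //.
  by rewrite sqmod0 sqmod_ge0.
have re := chX_riesz mA AK C0 B0 hC hl hi.
have d0 : 0 <= C * del by rewrite mulr_ge0 // ltW.
have dB : C * del * B <= 16^-1.
  have -> : C * del * B = 16^-1 * (C * B / (C * B + 1)).
    by rewrite /del; field; rewrite gt_eqF // ltr_wpDl.
  by rewrite ger_pMr ?invr_gt0 // ler_pdivrMr ?ltr_wpDl // mul1r lerDl.
have dX (f : XA A) : ell2 (fun i => ipA f (chX mA AK (lam i)) - ipA f (chX mA AK (lam' i)))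
    (C * del * nrm f (ip := ipA (A := A))).
  move=> s us; rewrite nrm_XA; under eq_bigr do rewrite !ip_chX.
  exact: hd (L2on_sub AK (XA_L2on f)) s us.
have [_ A0 _ lo int] := riesz_perturb (HA A) re d0 dX dB.
split=> //.
(* On a larger box [w] may be large. Each new coefficient is one of [f] or of the modulated [f * v],
   whose norm is no larger; hence the factor 2. *)
- move=> L; have [CL CL0 hCL] := hb L; exists (2 * CL); first by rewrite mulr_ge0.
  move=> f lf s us.
  pose v (t : T) : R[i] := conjc (ch1 (e * thead t)).
  have mv : mfunc v by apply: mfuncJ; apply: mfunc_ch1; exact: measurable_funM.
  have v1 t : sqmod (v t) <= 1 by rewrite sqmodJ sqmod_ch1.
  have lfv := L2on_bmul lf mv v1.
  apply: (@le_trans _ _ (\sum_(i <- s) sqmod (ft f (lam i)) + \sum_(i <- s) sqmod (ft (fun t => f t * v t) (lam i)))).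
    rewrite -big_split /=; apply: ler_sum => i _; rewrite /lam'; case: ifP => _.
      by rewrite lerDl sqmod_ge0.
    apply: le_trans (_ : sqmod (ft (fun t => f t * v t) (lam i)) <= _); last by rewrite lerDr sqmod_ge0.
    rewrite le_eqVlt; apply/orP; left; apply/eqP; congr sqmod; apply: eq_cint => t.
    by rewrite /ch dott_shift0 ch1D rmorphM /= /v; ring.
  have h1 := hCL _ lf s us; have h2 := hCL _ lfv s us.
  have h3 : nr (fun t => f t * v t) <= 1 * nr f.
    by apply: nr_le => //; [exact: lfv.1|exact: lf.1|move=> t; rewrite sqmodM mulrC ler_wpM2r ?sqmod_ge0].
  have : CL * nr (fun t => f t * v t) <= CL * nr f by rewrite ler_wpM2l //; lra.
  lra.
- by exists (4 * B); [rewrite mulr_ge0|exact: chX_lower lo].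
- exact: chX_interp int.
Qed.

End Perturbation.

(** * Sets with half-open unit fibres *)

Lemma cint_ae {R : realType} dd (T : measurableType dd) (mu : {measure set T -> \bar R})
    (f g : T -> R[i]) : mfunc f -> mfunc g -> (\forall x \ae mu, f x = g x) ->
  cint mu f = cint mu g.
Proof.
move=> [f1 f2] [g1 g2] fg; rewrite /cint /Rintegral; congr (Complex (fine _) (fine _)).
- apply: ae_eq_integral => //; [exact/measurable_EFinP|exact/measurable_EFinP|].
  by apply: (@filterS _ _ (ae_filter_ringOfSetsType mu)) fg => x -> _.
- apply: ae_eq_integral => //; [exact/measurable_EFinP|exact/measurable_EFinP|].
  by apply: (@filterS _ _ (ae_filter_ringOfSetsType mu)) fg => x -> _.
Qed.

(** Extracts from a lower bound one finite list that almost realizes it. If every list failed, all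
    sums would be below [(x - e) / (B + 1)], and the lower bound with this [M] would be
    contradictory. *)
Lemma ell2_near {R : realType} (I : choiceType) (c : I -> R[i]) (B x e : R) : 0 <= B -> 0 < e ->
  (forall M, ell2 c M -> x <= B * M) ->
  exists2 s, uniq s & x <= (B + 1) * (\sum_(i <- s) sqmod (c i)) + e.
Proof.
move=> B0 e0 h; apply: contrapT => n.
have B1 : 0 < B + 1 by rewrite ltr_wpDl.
have hs s : uniq s -> (B + 1) * (\sum_(i <- s) sqmod (c i)) + e < x.
  by move=> us; rewrite ltNge; apply/negP => hx; apply: n; exists s.
have : x <= B * ((x - e) / (B + 1)).
  by apply: h => s us; rewrite ler_pdivlMr // mulrC; have := hs s us; lra.
have := hs [::] isT; rewrite big_nil mulr0 add0r => ex.
rewrite mulrA ler_pdivlMr //; nra.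
Qed.

Section Slices.
Context {R : realType} {d : nat}.
Local Notation leb := (@lebesgue_measure R).
Local Notation RR := (measurableTypeR R).
Local Notation T := (d.+1.-tuple R).
Local Notation T' := (d.-tuple R).
Implicit Types (f : T -> R[i]) (w : T' -> R[i]) (k : nat).

Definition slice f (y : T') : RR -> R[i] := fun x => f (tcons (x, y)).
(** The partial Fourier coefficient in the first variable, as a function of the others. *)
Definition fc f k (y : T') : R[i] := fcoef (slice f y) k.

Lemma mfunc_slice f y : mfunc f -> mfunc (slice f y).
Proof.
by case=> f1 f2; split; [exact: measurable_tcons_sect2 f1 | exact: measurable_tcons_sect2 f2].
Qed.

Lemma measurable_thead : measurable_fun [set: T] (fun t => thead t : R).
Proof. by rewrite (_ : (fun t => thead t : R) = fun t => tnth t ord0) //; exact: measurable_tnth. Qed.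

Lemma mfunc_comp d1 d2 (T1 : measurableType d1) (T2 : measurableType d2) (g : T2 -> R[i]) (h : T1 -> T2) :
  measurable_fun [set: T1] h -> mfunc g -> mfunc (g \o h).
Proof. by move=> mh [g1 g2]; split; [exact: measurableT_comp g1 mh|exact: measurableT_comp g2 mh]. Qed.

Lemma mfunc_headch (a : R) : mfunc (fun t : T => ch1 (a * thead t)).
Proof. by apply: mfunc_ch1; apply: measurable_funM => //; exact: measurable_thead. Qed.

Lemma slice_int f : L2mu (tmu d.+1) f ->
  (\int[tmu d.+1]_t (sqmod (f t))%:E = \int[tmu d]_y \int[leb]_x (sqmod (slice f y x))%:E)%E.
Proof.
move=> lf; rewrite ge0_integral_tcons2 //; first exact: mfunc_Esqmod lf.1.
by move=> t; rewrite lee_fin sqmod_ge0.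
Qed.

Lemma measurable_slice_int f : mfunc f ->
  measurable_fun [set: T'] (fun y => \int[leb]_x (sqmod (slice f y x))%:E)%E.
Proof.
move=> mf.
have h : measurable_fun [set: RR * T'] ((EFin \o (fun t => sqmod (f t))) \o @tcons R d).
  by apply: measurableT_comp; [exact: mfunc_Esqmod | exact: measurable_tcons].
apply: (@measurable_fun_fubini_tonelli_G _ _ RR T' R leb _ h).
by move=> p; rewrite lee_fin sqmod_ge0.
Qed.

Lemma slice_L2_ae f : L2mu (tmu d.+1) f -> \forall y \ae tmu d, L2mu leb (slice f y).
Proof.
move=> lf; have : (tmu d).-integrable [set: T'] (fun y => \int[leb]_x (sqmod (slice f y x))%:E)%E.
  apply/integrableP; split; first exact: measurable_slice_int lf.1.
  have h := lf.2; rewrite slice_int // in h; apply: le_lt_trans h.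
  rewrite le_eqVlt; apply/orP; left; apply/eqP; apply: eq_integral => y _.
  by rewrite gee0_abs // integral_ge0 // => x _; rewrite lee_fin sqmod_ge0.
move=> /(integrable_ae measurableT); apply: (@filterS _ _ (ae_filter_ringOfSetsType (tmu d))).
move=> y /(_ I) h; split; first exact: mfunc_slice lf.1.
by rewrite -ge0_fin_numE // integral_ge0 // => x _; rewrite lee_fin sqmod_ge0.
Qed.

Section Bounded.
Variable K : nat.

Lemma slice_out f y x : L2on (box K) f -> ~ [set` `](- K%:R), K%:R]] x -> slice f y x = 0.
Proof. by move=> lf nx; apply: lf.2 => /box_tcons[h _]; apply: nx; rewrite /= in_itv. Qed.

Lemma slice_cintegrable f y a : L2on (box K) f -> L2mu leb (slice f y) ->
  cintegrable leb (fun x => slice f y x * conjc (ch1 (a * x))).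
Proof.
move=> lf ls; pose J : set RR := [set` `](- K%:R), K%:R]].
have mJ : measurable J by exact: measurable_itv.
have lJ : L2mu leb (rs J (fun x : RR => ch1 (a * x))).
  apply: (L2mu_rs (M := 1)) => //; [exact: itv_oc_lty|exact: ch1_mul_mfunc|].
  by move=> x; rewrite sqmod_ch1.
have := L2mu_cintegrable ls lJ; congr (cintegrable _ _); apply/funext => x.
by rewrite /rs; case: asboolP => h //; rewrite (slice_out _ lf h) !mul0r.
Qed.

Lemma fc_integrable f k : L2on (box K) f ->
  cintegrable (tmu d.+1) (fun t => f t * conjc (ch1 ((nu k)%:~R * thead t))).
Proof.
move=> lf; apply: (L2on_bmul_integrable (M := 1) lf).
  by apply: mfuncJ; exact: mfunc_headch.
by move=> t; rewrite sqmodJ sqmod_ch1.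
Qed.

Lemma mfunc_fc f k : L2on (box K) f -> mfunc (fc f k).
Proof.
move=> lf; have [h _] := cint_tcons (fc_integrable k lf).
by apply: cintegrable_mfunc h.
Qed.

(* Extended-valued, so that columns on which [f] is not square integrable need no exception. *)
Lemma fc_bessel f N y : L2on (box K) f ->
  (\sum_(k < N) (sqmod (fc f k y))%:E <=
    (K.*2.+1)%:R%:E * \int[leb]_x (sqmod (slice f y x))%:E)%E.
Proof.
move=> lf.
have h0 : (0 <= \int[leb]_x (sqmod (slice f y x))%:E)%E.
  by apply: integral_ge0 => x _; rewrite lee_fin sqmod_ge0.
case: (boolP ((\int[leb]_x (sqmod (slice f y x))%:E)%E \is a fin_num)); last first.
  by rewrite ge0_fin_numE // -leNgt leye_eq => /eqP ->; rewrite gt0_muley ?leey ?lte_fin.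
rewrite ge0_fin_numE // => fin.
have ls : L2mu leb (slice f y) by split => //; exact: mfunc_slice lf.1.1.
rewrite sumEFin (L2mu_int ls) -EFinM lee_fin.
apply: le_trans (bessel_interval N ls (fun x => @slice_out f y x lf)) _.
by rewrite ler_wpM2r ?ler_nat // fine_ge0.
Qed.

Lemma fc_nr_bessel f N : L2on (box K) f ->
  (\sum_(k < N) \int[tmu d]_y (sqmod (fc f k y))%:E <= (K.*2.+1)%:R%:E * (nr f)%:E)%E.
Proof.
move=> lf; have ms := measurable_slice_int lf.1.1.
rewrite -ge0_integral_sum //; last 2 first.
- by move=> k; apply: mfunc_Esqmod; exact: mfunc_fc.
- by move=> k y _; rewrite lee_fin sqmod_ge0.
rewrite -(nrE lf.1) (slice_int lf.1) -ge0_integralZl //; last first.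
  by move=> y _; apply: integral_ge0 => x _; rewrite lee_fin sqmod_ge0.
apply: ge0_le_integral => //.
- by move=> y _; apply: sume_ge0 => k _; rewrite lee_fin sqmod_ge0.
- by apply: emeasurable_sum => k; apply: mfunc_Esqmod; exact: mfunc_fc.
- exact: emeasurable_funM.
- by move=> y _; exact: fc_bessel.
Qed.

Lemma fc_L2on f k : L2on (box K) f -> L2on (@box R d K) (fc f k).
Proof.
move=> lf; split.
  split; first exact: mfunc_fc.
  apply: (@le_lt_trans _ _ ((K.*2.+1)%:R%:E * (nr f)%:E)%E); last by rewrite -EFinM ltry.
  apply: le_trans (fc_nr_bessel k.+1 lf); rewrite big_ord_recr /= leeDr //.
  apply: sume_ge0 => j _; apply: integral_ge0 => y _; by rewrite lee_fin sqmod_ge0.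
move=> y ny; rewrite /fc (_ : slice f y = fun=> 0).
  rewrite /fcoef; under eq_fun do rewrite mul0r.
  exact: cint0.
by apply/funext => x; apply: lf.2 => /box_tcons[].
Qed.

Lemma fc_bessel_nr f N : L2on (box K) f -> \sum_(k < N) nr (fc f k) <= (K.*2.+1)%:R * nr f.
Proof.
move=> lf; rewrite -lee_fin EFinM -sumEFin; apply: le_trans (fc_nr_bessel N lf).
rewrite le_eqVlt; apply/orP; left; apply/eqP; apply: eq_bigr => k _.
by rewrite nrE //; exact: (fc_L2on k lf).1.
Qed.

(** Fubini for a kernel that is a character in the first variable times [w] in the others. The
    splitting is asked only after multiplication by [f], which covers both the exponentials and the
    truncated products [tens]. *)
Lemma cint_fc f (W : T -> R[i]) w k : L2on (box K) f -> mfunc w ->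
  cintegrable (tmu d.+1) (fun t => f t * conjc (W t)) ->
  (forall x y, f (tcons (x, y)) * conjc (W (tcons (x, y))) =
     conjc (w y) * (f (tcons (x, y)) * conjc (ch1 ((nu k)%:~R * x)))) ->
  pr f W = pr (fc f k) w.
Proof.
move=> lf mw cW hW; rewrite /pr /L2ip; have [ci ->] := cint_tcons cW.
apply: cint_ae; first exact: cintegrable_mfunc ci.
  by apply: mfuncM; [exact: mfunc_fc | exact: mfuncJ].
apply: (@filterS _ _ (ae_filter_ringOfSetsType (tmu d))) (slice_L2_ae lf.1) => y ls.
under eq_fun do rewrite hW.
rewrite cintZ; first exact: mulrC.
by apply: slice_cintegrable.
Qed.

Lemma ft_fc f k (l : T') : L2on (box K) f -> ft f (tcons ((nu k)%:~R, l)) = ft (fc f k) l.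
Proof.
move=> lf; apply: cint_fc => //; first exact: mfunc_ch.
  exact: ft_integrable lf.
by move=> x y; rewrite ch_tcons rmorphM /=; ring.
Qed.

End Bounded.
End Slices.

Section Cylinder.
Context {R : realType} {d K : nat}.
Local Notation leb := (@lebesgue_measure R).
Local Notation RR := (measurableTypeR R).
Variables (T : set (d.+1.-tuple R)) (B : set (d.-tuple R)) (beta : d.-tuple R -> R).
Hypotheses (mT : measurable T) (TK : T `<=` box K).
Hypothesis hT : forall x y, T (tcons (x, y)) <-> B y /\ beta y < x <= beta y + 1.
Implicit Types (f : d.+1.-tuple R -> R[i]) (w : d.-tuple R -> R[i]).

(** The product of a character in the first variable and of [w], cut off to [T]: on each fibre a
    multiple of a member of the Fourier basis of that fibre. *)
Definition tens k w : d.+1.-tuple R -> R[i] :=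
  rs T (fun t => ch1 ((nu k)%:~R * (tuncons t).1) * w (tuncons t).2).

Lemma slice_tens k w y : (forall y, ~ B y -> w y = 0) ->
  slice (tens k w) y = fun x => w y * rs [set` `]beta y, beta y + 1]] (fun x => ch1 ((nu k)%:~R * x)) x.
Proof.
move=> w0; apply/funext => x; rewrite /slice /tens /rs tconsK /=.
case: asboolP => [/hT[By hx]|nT].
  by rewrite asboolT ?in_itv //= mulrC.
case: (pselect (B y)) => By; last by rewrite w0 // mul0r.
by rewrite asboolF ?mulr0 //= in_itv /= => hx; apply: nT; apply/hT.
Qed.

Lemma L2on_tens k w : L2on B w -> L2on T (tens k w).
Proof.
move=> [lw w0].
have mt : mfunc (tens k w).
  apply: mfunc_rs => //; apply: mfuncM; first exact: mfunc_headch.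
  have h := measurableT_comp (@measurable_snd _ _ RR (d.-tuple R)) (@measurable_tuncons R d).
  exact: (mfunc_comp h lw.1).
split; last by move=> t nT; rewrite /tens /rs (asboolF nT).
split=> //; apply: le_lt_trans lw.2.
rewrite ge0_integral_tcons2 //; last 2 first.
- exact: mfunc_Esqmod.
- by move=> t; rewrite lee_fin sqmod_ge0.
apply: ge0_le_integral => //.
- by move=> y _; apply: integral_ge0 => x _; rewrite lee_fin sqmod_ge0.
- exact: measurable_slice_int.
- exact: mfunc_Esqmod lw.1.
move=> y _.
have -> : (\int[leb]_x (sqmod (tens k w (tcons (x, y))))%:E)%E =
    (\int[leb]_x ((sqmod (w y))%:E * (\1_([set` `]beta y, beta y + 1]] : set RR) x)%:E))%E.
  apply: eq_integral => x _; rewrite -EFinM; congr EFin.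
  have := slice_tens k y w0 => /(congr1 (fun g => g x)); rewrite /slice => ->.
  rewrite sqmodM; congr (_ * _); rewrite /rs indicE; case: asboolP => h.
    by rewrite mem_set // sqmod_ch1.
  by rewrite memNset // sqmod0.
have mJ := unit_itv_measurable (beta y).
rewrite ge0_integralZl ?lee_fin ?sqmod_ge0 //; last first.
  by apply/measurable_EFinP; exact: measurable_indic.
rewrite integral_indic // setIT.
by rewrite [X in (_ * X <= _)%E](_ : _ = 1%E) ?mule1 //; exact: unit_itv_measure.
Qed.

Lemma fc_tens k j w : (forall y, ~ B y -> w y = 0) ->
  fc (tens k w) j = fun y => w y * if k == j then 1 else 0.
Proof.
move=> w0; apply/funext => y; rewrite /fc slice_tens // /fcoef.
have E x : w y * rs [set` `]beta y, beta y + 1]] (fun x : RR => ch1 ((nu k)%:~R * x)) x *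
      conjc (ch1 ((nu j)%:~R * x)) =
    w y * rs [set` `]beta y, beta y + 1]] (fun x : RR => ch1 ((nu k - nu j)%:~R * x)) x.
  rewrite -mulrA; congr (_ * _); rewrite /rs; case: ifP => _; last by rewrite mul0r.
  by rewrite -ch1N -ch1D rmorphB /= mulrBl.
under eq_fun do rewrite E.
rewrite cintZ; first by rewrite exp_orth subr_eq0 (inj_eq nu_inj).
have mJ := unit_itv_measurable (beta y).
have lJ a : L2mu leb (rs [set` `]beta y, beta y + 1]] (fun x : RR => ch1 (a * x))).
  apply: (L2mu_rs (M := 1)) => //; [exact: itv_oc_lty|exact: ch1_mul_mfunc|].
  by move=> x; rewrite sqmod_ch1.
have := L2mu_cintegrable (lJ (nu k - nu j)%:~R) (lJ 0).
congr (cintegrable _ _); apply/funext => x; rewrite /rs; case: ifP => _; last by rewrite mul0r.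
by rewrite mul0r ch10 conjc1 mulr1.
Qed.

Lemma pr_tens f k w : L2on T f -> L2on B w -> pr f (tens k w) = pr (fc f k) w.
Proof.
move=> lf lw; apply: (cint_fc (K := K)); first exact: L2on_sub lf.
- exact: lw.1.1.
- by apply: L2mu_cintegrable lf.1 _; exact: (L2on_tens k lw).1.
move=> x y; case: (pselect (T (tcons (x, y)))) => h; last by rewrite lf.2 // !mul0r mulr0.
by rewrite /tens /rs (asboolT h) tconsK rmorphM /=; ring.
Qed.

Lemma fc_L2onB f k : L2on T f -> L2on B (fc f k).
Proof.
move=> lf; split; first by have [] := fc_L2on k (L2on_sub TK lf).
move=> y ny; rewrite /fc (_ : slice f y = fun=> 0).
  rewrite /fcoef; under eq_fun do rewrite mul0r.
  exact: cint0.
by apply/funext => x; apply: lf.2 => /hT[].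
Qed.

(** Each fibre of [T] is an interval of length 1, where Parseval holds; the fibrewise series is then
    integrated term by term. *)
Lemma nr_fc_le f (S : R) : L2on T f -> (forall N, \sum_(k < N) nr (fc f k) <= S) -> nr f <= S.
Proof.
move=> lf h; have lK := L2on_sub TK lf.
have S0 : 0 <= S by have := h 0; rewrite big_ord0.
have mE k : measurable_fun [set: d.-tuple R] (fun y => (sqmod (fc f k y))%:E).
  by apply: mfunc_Esqmod; exact: mfunc_fc lK.
rewrite -lee_fin -(nrE lf.1) slice_int; last exact: lf.1.
have -> : (\int[tmu d]_y \int[leb]_x (sqmod (slice f y x))%:E)%E =
   (\int[tmu d]_y \sum_(0 <= k <oo) (sqmod (fc f k y))%:E)%E.
  apply: ae_eq_integral => //; first exact: measurable_slice_int lf.1.1.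
    by apply: ge0_emeasurable_sum => // k y _ _; rewrite lee_fin sqmod_ge0.
  apply: (@filterS _ _ (ae_filter_ringOfSetsType (tmu d))) (slice_L2_ae lf.1) => y ls _ /=.
  apply: (parseval (b := beta y) ls) => x nx; apply: lf.2 => /hT[_ hx]; apply: nx.
  by rewrite /= in_itv.
rewrite integral_nneseries //; last by move=> k y _; rewrite lee_fin sqmod_ge0.
apply: lime_le.
  by apply: is_cvg_nneseries => k _ _; apply: integral_ge0 => y _; rewrite lee_fin sqmod_ge0.
apply: nearW => N; rewrite big_mkord.
rewrite (eq_bigr (fun k : 'I_N => (nr (fc f k))%:E)); first by rewrite sumEFin lee_fin; exact: h.
by move=> k _; rewrite nrE //; exact: (fc_L2on k lK).1.
Qed.

Lemma sum_pairs_le (I : choiceType) (F : nat * I -> R) (M : nat -> R) (s : seq (nat * I)) (S : R) :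
  (forall p, 0 <= F p) -> uniq s -> (forall k t, uniq t -> \sum_(i <- t) F (k, i) <= M k) ->
  (forall N, \sum_(k < N) M k <= S) -> \sum_(p <- s) F p <= S.
Proof.
move=> F0 us hM hS.
pose N := (\max_(p <- s) p.1).+1; pose t := undup [seq p.2 | p <- s].
apply: le_trans (hS N).
apply: (@le_trans _ _ (\sum_(k < N) \sum_(i <- t) F (k : nat, i))); last first.
  by apply: ler_sum => k _; apply: hM; exact: undup_uniq.
rewrite -(big_mkord xpredT (fun k => \sum_(i <- t) F (k, i))) /index_iota subn0.
rewrite -big_allpairs_dep.
have sub : {subset s <= [seq (k, i) | k <- iota 0 N, i <- t]}.
  move=> p sp; apply/allpairsP; exists p; split; last by case: p sp.
    by rewrite mem_iota add0n leq0n ltnS /=; exact: (@leq_bigmax_seq _ s xpredT (fun p => p.1)).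
  by rewrite mem_undup; apply/mapP; exists p.
have ut : uniq [seq (k, i) | k <- iota 0 N, i <- t].
  apply: allpairs_uniq; rewrite ?iota_uniq ?undup_uniq //.
  by move=> [a b] [a' b'] _ _ [-> ->].
by rewrite (sum_sub _ us ut sub) lerDl sumr_ge0.
Qed.

(** At the frequency [(nu k, lam i)] the transform of [f] is the transform of [fc f k] at [lam i].
    The bounds on [B] are applied to each [fc f k] and summed over [k] by Parseval or Bessel. *)
Theorem rb_cylinder (I : choiceType) (lam : I -> d.-tuple R) u : rb B lam u ->
  rb T (fun p : nat * I => tcons ((nu p.1)%:~R, lam p.2)) (fun p => tens p.1 (u p.2)).
Proof.
move=> [hu ho hc hb [C0 C00 hl] hi].
have lU p : L2on T (tens p.1 (u p.2)) by exact: L2on_tens.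
have fE f (p : nat * I) : L2on T f -> ft f (tcons ((nu p.1)%:~R, lam p.2)) = ft (fc f p.1) (lam p.2).
  by move=> lf; apply: (ft_fc (K := K)); exact: L2on_sub lf.
have lower f M : L2on T f -> ell2 (fun p : nat * I => ft f (tcons ((nu p.1)%:~R, lam p.2))) M ->
    nr f <= (C0 + 1) * M.
  move=> lf fM; apply: nr_fc_le => // N; apply/ler_addgt0Pr => e e0.
  (* The error [e] is shared among the [N] coefficients; [N.+1] avoids dividing by 0. *)
  have e'0 : 0 < e / N.+1%:R by rewrite divr_gt0.
  have sP k := ell2_near C00 e'0 (fun M => hl (fc f k) M (fc_L2onB k lf)).
  pose s k := sval (cid2 (sP k)).
  have us k : uniq (s k) by rewrite /s; case: (cid2 _).
  have hs k : nr (fc f k) <= (C0 + 1) * (\sum_(i <- s k) sqmod (ft (fc f k) (lam i))) + e / N.+1%:R.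
    by rewrite /s; case: (cid2 _).
  apply: (@le_trans _ _ (\sum_(k < N) ((C0 + 1) * (\sum_(i <- s k) sqmod (ft (fc f k) (lam i))) + e / N.+1%:R))).
    by apply: ler_sum => k _; exact: hs.
  rewrite big_split /= -mulr_sumr sumr_const card_ord; apply: lerD; last first.
    rewrite -[leLHS]mulr_natr mulrAC ler_pdivrMr // ler_pM2l // ler_nat; exact: leqnSn.
  rewrite ler_wpM2l ?addr_ge0 //.
  (* All the lists [s k] together form one duplicate-free list of pairs, so that [fM] bounds the
     total by [M] only once. *)
  pose t := flatten [seq [seq (k, i) | i <- s k] | k <- iota 0 N].
  have -> : \sum_(k < N) \sum_(i <- s k) sqmod (ft (fc f k) (lam i)) =
      \sum_(p <- t) sqmod (ft f (tcons ((nu p.1)%:~R, lam p.2))).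
    rewrite /t -[RHS]/(\sum_(p <- [seq (k, i) | k <- iota 0 N, i <- s k]) _).
    rewrite big_allpairs_dep /=.
    rewrite -(big_mkord xpredT (fun k => \sum_(i <- s k) sqmod (ft (fc f k) (lam i)))) /index_iota subn0.
    by apply: eq_bigr => k _; apply: eq_bigr => i _; rewrite (fE f (k, i)).
  apply: fM; apply: allpairs_uniq_dep => [|k _|]; rewrite ?iota_uniq ?us //.
  by move=> [a b] [a' b'] _ _ /= [] -> ->.
have C10 : 0 <= C0 + 1 by rewrite addr_ge0.
split=> //.
- move=> [k i] [l j] /=; rewrite (pr_tens l (lU (k, i)) (hu j)) fc_tens; last exact: (hu i).2.
  rewrite xpair_eqE; case: (eqVneq k l) => [_|_] /=.
    by under eq_fun do rewrite mulr1; exact: ho.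
  under eq_fun do rewrite mulr0.
  rewrite /pr /L2ip; under eq_fun do rewrite mul0r.
  exact: cint0.
- move=> f lf f0; apply/eqP; rewrite eq_le nr_ge0 andbT; apply: nr_fc_le => // N.
  rewrite big1 // => k _; apply: hc => [|i]; first exact: fc_L2onB.
  by have := f0 (k : nat, i); rewrite pr_tens.
- move=> L; have [C C1 hC] := hb L; exists (C * (L.*2.+1)%:R); first by rewrite mulr_ge0.
  move=> f lf s us.
  apply: (@sum_pairs_le _ (fun p => sqmod (ft f (tcons ((nu p.1)%:~R, lam p.2)))) (fun k => C * nr (fc f k))) => //.
  + by move=> p; exact: sqmod_ge0.
  + move=> k t ut; have := hC _ (fc_L2on k lf) t ut; apply: le_trans.
    by apply: ler_sum => i _; rewrite (ft_fc k (lam i) lf).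
  + by move=> N; rewrite -mulr_sumr -mulrA ler_wpM2l // fc_bessel_nr.
- by exists (C0 + 1).
- have hP i := hi _ _ (@delta_ell2 R I i).
  pose h i := sval (cid2 (hP i)).
  have lh i : L2on B (h i) by rewrite /h; case: (cid2 _).
  have hh i j : ft (h i) (lam j) = if i == j then 1 else 0.
    by rewrite /h; case: (cid2 _) => /= ? _ ->; rewrite eq_sym.
  apply: (chX_biorth mT TK (h := fun p => tens p.1 (h p.2)) C10) => //.
    by move=> p; exact: L2on_tens.
  move=> [k i] [l j]; rewrite fE /=; last exact: L2on_tens.
  rewrite fc_tens; last exact: (lh i).2.
  rewrite xpair_eqE; case: (eqVneq k l) => [_|_] /=.
    by under eq_fun do rewrite mulr1; exact: hh.
  under eq_fun do rewrite mulr0.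
  rewrite /ft /pr /L2ip; under eq_fun do rewrite mul0r.
  exact: cint0.
Qed.

End Cylinder.

(** * Affine changes of variables *)

Section Affine.
Context {R : realType}.
Local Notation leb := (@lebesgue_measure R).
Local Notation RR := (measurableTypeR R).

Definition aff1 (a b : R) : RR -> RR := fun x => a * x + b.

Lemma measurable_aff1 a b : measurable_fun [set: RR] (aff1 a b).
Proof. by apply: measurable_funD => //; apply: measurable_funM => //; exact: measurable_id. Qed.

Lemma aff1K a b : a != 0 -> cancel (aff1 a b) (aff1 a^-1 (- (b / a))).
Proof. by move=> a0 x; rewrite /aff1; field. Qed.
Lemma aff1VK a b : a != 0 -> cancel (aff1 a^-1 (- (b / a))) (aff1 a b).
Proof. by move=> a0 x; rewrite /aff1; field. Qed.

Lemma aff1_preimage_measure (a b p q : R) : a != 0 ->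
  leb (aff1 a b @^-1` `]p, q]) = (`|a|^-1%:E * leb `]p, q]%classic)%E.
Proof.
move=> a0; have := a0; rewrite neq_lt => /orP[an|ap].
  have -> : aff1 a b @^-1` `]p, q] = [set` `[(q - b) / a, (p - b) / a[].
    apply/seteqP; split=> x; rewrite /= !in_itv /= ler_ndivrMr // ltr_ndivlMr // /aff1;
      by move=> /andP[h1 h2]; apply/andP; split; lra.
  rewrite !lebesgue_measure_itv /= !lte_fin ltr_nM2r ?invr_lt0 // ltrD2r.
  rewrite (ltr0_norm an); case: ifP => _; last by rewrite mule0.
  by rewrite -!EFinB -EFinM; congr EFin; field.
have -> : aff1 a b @^-1` `]p, q] = [set` `](p - b) / a, (q - b) / a]].
  apply/seteqP; split=> x; rewrite /= !in_itv /= ltr_pdivrMr // ler_pdivlMr // /aff1;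
    by move=> /andP[h1 h2]; apply/andP; split; lra.
rewrite !lebesgue_measure_itv /= !lte_fin ltr_pM2r ?invr_gt0 // ltrD2r.
rewrite (gtr0_norm ap); case: ifP => _; last by rewrite mule0.
by rewrite -!EFinB -EFinM; congr EFin; field.
Qed.

(** The image of Lebesgue measure, multiplied by [|a|], gives each half-open interval its length,
    hence is Lebesgue measure by uniqueness. *)
Lemma integral_aff1 (a b : R) (h : RR -> \bar R) : a != 0 -> measurable_fun [set: RR] h ->
  (forall x, 0 <= h x)%E -> (\int[leb]_x h (aff1 a b x) = `|a|^-1%:E * \int[leb]_x h x)%E.
Proof.
move=> a0 mh h0; have na : 0 < `|a| by rewrite normr_gt0.
have [nu' hnu] := ex_pushforward (sigma_finiteT leb) (measurable_aff1 a b)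
  (measurable_aff1 _ _) (aff1K b a0) (aff1VK b a0).
have k0 : 0 <= `|a| by exact: ltW.
pose m := mscale (NngNum k0) nu'.
have nuE (X : set RR) : measurable X -> nu' X = leb (aff1 a b @^-1` X).
  move=> mX; have mX' : measurable (aff1 a b @^-1` X).
    by rewrite -[Y in measurable Y]setTI; exact: measurable_aff1.
  have := hnu (fun x => (\1_X x)%:E); rewrite integral_indic // setIT => ->.
  - by rewrite -[in RHS](setIT (_ @^-1` _)) -integral_indic.
  - by apply/measurable_EFinP; exact: measurable_indic.
  - by move=> x; rewrite lee_fin indicE ler0n.
have hm (X : set RR) : measurable X -> leb X = m X.
  apply: lebesgue_measure_unique => Y [[p q] _ <-] /=.
  rewrite /m /mscale /= nuE ?aff1_preimage_measure //.
  by rewrite muleA -EFinM mulfV ?mul1e // gt_eqF.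
have -> : (\int[leb]_x h x = \int[m]_x h x)%E.
  by apply: eq_measure_integral => A mA _; exact: hm.
rewrite ge0_integral_mscale //= muleA -EFinM mulVf ?mul1e ?gt_eqF //.
by rewrite hnu.
Qed.

Definition tadd n (t s : n.-tuple R) : n.-tuple R := [tuple tnth t i + tnth s i | i < n].

Lemma measurable_tadd d (T : measurableType d) n (f g : T -> n.-tuple R) :
  measurable_fun [set: T] f -> measurable_fun [set: T] g ->
  measurable_fun [set: T] (fun t => tadd (f t) (g t)).
Proof.
move=> /measurable_fun_tnthP mf /measurable_fun_tnthP mg; apply/measurable_fun_tnthP => i.
rewrite (_ : _ \o _ = fun t => tnth (f t) i + tnth (g t) i).
  by apply: measurable_funD; [exact: mf|exact: mg].
by apply/funext => t /=; rewrite tnth_mktuple.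
Qed.

Definition tlin n (w c : n.-tuple R) (x : R) : n.-tuple R := [tuple x * tnth w i + tnth c i | i < n].

Lemma measurable_tlin n w c : measurable_fun [set: RR] (@tlin n w c).
Proof.
apply/measurable_fun_tnthP => i; rewrite (_ : _ \o _ = fun x : RR => x * tnth w i + tnth c i).
  by apply: measurable_funD => //; apply: measurable_funM => //; exact: measurable_id.
by apply/funext => t /=; rewrite tnth_mktuple.
Qed.

(** The map [(x, y) -> (a x + b, y + x w + c)]. One such map carries [e_0] to any vector whose first
    coordinate is not 0, and its Jacobian comes from the first variable alone. *)
Definition aff n (a b : R) (w c : n.-tuple R) (t : n.+1.-tuple R) : n.+1.-tuple R :=
  let p := tuncons t in tcons (aff1 a b p.1, tadd p.2 (tlin w c p.1)).

Lemma aff_tcons n a b (w c : n.-tuple R) (x : R) y :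
  aff a b w c (tcons (x, y)) = tcons (a * x + b, tadd y (tlin w c x)).
Proof. by rewrite /aff tconsK. Qed.

Lemma measurable_aff n a b (w c : n.-tuple R) : measurable_fun [set: n.+1.-tuple R] (aff a b w c).
Proof.
have mu := @measurable_tuncons R n.
have m1 := measurableT_comp (@measurable_fst _ _ RR (n.-tuple R)) mu.
have m2 := measurableT_comp (@measurable_snd _ _ RR (n.-tuple R)) mu.
apply: (measurableT_comp (@measurable_tcons R n)).
apply/measurable_fun_pairP; split.
  exact: (measurableT_comp (measurable_aff1 a b) m1).
apply: measurable_tadd; first exact: m2.
exact: (measurableT_comp (measurable_tlin w c) m1).
Qed.

Definition affV_w n (a : R) (w : n.-tuple R) : n.-tuple R := [tuple - (tnth w i / a) | i < n].
Definition affV_c n (a b : R) (w c : n.-tuple R) : n.-tuple R :=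
  [tuple b * tnth w i / a - tnth c i | i < n].
Definition affV n a b (w c : n.-tuple R) := aff a^-1 (- (b / a)) (affV_w a w) (affV_c a b w c).

Lemma tconsP n (t : n.+1.-tuple R) : exists (x : R) (y : n.-tuple R), t = tcons (x, y).
Proof. by exists (tuncons t).1, (tuncons t).2; rewrite -[LHS]tunconsK -surjective_pairing. Qed.

Lemma affK n a b (w c : n.-tuple R) : a != 0 -> cancel (aff a b w c) (affV a b w c).
Proof.
move=> a0 t; have [x [y ->]] := tconsP t.
rewrite aff_tcons /affV aff_tcons; congr tcons; congr pair; first exact: (aff1K b a0 x).
by apply: eq_from_tnth => i; rewrite !tnth_mktuple; field.
Qed.

Lemma affVK n a b (w c : n.-tuple R) : a != 0 -> cancel (affV a b w c) (aff a b w c).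
Proof.
move=> a0 t; have [x [y ->]] := tconsP t.
rewrite [affV _ _ _ _ _]aff_tcons aff_tcons; congr tcons; congr pair; first exact: (aff1VK b a0 x).
by apply: eq_from_tnth => i; rewrite !tnth_mktuple; field.
Qed.

(** For fixed first coordinate the others undergo a translation. Its invariance is a hypothesis here
    because [integral_tadd] is itself obtained from this lemma by induction on the dimension. *)
Lemma integral_aff n a b (w c : n.-tuple R) (h : n.+1.-tuple R -> \bar R) : a != 0 ->
  (forall (c : n.-tuple R) (g : n.-tuple R -> \bar R), measurable_fun [set: n.-tuple R] g ->
     (forall x, 0 <= g x)%E -> (\int[tmu n]_y g (tadd y c) = \int[tmu n]_y g y)%E) ->
  measurable_fun [set: n.+1.-tuple R] h -> (forall x, 0 <= h x)%E ->
  (\int[tmu n.+1]_t h (aff a b w c t) = `|a|^-1%:E * \int[tmu n.+1]_t h t)%E.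
Proof.
move=> a0 IH mh h0.
have mc := @measurable_tcons R n.
rewrite !ge0_integral_tcons //; last exact: (measurableT_comp mh (measurable_aff a b w c)).
rewrite !(@fubini_tonelli1 _ _ RR (n.-tuple R) R leb (tmu n)) //; last 2 first.
- exact: (measurableT_comp mh mc).
- exact: (measurableT_comp (measurableT_comp mh (measurable_aff a b w c)) mc).
rewrite /fubini_F.
pose G (x : RR) := (\int[tmu n]_y h (tcons (x, y)))%E.
transitivity (\int[leb]_x G (aff1 a b x))%E.
  apply: eq_integral => x _; rewrite /G -(IH (tlin w c x)) //.
    by apply: eq_integral => y _; rewrite aff_tcons.
  exact: (measurable_tcons_sect (aff1 a b x) mh).
rewrite integral_aff1 //.
  have := @measurable_fun_fubini_tonelli_F _ _ RR (n.-tuple R) R (tmu n) _ (measurableT_comp mh mc).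
  by apply => p; exact: h0.
by move=> x; apply: integral_ge0.
Qed.

Lemma integral_tadd n (c : n.-tuple R) (g : n.-tuple R -> \bar R) :
  measurable_fun [set: n.-tuple R] g -> (forall x, 0 <= g x)%E ->
  (\int[tmu n]_y g (tadd y c) = \int[tmu n]_y g y)%E.
Proof.
elim: n c g => [|n IH] c g mg g0.
  apply: eq_integral => y _.
  by have -> : tadd y c = y by apply: eq_from_tnth => -[].
rewrite -(tunconsK c); case: (tuncons c) => c0 c'.
transitivity (\int[tmu n.+1]_t g (aff 1 c0 [tuple 0%R | _ < n] c' t))%E.
  apply: eq_integral => t _; congr g; rewrite -(tunconsK t); case: (tuncons t) => x y.
  rewrite aff_tcons mul1r; apply: eq_from_tnth => i; case: (unliftP ord0 i) => [j ->|->].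
    by rewrite tnth_mktuple !tnthS !tnth_mktuple mulr0 add0r.
  by rewrite tnth_mktuple !tnth0.
by rewrite integral_aff ?oner_neq0 // normr1 invr1 mul1e.
Qed.

(* [a] is the inverse of the Jacobian of [phi]. *)
Record cov n (phi psi : n.-tuple R -> n.-tuple R) (a : R) : Prop := Cov {
  cov_m : measurable_fun setT phi;
  cov_mV : measurable_fun setT psi;
  cov_K : cancel phi psi;
  cov_VK : cancel psi phi;
  cov_gt0 : 0 < a;
  cov_int : forall h : n.-tuple R -> \bar R, measurable_fun setT h -> (forall x, 0 <= h x)%E ->
    (\int[tmu n]_t h (phi t) = a%:E * \int[tmu n]_t h t)%E }.

Lemma cov_aff n a b (w c : n.-tuple R) : a != 0 -> cov (aff a b w c) (affV a b w c) `|a|^-1.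
Proof.
move=> a0; split.
- exact: measurable_aff.
- exact: measurable_aff.
- exact: affK.
- exact: affVK.
- by rewrite invr_gt0 normr_gt0.
- by move=> h mh h0; apply: integral_aff => //; exact: integral_tadd.
Qed.

Lemma cov_tadd n (c : n.-tuple R) : 
  cov (fun t => tadd t c) (fun t => tadd t [tuple - tnth c i | i < n]) 1.
Proof.
have m e : measurable_fun [set: n.-tuple R] (fun t => tadd t e).
  by apply: measurable_tadd => //; exact: measurable_id.
split=> //.
- by move=> t; apply: eq_from_tnth => i; rewrite !tnth_mktuple addrK.
- by move=> t; apply: eq_from_tnth => i; rewrite !tnth_mktuple subrK.
- by move=> h mh h0; rewrite mul1e integral_tadd.
Qed.

Section ChangeOfVariables.
Variables (n : nat) (phi psi : n.-tuple R -> n.-tuple R) (a : R).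
Hypothesis cv : cov phi psi a.
Implicit Types f g : n.-tuple R -> R[i].

Lemma cov_integral (h : n.-tuple R -> \bar R) : measurable_fun setT h ->
  (\int[tmu n]_t h (phi t) = a%:E * \int[tmu n]_t h t)%E.
Proof.
move=> mh; have h1 := measurable_funepos mh; have h2 := measurable_funeneg mh.
have [_ _ _ _ a0 ci] := cv.
rewrite [LHS]integralE [in RHS]integralE; rewrite (_ : (fun t => h (phi t)) = h \o phi) // funepos_comp funeneg_comp.
have e1 : (\int[tmu n]_t (h^\+ \o phi) t = a%:E * \int[tmu n]_t h^\+ t)%E by exact: ci.
have e2 : (\int[tmu n]_t (h^\- \o phi) t = a%:E * \int[tmu n]_t h^\- t)%E by exact: ci.
rewrite e1 e2.
have p1 : (0 <= \int[tmu n]_t h^\+ t)%E by exact: integral_ge0.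
have p2 : (0 <= \int[tmu n]_t h^\- t)%E by exact: integral_ge0.
move: p1 p2; case: (\int[tmu n]_t h^\+ t)%E => [r||]; case: (\int[tmu n]_t h^\- t)%E => [s||] //= _ _.
- by rewrite -EFinM -!EFinD -EFinM mulrDr mulrN.
- by rewrite !gt0_muley ?lte_fin //= gt0_muleNy ?lte_fin.
- by rewrite !gt0_muley ?lte_fin.
- by rewrite !gt0_muley ?lte_fin //= gt0_muleNy ?lte_fin.
Qed.

Lemma cov_mfunc f : mfunc f -> mfunc (f \o phi).
Proof. by apply: mfunc_comp; exact: cov_m cv. Qed.

Lemma cov_cint f : mfunc f -> cint (tmu n) (f \o phi) = (a%:C)%C * cint (tmu n) f.
Proof.
move=> [f1 f2].
have E (r : n.-tuple R -> R) : measurable_fun setT r ->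
    \int[tmu n]_t r (phi t) = a * \int[tmu n]_t r t.
  move=> mr; rewrite /Rintegral (cov_integral (h := fun t => (r t)%:E)); last exact/measurable_EFinP.
  case: (\int[tmu n]_t (r t)%:E)%E => [s||] //=.
  - by rewrite gt0_muley ?lte_fin ?(cov_gt0 cv) //= mulr0.
  - by rewrite gt0_muleNy ?lte_fin ?(cov_gt0 cv) //= mulr0.
apply: ceq; rewrite ?ReM ?ImM /= mul0r ?subr0 ?addr0.
  exact: (E _ f1).
exact: (E _ f2).
Qed.

Lemma cov_nr f : mfunc f -> nr (f \o phi) = a * nr f.
Proof.
move=> mf; rewrite /nr (cov_integral (h := fun t => (sqmod (f t))%:E)); last exact: mfunc_Esqmod.
case: (\int[tmu n]_t (sqmod (f t))%:E)%E => [s||] //=.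
- by rewrite gt0_muley ?lte_fin ?(cov_gt0 cv) //= mulr0.
- by rewrite gt0_muleNy ?lte_fin ?(cov_gt0 cv) //= mulr0.
Qed.

Lemma cov_L2on A f : L2on A f -> L2on (phi @^-1` A) (f \o phi).
Proof.
move=> [[mf lf] f0]; split; last by move=> t nA; exact: f0.
split; first exact: cov_mfunc.
rewrite (cov_integral (h := fun t => (sqmod (f t))%:E)); last exact: mfunc_Esqmod.
by apply: lte_mul_pinfty; rewrite ?lee_fin ?ltW ?(cov_gt0 cv).
Qed.

Lemma cov_pr f g : mfunc f -> mfunc g -> pr (f \o phi) (g \o phi) = (a%:C)%C * pr f g.
Proof. by move=> mf mg; rewrite -cov_cint //; apply: mfuncM => //; exact: mfuncJ. Qed.

End ChangeOfVariables.

Lemma cov_sym n (phi psi : n.-tuple R -> n.-tuple R) a : cov phi psi a -> cov psi phi a^-1.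
Proof.
move=> cv; have [m1 m2 K VK a0 ci] := cv; split => //; first by rewrite invr_gt0.
move=> h mh h0; have := ci (h \o psi) (measurableT_comp mh m2) (fun x => h0 _).
have -> : (fun t => (h \o psi) (phi t)) = h by apply/funext => t /=; rewrite K.
by move=> ->; rewrite muleA -EFinM mulVf ?gt_eqF // mul1e.
Qed.

End Affine.

(** * Riesz bases under changes of variables *)

Section Transport.
Context {R : realType} {n : nat}.
Local Notation T := (n.-tuple R).
Implicit Types (f g : T -> R[i]) (l t : T) (A : set T).

Lemma L2onZ A (c : R[i]) f : L2on A f -> L2on A (fun t => c * f t).
Proof. by move=> [lf f0]; split; [exact: L2muZ | move=> t /f0 ->; rewrite mulr0]. Qed.

Lemma ell2_scale (I : choiceType) (c c' : I -> R[i]) (a M : R) : 0 <= a ->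
  (forall i, sqmod (c' i) = a * sqmod (c i)) -> ell2 c M -> ell2 c' (a * M).
Proof.
move=> a0 h cM s us; under eq_bigr do rewrite h.
by rewrite -mulr_sumr ler_wpM2l // cM.
Qed.

Lemma prZl (c : R[i]) f g : L2mu (tmu n) f -> L2mu (tmu n) g -> pr (fun t => c * f t) g = c * pr f g.
Proof.
move=> lf lg; rewrite /pr /L2ip -cintZ; last exact: L2mu_cintegrable.
by apply: eq_cint => t; rewrite mulrA.
Qed.

Lemma prZr (c : R[i]) f g : L2mu (tmu n) f -> L2mu (tmu n) g ->
  pr f (fun t => c * g t) = conjc c * pr f g.
Proof.
move=> lf lg; rewrite /pr /L2ip -cintZ; last exact: L2mu_cintegrable.
by apply: eq_cint => t; rewrite rmorphM /= mulrCA.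
Qed.

Lemma cov_ft K (phi psi : T -> T) a f l l' (r : R) : cov phi psi a -> L2on (box K) f ->
  (forall t, dott l (phi t) = dott l' t + r) ->
  ft (f \o phi) l' = ch1 r * (a%:C)%C * ft f l.
Proof.
move=> cv lf h.
have mg : mfunc (fun t => f t * conjc (ch l t)).
  by apply: mfuncM; [exact: lf.1.1 | apply: mfuncJ; exact: mfunc_ch].
have cg := ft_integrable l lf.
rewrite -mulrA -(cov_cint cv mg) -cintZ.
  apply: eq_cint => t /=; rewrite /ch h ch1D rmorphM /=.
  transitivity (f (phi t) * (ch1 r * conjc (ch1 r)) * conjc (ch1 (dott l' t))); last by ring.
  by rewrite -sqmodE sqmod_ch1 mulr1.
case: cg => g1 g2; have [c1 c2] := conj (measurable_int _ g1) (measurable_int _ g2).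
have fin (h' : T -> R) : (tmu n).-integrable setT (EFin \o h') ->
    (tmu n).-integrable setT (EFin \o (h' \o phi)).
  move=> /integrableP[mh hoo]; apply/integrableP; split.
    exact: (measurableT_comp mh (cov_m cv)).
  rewrite (cov_int cv (h := fun t => `|(h' t)%:E|%E)) //; last exact: measurableT_comp.
  by apply: lte_mul_pinfty; rewrite ?lee_fin ?ltW ?(cov_gt0 cv).
by split; [exact: (fin _ g1) | exact: (fin _ g2)].
Qed.

(** [L] is the adjoint of the linear part of [phi], so [ft (f \o phi) (L l)] is [a * ft f l] up to a
    unimodular factor and the frequencies are pulled back by [L']. The factor [Num.sqrt a] restores
    the norm of [u i] after composition with [psi]. *)
Theorem rb_transport A (phi psi : T -> T) a (L L' : T -> T) (gam : T -> R)
    (I : choiceType) (lam : I -> T) u :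
  cov phi psi a -> (forall l t, dott l (phi t) = dott (L l) t + gam l) -> cancel L' L ->
  (forall K, exists K', phi @^-1` box K `<=` box K') -> (exists K, A `<=` box K) ->
  rb (phi @^-1` A) lam u ->
  rb A (fun i => L' (lam i)) (fun i t => ((Num.sqrt a)%:C)%C * u i (psi t)).
Proof.
move=> cv hL LK hbox [KA AKA] [hu ho hc hb [B B0 hl] hi].
have [m1 m2 K VK a0 ci] := cv; have cv' := cov_sym cv.
have a1 : a != 0 by rewrite gt_eqF.
have psiA : psi @^-1` (phi @^-1` A) = A by apply/seteqP; split => t /=; rewrite VK.
have luV g : L2on (phi @^-1` A) g -> L2on A (g \o psi) by move/(cov_L2on cv'); rewrite psiA.
have lf A' f : L2on A' f -> L2on (phi @^-1` A') (f \o phi) by exact: (cov_L2on cv).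
pose c : R[i] := ((Num.sqrt a)%:C)%C.
have c0 : c != 0.
  apply/eqP => /(congr1 (@complex.Re R)) /= /eqP; by rewrite sqrtr_eq0 leNgt a0.
have cc : c * conjc c = (a%:C)%C by rewrite -sqmodE sqmod_real sqr_sqrtr // ltW.
have lU i := luV _ (hu i).
have fE Kf f i : L2on (box Kf) f -> ft (f \o phi) (lam i) =
    ch1 (gam (L' (lam i))) * (a%:C)%C * ft f (L' (lam i)).
  move=> lf'; apply: cov_ft cv lf' _ => t; rewrite hL LK //.
have sE Kf f i : L2on (box Kf) f -> sqmod (ft (f \o phi) (lam i)) =
    a ^+ 2 * sqmod (ft f (L' (lam i))).
  by move=> lf'; rewrite (fE Kf) // !sqmodM sqmod_ch1 mul1r sqmod_real.
have nE f : mfunc f -> nr (f \o phi) = a * nr f by exact: (cov_nr cv).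
split.
- by move=> i; apply: L2onZ; exact: luV.
- move=> i j; rewrite -/c prZl ?prZr; [|exact: (lU i).1|exact: (lU j).1|exact: (lU i).1|exact: (L2muZ c (lU j).1)].
  rewrite mulrA cc (cov_pr cv' (hu i).1.1 (hu j).1.1) mulrA -rmorphM /= mulfV //= mul1r.
  exact: ho.
- move=> f lfA f0; have : nr (f \o phi) = 0.
    apply: hc => [|i]; first exact: lf.
    have := f0 i; rewrite -/c prZr; [|exact: lfA.1|exact: (lU i).1].
    have -> : f = (f \o phi) \o psi by apply/funext => t /=; rewrite VK.
    rewrite (cov_pr cv' (lf _ _ lfA).1.1 (hu i).1.1) mulrA => /eqP.
    rewrite mulf_eq0 => /orP[|/eqP]; last by rewrite (_ : (f \o phi) \o psi = f) //; apply/funext => t /=; rewrite VK.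
    rewrite mulf_eq0 conjc_eq0 (negbTE c0) /= => /eqP /(congr1 (@complex.Re R)) /= /eqP.
    by rewrite invr_eq0 (negbTE a1).
  rewrite nE; last exact: lfA.1.1.
  by move/eqP; rewrite mulf_eq0 (negbTE a1) => /eqP.
- move=> Kf; have [K' hK'] := hbox Kf; have [C C0 hC] := hb K'.
  exists (C / a); first by rewrite divr_ge0 // ltW.
  move=> f lf' s us; have := hC _ (L2on_sub hK' (lf _ _ lf')) s us.
  rewrite nE; last exact: lf'.1.1.
  under eq_bigr do rewrite (sE Kf) //.
  rewrite -mulr_sumr => h.
  have a2 : 0 < a ^+ 2 by rewrite exprn_gt0.
  rewrite -(ler_pM2l a2); apply: le_trans h _.
  by rewrite le_eqVlt; apply/orP; left; apply/eqP; field.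
- exists (B * a); first by rewrite mulr_ge0 // ltW.
  move=> f M lfA fM; have lK := L2on_sub AKA lfA.
  have := hl _ (a ^+ 2 * M) (lf _ _ lfA).
  rewrite nE; last exact: lfA.1.1.
  move=> h; rewrite -(ler_pM2l a0).
  have -> : a * (B * a * M) = B * (a ^+ 2 * M) by ring.
  apply: h; apply: ell2_scale fM; first exact: sqr_ge0.
  by move=> i; exact: sE lK.
- move=> c1 M cM.
  have c1M : ell2 (fun i => ch1 (gam (L' (lam i))) * (a%:C)%C * c1 i) (a ^+ 2 * M).
    apply: ell2_scale cM; first exact: sqr_ge0.
    by move=> i; rewrite !sqmodM sqmod_ch1 mul1r sqmod_real.
  have [g lg hg] := hi _ _ c1M.
  exists (g \o psi); first exact: luV.
  move=> i; have := fE KA (g \o psi) i (L2on_sub AKA (luV _ lg)).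
  rewrite (_ : (g \o psi) \o phi = g); last by apply/funext => t /=; rewrite K.
  rewrite hg => /mulfI ->//; rewrite mulf_neq0 //.
    by apply/eqP => h0; have := sqmod_ch1 (gam (L' (lam i))); rewrite h0 sqmod0 => /eqP; rewrite eq_sym oner_eq0.
  by apply/eqP => /(congr1 (@complex.Re R)) /= /eqP; rewrite (negbTE a1).
Qed.
End Transport.

(** * Gluing two frequency sets *)

Section Combine.
Context {R : realType} {d K : nat}.
Local Notation T := (d.+1.-tuple R).
Implicit Types (f g : T -> R[i]) (t l : T).

Definition tvec (s : R) : T := tcons (s, [tuple 0 | _ < d]).
Definition tsh (s : R) t : T := tadd t (tvec s).

Lemma tsh_tcons s x y : tsh s (tcons (x, y)) = tcons (x + s, y).
Proof.
apply: eq_from_tnth => i; case: (unliftP ord0 i) => [j ->|->].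
  by rewrite tnth_mktuple !tnthS tnth_mktuple addr0.
by rewrite tnth_mktuple !tnth0.
Qed.

Lemma tshD s r t : tsh s (tsh r t) = tsh (r + s) t.
Proof. by have [x [y ->]] := tconsP t; rewrite !tsh_tcons addrA. Qed.

Lemma tsh0 t : tsh 0 t = t.
Proof. by have [x [y ->]] := tconsP t; rewrite tsh_tcons addr0. Qed.

Lemma dott_tsh l s t : dott l (tsh s t) = dott l t + thead l * s.
Proof.
have [x [y ->]] := tconsP t; have [a [m ->]] := tconsP l.
rewrite tsh_tcons !(dott_tcons a) theadE /=; ring.
Qed.

Lemma cov_tsh s : exists psi, @cov R _ (tsh s) psi 1.
Proof. by exists (fun t => tadd t [tuple - tnth (tvec s) i | i < d.+1]); exact: cov_tadd. Qed.

Lemma L2mu_tsh s f : L2mu (tmu d.+1) f -> L2mu (tmu d.+1) (f \o tsh s).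
Proof.
by move=> lf; have [psi cv] := cov_tsh s; have [] := cov_L2on (A := setT) cv (conj lf (fun t n => False_ind _ (n I))).
Qed.

Lemma nr_tsh s f : mfunc f -> nr (f \o tsh s) = nr f.
Proof. by move=> mf; have [psi cv] := cov_tsh s; rewrite (cov_nr cv mf) mul1r. Qed.

Lemma ft_tsh f l : L2on (box K) f -> ft (f \o tsh (-1)) l = conjc (ch1 (thead l)) * ft f l.
Proof.
move=> lf; have [psi cv] := cov_tsh (-1).
rewrite (cov_ft (l := l) (l' := l) (r := - thead l) cv lf) ?mulr1 ?ch1N // => t.
by rewrite dott_tsh mulrN1.
Qed.

Variables A A' : set T.
Hypotheses (mA : measurable A) (mA' : measurable A') (AK : A `<=` box K).
Hypotheses (sub : A' `<=` A) (sub1 : forall t, A' t -> A (tsh 1 t)).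
(** In the application a fibre of [A'] is an interval and the fibre of [A] extends it upwards by 1.
    If the column below [t] meets [A] at all, it passes through [A'] one step below [t]. *)
Hypothesis down : forall t (k : nat), A' t -> A (tsh (- k.+1%:R) t) -> A' (tsh (-1) t).

Let D : set T := A `&` ~` A'.
(** The box has height [2 K], so [N] steps downwards leave it and the column sum is complete. *)
Let N := K.*2.+1.

(* The [g] of the decomposition [f = f1 + (g - g(. - e_0))] with [f1] zero on [A']. *)
Definition colsum f : T -> R[i] := rs A' (fun t => \sum_(k < N) f (tsh (- k%:R) t)).

Lemma L2on_colsum f : L2on A f -> L2on A' (colsum f).
Proof.
move=> lf; have h n : L2mu (tmu d.+1) (fun t => \sum_(k < n) f (tsh (- k%:R) t)).
  elim: n => [|n IH]; first by under eq_fun do rewrite big_ord0; exact: L2mu0.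
  by under eq_fun do rewrite big_ord_recr /=; apply: L2muD => //; exact: L2mu_tsh lf.1.
have := @L2on_rs R _ A' setT _ mA' (conj (h N) (fun t n => False_ind _ (n I))).
by rewrite setIT.
Qed.

Lemma L2on_tsh g : L2on A' g -> L2on A (g \o tsh (-1)).
Proof.
move=> [lg g0]; split; first exact: L2mu_tsh.
move=> t nA; apply: g0 => /sub1; rewrite tshD.
by rewrite (_ : -1 + 1 = 0) ?tsh0 // addrC subrr.
Qed.

Lemma far_out t : A' t -> ~ A (tsh (- N%:R) t).
Proof.
move=> /sub/AK h1 /AK; have [x [y tE]] := tconsP t; move: h1; rewrite tE tsh_tcons.
move=> /box_tcons[/andP[h1 h2] _] /box_tcons[/andP[h3 h4] _]; move: h3.
rewrite /N -natr1 -addnn natrD; lra.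
Qed.

(** At a point [t] of [A'] the column sums at [t] and at [t - e_0] differ by [f t] when [t - e_0] is
    in [A']. Otherwise [down] kills every term of the sum at [t] but the first, which is [f t]. *)
Lemma colsum_split f : L2on A f ->
  L2on D (fun t => f t - colsum f t + colsum f (tsh (-1) t)).
Proof.
move=> lf; have lg := L2on_colsum lf; have lg1 := L2on_tsh lg.
have [lF F0] := L2onD (L2onB lf (L2on_sub sub lg)) lg1.
split=> // t nD; case: (pselect (A t)) => At; last exact: F0.
have A't : A' t by apply: contrapT => nA'; exact: nD.
have step (k : nat) : tsh (- k%:R) (tsh (-1) t) = tsh (- k.+1%:R) t.
  by rewrite tshD -natr1 opprD addrC.
rewrite /colsum /rs (asboolT A't).
have fz (k : nat) : ~ A' (tsh (-1) t) -> f (tsh (- k.+1%:R) t) = 0.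
  by move=> n; apply: lf.2 => /(down A't).
have s0 : tsh (- 0%:R) t = t by rewrite oppr0 tsh0.
case: asboolP => h.
  under [X in _ + X]eq_bigr do rewrite step.
  rewrite /N big_ord_recl big_ord_recr /= s0.
  have -> : f (tsh (- (K.*2.+1)%:R) t) = 0 by apply: lf.2; exact: far_out.
  by rewrite addr0 opprD addrA subrr add0r addNr.
rewrite addr0 /N big_ord_recl /= s0 big1 ?addr0 ?subrr // => k _.
by rewrite fz.
Qed.

End Combine.

Lemma sum_split {V : zmodType} (I1 I2 : eqType) (s : seq (I1 + I2)) (F : I1 + I2 -> V) : uniq s ->
  exists s1 s2, [/\ uniq s1, uniq s2 &
    \sum_(i <- s) F i = \sum_(i <- s1) F (inl i) + \sum_(i <- s2) F (inr i)].
Proof.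
elim: s => [|x s IH] /=; first by move=> _; exists [::], [::]; rewrite !big_nil addr0.
move=> us.
exists (pmap (fun x => if x is inl i then Some i else None) (x :: s)).
exists (pmap (fun x => if x is inr i then Some i else None) (x :: s)); split.
- by apply: (@pmap_uniq _ _ _ inl _ (x :: s) us) => -[].
- by apply: (@pmap_uniq _ _ _ inr _ (x :: s) us) => -[].
rewrite !big_pmap -big_split /=; apply: eq_bigr => -[i|i] _ /=; rewrite ?addr0 ?add0r //.
Qed.

Lemma ell2_sum_type {R : realType} (I1 I2 : choiceType) (c : I1 + I2 -> R[i]) (M1 M2 : R) :
  ell2 (fun i => c (inl i)) M1 -> ell2 (fun i => c (inr i)) M2 -> ell2 c (M1 + M2).
Proof.
move=> h1 h2 s us; have [s1 [s2 [u1 u2 ->]]] := sum_split (fun i => sqmod (c i)) us.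
by rewrite lerD ?h1 ?h2.
Qed.

Lemma ell2_inj {R : realType} (I J : choiceType) (h : J -> I) (c : I -> R[i]) (M : R) :
  injective h -> ell2 c M -> ell2 (c \o h) M.
Proof.
move=> hi cM s us; have := cM (map h s); rewrite big_map; apply.
by rewrite map_inj_uniq.
Qed.

Lemma ell2D {R : realType} (I : choiceType) (c c' : I -> R[i]) (M M' : R) :
  ell2 c M -> ell2 c' M' -> ell2 (fun i => c i - c' i) (2 * M + 2 * M').
Proof.
move=> h h' s us; apply: (@le_trans _ _ (\sum_(i <- s) (2 * sqmod (c i) + 2 * sqmod (c' i)))).
  by apply: ler_sum => i _; have := sqmodD (c i) (- c' i); rewrite sqmodN.
by rewrite big_split /= -!mulr_sumr lerD // ler_wpM2l // ?h ?h'.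
Qed.

Section CombineTheorem.
Context {R : realType} {d K : nat}.
Local Notation T := (d.+1.-tuple R).
Variables A A' : set T.
Hypotheses (mA : measurable A) (mA' : measurable A') (AK : A `<=` box K).
Hypotheses (sub : A' `<=` A) (sub1 : forall t, A' t -> A (tsh 1 t)).
Hypothesis down : forall t (k : nat), A' t -> A (tsh (- k.+1%:R) t) -> A' (tsh (-1) t).
Variables (I1 I2 : choiceType) (lam1 : I1 -> T) (lam2 : I2 -> T).
Variables (u1 : I1 -> T -> R[i]) (u2 : I2 -> T -> R[i]) (kappa : R).
Hypothesis int1 : forall i, ch1 (thead (lam1 i)) = 1.
Hypotheses (k0 : 0 < kappa) (sep2 : forall i, kappa <= sqmod (1 - conjc (ch1 (thead (lam2 i))))).
Hypotheses (rb1 : rb (A `&` ~` A') lam1 u1) (rb2 : rb A' lam2 u2).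

Theorem rb_combine : rb A (fun i => match i with inl i => lam1 i | inr i => lam2 i end)
  (fun i => match i with inl i => u1 i | inr i => u2 i end).
Proof.
pose D := A `&` ~` A'.
have mD : measurable D by apply: measurableI => //; exact: measurableC.
have DA : D `<=` A by move=> t [].
have [hu1 ho1 hc1 hb1 [B1 B10 hl1] hi1] : rb D lam1 u1 by exact: rb1.
have [hu2 ho2 hc2 hb2 [B2 B20 hl2] hi2] := rb2.
have ftS f1 g l : L2on D f1 -> L2on A' g ->
    ft (fun t => f1 t + (g t - g (tsh (-1) t))) l = ft f1 l + (1 - conjc (ch1 (thead l))) * ft g l.
  move=> lf lg; have l1 := L2on_sub AK (L2on_sub DA lf); have l2 := L2on_sub AK (L2on_sub sub lg).
  have l3 : L2on (box K) (g \o tsh (-1)) by apply: L2on_sub AK _; exact: (L2on_tsh sub1 lg).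
  rewrite (ftD l l1 (L2onB l2 l3)) (ftB l l2 l3) (ft_tsh l l2); ring.
have nz j : 1 - conjc (ch1 (thead (lam2 j))) != 0.
  by apply/eqP => h; have := sep2 j; rewrite h sqmod0 leNgt k0.
have ortho f g : (forall t, ~ D t -> f t = 0) -> (forall t, ~ A' t -> g t = 0) -> pr f g = 0.
  move=> f0 g0; rewrite /pr /L2ip (_ : (fun t => _) = fun=> 0); last first.
    apply/funext => t; case: (pselect (A' t)) => h; last by rewrite g0 // conjc0 mulr0.
    by rewrite f0 ?mul0r // => -[].
  exact: cint0.
have ortho' f g : (forall t, ~ D t -> f t = 0) -> (forall t, ~ A' t -> g t = 0) -> pr g f = 0.
  move=> f0 g0; rewrite /pr /L2ip (_ : (fun t => _) = fun=> 0); last first.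
    apply/funext => t; case: (pselect (A' t)) => h; last by rewrite g0 // mul0r.
    by rewrite f0 ?conjc0 ?mulr0 // => -[].
  exact: cint0.
split.
- by case=> i; [exact: L2on_sub DA (hu1 i) | exact: L2on_sub sub (hu2 i)].
- move=> [i|i] [j|j].
  + exact: ho1.
  + by rewrite ortho //; [exact: (hu1 i).2|exact: (hu2 j).2].
  + by rewrite ortho' //; [exact: (hu1 j).2|exact: (hu2 i).2].
  + exact: ho2.
- move=> f lf f0.
  have lD : L2on D (rs D f).
    by apply: (L2on_sub _ (L2on_rs mD lf)) => t [].
  have lA' : L2on A' (rs A' f).
    by apply: (L2on_sub _ (L2on_rs mA' lf)) => t [].
  have prr (B : set T) (g : T -> R[i]) : (forall t, ~ B t -> g t = 0) -> pr (rs B f) g = pr f g.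
    move=> g0; apply: eq_cint => t; rewrite /rs; case: asboolP => // h.
    by rewrite g0 // conjc0 !mulr0.
  have z1 : nr (rs D f) = 0.
    by apply: hc1 => // i; rewrite prr; [exact: (f0 (inl i)) | exact: (hu1 i).2].
  have z2 : nr (rs A' f) = 0.
    by apply: hc2 => // i; rewrite prr; [exact: (f0 (inr i)) | exact: (hu2 i).2].
  have := nrD lD.1 lA'.1; rewrite z1 z2 !mulr0 addr0.
  rewrite (_ : (fun t => _) = f) => [h|]; first by apply/eqP; rewrite eq_le h nr_ge0.
  apply/funext => t; rewrite /rs; case: asboolP => h1; case: asboolP => h2; rewrite ?addr0 ?add0r //.
    by case: h1 => _ /(_ h2).
  by rewrite lf.2 // => At; apply: h1.
- move=> L; have [C1 C10 hC1] := hb1 L; have [C2 C20 hC2] := hb2 L.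
  exists (C1 + C2); first exact: addr_ge0.
  by move=> f lf; rewrite mulrDl; apply: ell2_sum_type; [exact: hC1|exact: hC2].
- have [C2 C20 hC2] := hb2 K.
  (* The integer frequencies bound [nr f1] by [B1 * M]. Removing [f1] leaves coefficients with sum
     at most [2 M + 2 C2 B1 M], divided by [kappa] to reach those of [g]. Finally [nr] of
     [g - g(. - e_0)] is at most [4 * nr g], and the outer sum doubles it. *)
  pose B := 2 * B1 + 8 * (B2 * ((2 + 2 * (C2 * B1)) / kappa)).
  have B3 : 0 <= (2 + 2 * (C2 * B1)) / kappa.
    by rewrite divr_ge0 ?ltW // ltr_wpDr // !mulr_ge0.
  exists B; first by apply: addr_ge0; [exact: mulr_ge0 | apply: mulr_ge0 => //; exact: mulr_ge0].
  move=> f M lf fM.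
  have M1 : ell2 (fun i => ft f (lam1 i)) M by exact: (ell2_inj (h := inl) (@inl_inj _ _) fM).
  have M2 : ell2 (fun i => ft f (lam2 i)) M by exact: (ell2_inj (h := inr) (@inr_inj _ _) fM).
  pose g := colsum (K := K) A' f; have lg : L2on A' g by exact: (L2on_colsum mA' lf).
  have lg1 : L2on A (g \o tsh (-1)) by exact: (L2on_tsh sub1 lg).
  pose f1 t := f t - g t + g (tsh (-1) t).
  have lf1 : L2on D f1 by exact: (colsum_split mA' AK sub sub1 down lf).
  have fE : f = fun t => f1 t + (g t - g (tsh (-1) t)) by apply/funext => t; rewrite /f1; ring.
  have h1 : nr f1 <= B1 * M.
    apply: hl1 => // s us; apply: le_trans (M1 s us); apply: ler_sum => i _.
    by rewrite fE (ftS _ _ _ lf1 lg) int1 conjc1 subrr mul0r addr0.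
  have h2 : ell2 (fun i => ft g (lam2 i)) ((2 * M + 2 * (C2 * nr f1)) / kappa).
    move=> s us; rewrite ler_pdivlMr // mulr_suml.
    have := ell2D M2 (hC2 f1 (L2on_sub AK (L2on_sub DA lf1))) us; apply: le_trans.
    apply: ler_sum => i _; rewrite {1}fE (ftS _ _ _ lf1 lg) addrAC subrr add0r sqmodM mulrC.
    by rewrite ler_wpM2r ?sqmod_ge0.
  have h3 : nr g <= B2 * ((2 + 2 * (C2 * B1)) / kappa * M).
    apply: le_trans (hl2 _ _ lg h2) _; apply: ler_wpM2l => //.
    rewrite [leRHS]mulrAC ler_wpM2r ?invr_ge0 ?(ltW k0) //.
    by have := ler_wpM2l C20 h1; lra.
  have h4 : nr f <= 2 * nr f1 + 2 * nr (fun t => g t - g (tsh (-1) t)).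
    by rewrite {1}fE; apply: nrD; [exact: lf1.1|exact: L2muB lg.1 lg1.1].
  have h5 : nr (fun t => g t - g (tsh (-1) t)) <= 2 * nr g + 2 * nr g.
    have := nrD lg.1 (L2muZ (-1) lg1.1).
    have -> : nr (fun t => -1 * (g \o tsh (-1)) t) = nr g.
      under eq_fun do rewrite mulN1r; rewrite nrN nr_tsh //; exact: lg.1.1.
    by under eq_fun do rewrite mulN1r.
  have -> : B * M = 2 * (B1 * M) + 8 * (B2 * ((2 + 2 * (C2 * B1)) / kappa * M)) by rewrite /B; ring.
  lra.
- move=> c M cM; have [C2 C20 hC2] := hb2 K.
  have [f1 lf1 hf1] := hi1 _ _ (ell2_inj (h := inl) (@inl_inj _ _) cM).
  have M2 := ell2D (ell2_inj (h := inr) (@inr_inj _ _) cM) (hC2 f1 (L2on_sub AK (L2on_sub DA lf1))).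
  (* Back substitution: the values still to be reached once [f1] is fixed, divided by the factor
     that the difference [g - g(. - e_0)] produces. *)
  pose c2 j := (c (inr j) - ft f1 (lam2 j)) / (1 - conjc (ch1 (thead (lam2 j)))).
  have c2M : ell2 c2 ((2 * M + 2 * (C2 * nr f1)) / kappa).
    move=> s us; rewrite ler_pdivlMr // mulr_suml; have := M2 s us; apply: le_trans.
    apply: ler_sum => j _ /=.
    have -> : c (inr j) - ft f1 (lam2 j) = c2 j * (1 - conjc (ch1 (thead (lam2 j)))).
      by rewrite /c2 divfK.
    by rewrite sqmodM ler_wpM2l ?sqmod_ge0.
  have [g lg hg] := hi2 _ _ c2M.
  have lg1 : L2on A (g \o tsh (-1)) by exact: (L2on_tsh sub1 lg).
  exists (fun t => f1 t + (g t - g (tsh (-1) t))).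
    by apply: L2onD (L2on_sub DA lf1) _; apply: L2onB lg1; exact: L2on_sub sub lg.
  move=> [i|j]; rewrite ftS //.
    by rewrite int1 conjc1 subrr mul0r addr0 hf1.
  by rewrite hg /c2 mulrC divfK // addrC subrK.
Qed.

End CombineTheorem.

(** * Closed and compact sets of row vectors as sets of tuples *)

Section TupleTopology.
Context {R : realType}.
Local Notation row := row_of_tuple.

Definition tuple_of_row {d} (x : 'rV[R]_d) : d.-tuple R := [tuple x ord0 i | i < d].

Lemma row_tupleK d : cancel (@row_of_tuple R d) tuple_of_row.
Proof. by move=> t; apply: eq_from_tnth => i; rewrite tnth_mktuple mxE. Qed.
Lemma tuple_rowK d : cancel tuple_of_row (@row_of_tuple R d).
Proof. by move=> x; apply/rowP => i; rewrite mxE tnth_mktuple. Qed.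

(** The topology lives on row vectors and the sigma-algebra on tuples. The link is that an open set
    is a countable union of half-open cubes with rational centres and sides [2 / n.+1]. *)
Lemma measurable_closed d (C : set 'rV[R]_d) : closed C -> measurable [set t | C (row t)].
Proof.
move=> cC; rewrite -[X in measurable X]setCK; apply: measurableC.
have oU : open (~` C) by exact: closed_openC.
pose bx (p : d.-tuple rat * nat) : set (d.-tuple R) :=
  [set t | forall i, ratr (tnth p.1 i) - p.2.+1%:R^-1 < tnth t i <= ratr (tnth p.1 i) + p.2.+1%:R^-1].
have mbx p : measurable (bx p).
  rewrite (_ : bx p = \bigcap_(i in [set: 'I_d]) ((fun t => tnth t i) @^-1`
    [set` `](ratr (tnth p.1 i) - p.2.+1%:R^-1), (ratr (tnth p.1 i) + p.2.+1%:R^-1)]])); last first.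
    apply/seteqP; split=> t h i => [_|]; first by rewrite /= in_itv /=; exact: h.
    by have := h i I; rewrite /= in_itv.
  apply: fin_bigcap_measurable => // i _.
  by rewrite -[X in measurable X]setTI; apply: measurable_tnth.
pose F p : set (d.-tuple R) := if `[< bx p `<=` [set t | ~ C (row t)] >] then bx p else set0.
rewrite (_ : ~` _ = \bigcup_p F p).
  apply: countable_bigcupT_measurable => [|p]; first exact: countableP.
  by rewrite /F; case: ifP.
apply/seteqP; split=> [t|t [p _]]; last by rewrite /F; case: asboolP => // h /h.
move=> nC; have : nbhs (row t) (~` C) by apply: open_nbhs_nbhs.
move=> /nbhs_ballP[e /= e0 he].
have [n hn] : exists n : nat, 2 * n.+1%:R^-1 < e.
  exists (Num.Def.archi_bound (2 / e)).
  have := archi_boundP (ltW (divr_gt0 (ltr0n _ 2) e0)).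
  rewrite ltr_pdivrMr // => h; rewrite ltr_pdivrMr // mulrC.
  by apply: lt_trans h _; rewrite ltr_pM2r // ltr_nat.
have n0 : (0 : R) < n.+1%:R^-1 by rewrite invr_gt0.
have [r rE] : exists r : R, r = n.+1%:R^-1 by eexists.
rewrite -rE in hn n0.
have hq (i : 'I_d) : exists q : rat, `|ratr q - tnth t i| < r.
  have [|q] := @rat_in_itvoo R (tnth t i - r) (tnth t i + r); first lra.
  by rewrite in_itv /= => /andP[h1 h2]; exists q; rewrite ltr_norml; apply/andP; split; lra.
pose q := [tuple sval (cid (hq i)) | i < d].
have hq' i : `|ratr (tnth q i) - tnth t i| < r by rewrite tnth_mktuple; case: (cid _).
exists (q, n) => //; rewrite /F asboolT => [i|s hs].
  by have := hq' i; rewrite ltr_norml /= -rE => /andP[h1 h2]; apply/andP; split; lra.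
apply: he; split=> // k i; rewrite !mxE -ball_normE /ball_ /=.
have := hq' i; have := hs i; rewrite /= -rE ltr_norml => /andP[h1 h2] /andP[h3 h4].
by rewrite ltr_norml; apply/andP; split; lra.
Qed.

Lemma coord_le_norm d (x : 'rV[R]_d) i : `|x ord0 i| <= `|x|.
Proof.
rewrite [leRHS]mx_normrE.
by apply: (@le_bigmax_cond _ _ _ 0 (ord0, i) xpredT (fun ij => `|x ij.1 ij.2|)).
Qed.

Lemma compact_box d (C : set 'rV[R]_d) : compact C -> exists K, [set t | C (row t)] `<=` box K.
Proof.
move=> /compact_bounded[M [_ hM]].
have hM1 : M < `|M| + 1 by have := ler_norm M; lra.
have := archi_boundP (addr_ge0 (normr_ge0 M) ler01); set K := Num.Def.archi_bound _ => hK.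
exists K => t Ct i; have := hM _ hM1 _ Ct; rewrite /= => h.
have := le_trans (coord_le_norm (row t) i) h; rewrite mxE ler_norml => /andP[h1 h2].
by apply/andP; split; lra.
Qed.

End TupleTopology.

(** * Base cases and inductive step for sets of tuples *)

Definition riesz_set {R : realType} d (A : set (d.-tuple R)) : Prop :=
  exists (I : choiceType) (lam : I -> d.-tuple R) u, rb A lam u.

Section BaseCases.
Context {R : realType}.

Lemma riesz_set_null d (A : set (d.-tuple R)) : (forall f, L2on A f -> nr f = 0) -> riesz_set A.
Proof.
move=> h; exists void, (fun i : void => match i with end), (fun i : void => match i with end); split.
- by case.
- by case.
- by move=> f lf _; exact: h.
- by move=> K; exists 0 => // f lf [|[]//] _; rewrite big_nil mul0r.
- by exists 0 => // f M lf _; rewrite h // mul0r.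
- move=> c M _; exists (fun=> 0); last by case.
  by split=> //; exact: L2mu0.
Qed.

Lemma thead0_null d (A : set (d.+1.-tuple R)) f : (forall t, A t -> thead t = 0) ->
  L2on A f -> nr f = 0.
Proof.
move=> h lf; apply: EFin_inj; rewrite -(nrE lf.1) slice_int; last exact: lf.1.
transitivity (\int[tmu d]_y (cst 0%E y : \bar R))%E; last by rewrite integral0.
apply: eq_integral => y _.
transitivity (\int[@lebesgue_measure R]_x (cst 0%E x : \bar R))%E; last by rewrite integral0.
apply: ae_eq_integral => //; first exact: mfunc_Esqmod (mfunc_slice y lf.1.1).
exists [set 0]; split; first exact: measurable_set1.
  exact: lebesgue_measure_set1.
move=> x /= nx; apply: contrapT => x0; apply: nx => _.
rewrite /slice lf.2 ?sqmod0 // => /h; rewrite theadE; exact: x0.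
Qed.

Lemma measurable_dim0 dd (T : measurableType dd) (f : 0.-tuple R -> T) : measurable_fun setT f.
Proof.
move=> _ Y mY; rewrite setTI; case: (pselect (Y (f [tuple]))) => h.
  rewrite (_ : _ @^-1` _ = setT) //; apply/seteqP; split=> // t _.
  by rewrite (tuple0 t).
rewrite (_ : _ @^-1` _ = set0) //; apply/seteqP; split=> // t.
by rewrite /= (tuple0 t).
Qed.

Lemma integral_dim0 (g : 0.-tuple R -> \bar R) : (\int[tmu 0]_t g t = g [tuple])%E.
Proof.
rewrite integralE -!iintE //=; try exact: measurable_dim0.
by have /(congr1 (fun h => h [tuple])) := funeposneg g.
Qed.

Lemma pr_dim0 (f g : 0.-tuple R -> R[i]) : pr f g = f [tuple] * conjc (g [tuple]).
Proof. by rewrite /pr /L2ip /cint /Rintegral !integral_dim0 /=; case: (_ * _). Qed.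

Lemma nr_dim0 (f : 0.-tuple R -> R[i]) : nr f = sqmod (f [tuple]).
Proof. by rewrite /nr integral_dim0. Qed.

Lemma L2on_dim0 (f : 0.-tuple R -> R[i]) : L2on setT f.
Proof.
split; last by move=> t n; case: n.
split; first by split; exact: measurable_dim0.
by rewrite integral_dim0 ltry.
Qed.

Lemma riesz_set_dim0 : riesz_set [set: 0.-tuple R].
Proof.
have ch0 l : ch l ([tuple] : 0.-tuple R) = 1 by rewrite /ch /dott big_ord0 ch10.
have ftE (f : 0.-tuple R -> R[i]) l : ft f l = f [tuple] by rewrite /ft pr_dim0 ch0 conjc1 mulr1.
exists unit, (fun=> [tuple]), (fun _ _ => 1); split.
- by move=> i; exact: L2on_dim0.
- by move=> [] []; rewrite pr_dim0 conjc1 mulr1.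
- by move=> f _ /(_ tt); rewrite pr_dim0 conjc1 mulr1 nr_dim0 => ->; rewrite sqmod0.
- move=> K; exists 1 => // f _ s us; rewrite mul1r nr_dim0.
  case: s us => [_|[] [|[] s]] //=; first by rewrite big_nil sqmod_ge0.
  by rewrite big_seq1 ftE.
- exists 1 => // f M _ h; rewrite mul1r nr_dim0; have := h [:: tt] isT.
  by rewrite big_seq1 ftE.
- move=> c M _; exists (fun=> c tt); first exact: L2on_dim0.
  by move=> []; rewrite ftE.
Qed.

End BaseCases.

Section Step.
Context {R : realType} {d K : nat}.
Local Notation T := (d.+1.-tuple R).
Variable A' : set T.
Let A : set T := [set t | exists s : R, 0 <= s <= 1 /\ A' (tsh (- s) t)].
Let B : set (d.-tuple R) := [set y | exists x : R, A' (tcons (x, y))].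
Hypotheses (mA : measurable A) (mA' : measurable A') (AK : A `<=` box K).
Hypothesis cvx : forall t (a b c : R), a <= b <= c -> A' (tsh a t) -> A' (tsh c t) -> A' (tsh b t).
Hypothesis top : forall y, B y -> exists2 m : R, A' (tcons (m, y)) &
  forall x, A' (tcons (x, y)) -> x <= m.

(** With [beta y] the upper end of the fibre of [A'] over [y], the fibre of [A] ends at
    [beta y + 1]. So [A] minus [A'] is a cylinder over [B] with half-open unit fibres, and
    [rb_combine] glues it to [A'] once the frequencies of [A'] have been perturbed. *)
Theorem riesz_set_step : riesz_set A' -> riesz_set B -> riesz_set A.
Proof.
move=> [I2 [lam2 [u2 rb2]]] [I1 [lam1 [u1 rb1]]].
have sub : A' `<=` A by move=> t h; exists 0; rewrite oppr0 tsh0 lexx ler01.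
have beta_ex y : exists m : R, B y -> A' (tcons (m, y)) /\ forall x, A' (tcons (x, y)) -> x <= m.
  case: (pselect (B y)) => [/top[m h1 h2]|n]; last by exists 0.
  by exists m.
pose beta y := sval (cid (beta_ex y)).
have bP y : B y -> A' (tcons (beta y, y)) /\ forall x, A' (tcons (x, y)) -> x <= beta y.
  exact: (svalP (cid (beta_ex y))).
have cvx1 (x y z : R) w : x <= y <= z -> A' (tcons (x, w)) -> A' (tcons (z, w)) -> A' (tcons (y, w)).
  have e (r : R) : tcons (r, w) = tsh r (tcons (0, w)) by rewrite tsh_tcons add0r.
  by move=> xyz; rewrite (e x) (e y) (e z); exact: cvx.
have hT x y : (A `&` ~` A') (tcons (x, y)) <-> B y /\ beta y < x <= beta y + 1.
  split=> [[[s [/andP[s0 s1]]]]|[By /andP[h1 h2]]].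
    rewrite tsh_tcons => A's nA'; have By : B y by exists (x - s).
    have [b1 b2] := bP _ By; have := b2 _ A's => xb; split=> //; apply/andP; split; last lra.
    rewrite ltNge; apply/negP => xb'; apply: nA'; apply: cvx1 A's b1.
    by apply/andP; split; lra.
  have [b1 b2] := bP _ By; split; last by move=> /b2; lra.
  exists (x - beta y); split; first by apply/andP; split; lra.
  by rewrite tsh_tcons (_ : x - (x - beta y) = beta y) //; ring.
have mT : measurable (A `&` ~` A') by apply: measurableI => //; exact: measurableC.
have rbT := rb_cylinder mT (subset_trans (@subIsetl _ _ _) AK) hT rb1.
have [kappa k0 [lam2' rb2' sep]] := rb_perturb mA' (subset_trans sub AK) rb2.
have sub1 t : A' t -> A (tsh 1 t).
  by move=> A't; exists 1; rewrite tshD subrr tsh0 ler01 lexx.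
have down t (k : nat) : A' t -> A (tsh (- k.+1%:R) t) -> A' (tsh (-1) t).
  move=> A't [s [/andP[s0 s1]]]; rewrite tshD => h.
  have k0' := ler0n R k; apply: (cvx (a := - k.+1%:R - s) (c := 0)) => //; last by rewrite tsh0.
  by rewrite -natr1; apply/andP; split; lra.
have int1 (p : nat * I1) : ch1 (thead (tcons ((nu p.1)%:~R, lam1 p.2))) = 1.
  by rewrite theadE ch1_int.
exact: (ex_intro _ _ (ex_intro _ _ (ex_intro _ _ (rb_combine mA mA' AK sub sub1 down int1 k0 sep rbT rb2')))).
Qed.

End Step.

Section ConvexSets.
Context {R : realType} {d : nat}.
Implicit Types (C : set 'rV[R]_d) (x v : 'rV[R]_d).

Definition convex C := forall x y (s : R), 0 <= s <= 1 -> C x -> C y -> C (s *: x + (1 - s) *: y).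

Lemma convex_line C x v (s t r : R) : convex C -> s <= t <= r ->
  C (x + s *: v) -> C (x + r *: v) -> C (x + t *: v).
Proof.
move=> cC /andP[st tr] hs hr; case: (eqVneq s r) => [sr|sr].
  by have -> : t = s by apply/eqP; rewrite eq_le {1}sr tr st.
have rs0 : 0 < r - s by rewrite subr_gt0 lt_def eq_sym sr (le_trans st tr).
have := cC _ _ ((r - t) / (r - s)) _ hs hr.
have -> : (r - t) / (r - s) *: (x + s *: v) + (1 - (r - t) / (r - s)) *: (x + r *: v) = x + t *: v.
  by apply/rowP => i; rewrite !mxE; field; rewrite gt_eqF.
apply; apply/andP; split; first by rewrite divr_ge0 // subr_ge0 // (le_trans st tr).
by rewrite ler_pdivrMr // mul1r lerB.
Qed.

End ConvexSets.

(** * Zonotopes *)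

Section Zonotope.
Context {R : realType}.

(** The Minkowski sum of the segments [[0, 1] v]. Membership is recursive because the induction
    removes one generator at a time. *)
Fixpoint zono {d} (vs : seq 'rV[R]_d) : set 'rV[R]_d :=
  if vs is v :: vs' then [set x | exists s : R, 0 <= s <= 1 /\ zono vs' (x - s *: v)]
  else [set 0].

Section Basics.
Variable d : nat.
Implicit Types (vs ws : seq 'rV[R]_d) (x y v w : 'rV[R]_d).

Lemma zono0 vs : zono vs 0.
Proof.
elim: vs => [|v vs IH] //=; exists 0; rewrite lexx ler01; split=> //.
by rewrite scale0r subr0.
Qed.

Lemma zono_swap v w vs x : zono [:: v, w & vs] x -> zono [:: w, v & vs] x.
Proof.
move=> /= [s [s01 [r [r01 h]]]]; exists r; split=> //; exists s; split=> //.
by rewrite addrAC.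
Qed.

Lemma zono_cons v vs ws : (forall x, zono vs x -> zono ws x) ->
  forall x, zono (v :: vs) x -> zono (v :: ws) x.
Proof. by move=> h x [s [s01 hs]]; exists s; split=> //; exact: h. Qed.

Lemma zono_rot v vs ws : zono (vs ++ v :: ws) = zono (v :: vs ++ ws).
Proof.
apply/seteqP; elim: vs => [|w vs [IH1 IH2]]; first by split.
split=> x h.
  by apply: zono_swap; exact: zono_cons IH1 _ h.
by apply: zono_cons IH2 _ (zono_swap h).
Qed.

Lemma zono_convex vs : convex (zono vs).
Proof.
move=> x y s /andP[s0 s1]; elim: vs x y => [|v vs IH] x y /=.
  by move=> -> ->; rewrite !scaler0 addr0.
move=> [p [/andP[p0 p1] hp]] [q [/andP[q0 q1] hq]].
exists (s * p + (1 - s) * q); split; first by apply/andP; split; nra.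
have := IH _ _ hp hq; congr (zono _ _).
by apply/rowP => i; rewrite !mxE; ring.
Qed.

Lemma zono_compact vs : compact (zono vs).
Proof.
elim: vs => [|v vs IH]; first exact: compact_set1.
have -> : zono (v :: vs) = [set p.1 *: v + p.2 | p in [set` `[(0 : R), 1]] `*` zono vs].
  apply/seteqP; split=> [x [s [s01 h]]|x [[s y] [/= s01 h]] <-].
    by exists (s, x - s *: v); [split=> //=; rewrite in_itv | rewrite /= addrC subrK].
  by exists s; split; [move: s01; rewrite in_itv|rewrite addrC addKr].
apply: continuous_compact; last by apply: compact_setX => //; exact: segment_compact.
apply: continuous_subspaceT => p; apply: cvgD; last exact: cvg_snd.
by apply: cvgZr_tmp; exact: cvg_fst.
Qed.

Lemma zono_coord vs x i : (forall v, v \in vs -> v ord0 i = 0) -> zono vs x -> x ord0 i = 0.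
Proof.
elim: vs x => [|v vs IH] x h /=; first by move=> ->; rewrite mxE.
move=> [s [_ /IH]]; rewrite !mxE (h v) ?mem_head // mulr0 subr0; apply => w wv.
by apply: h; rewrite inE wv orbT.
Qed.

End Basics.

Lemma zono_map d e (f : 'rV[R]_d -> 'rV[R]_e) vs y :
  (forall (a : R) u v, f (a *: u + v) = a *: f u + f v) ->
  zono (map f vs) y <-> exists2 x, zono vs x & f x = y.
Proof.
move=> lf; have f0 : f 0 = 0 by have := lf (-1) 0 0; rewrite scaler0 addr0 scaleN1r addNr.
elim: vs y => [|v vs IH] y /=.
  by split=> [->|[x -> <-]] //; exists 0.
split=> [[s [s01 /IH[x hx xE]]]|[x [s [s01 hs]] <-]].
  by exists (s *: v + x); [exists s; split=> //; rewrite addrC addKr|rewrite lf xE addrC subrK].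
exists s; split=> //; apply/IH; exists (x - s *: v) => //.
by rewrite addrC -scaleNr lf scaleNr addrC.
Qed.

Lemma lift0F d (j : 'I_d) : (lift ord0 j == ord0 :> 'I_d.+1) = false.
Proof. by rewrite eq_sym (negbTE (neq_lift _ _)). Qed.

Lemma row_tsh d (s : R) (t : d.+1.-tuple R) :
  row_of_tuple (tsh s t) = row_of_tuple t + s *: delta_mx ord0 ord0.
Proof.
have [x [y ->]] := tconsP t; rewrite tsh_tcons; apply/rowP => i; rewrite !mxE.
case: (unliftP ord0 i) => [j ->|->]; rewrite ?tnthS ?tnth0.
  by rewrite lift0F andbF mulr0 addr0.
by rewrite !eqxx mulr1.
Qed.

Definition rtail {d} (x : 'rV[R]_d.+1) : 'rV[R]_d := \row_j x ord0 (lift ord0 j).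

Lemma rtail_linear d (a : R) (u v : 'rV[R]_d.+1) : rtail (a *: u + v) = a *: rtail u + rtail v.
Proof. by apply/rowP => i; rewrite !mxE. Qed.

Lemma rtail_tcons d x (y : d.-tuple R) : rtail (row_of_tuple (tcons (x, y))) = row_of_tuple y.
Proof. by apply/rowP => i; rewrite !mxE tnthS. Qed.

Lemma zono_measurable d (vs : seq 'rV[R]_d) : measurable [set t | zono vs (row_of_tuple t)].
Proof.
apply: measurable_closed; apply: compact_closed; last exact: zono_compact.
exact: norm_hausdorff.
Qed.

Lemma riesz_zono_step d (ws : seq 'rV[R]_d.+1) :
  riesz_set [set t | zono ws (row_of_tuple t)] ->
  riesz_set [set t | zono (map rtail ws) (row_of_tuple t)] ->
  riesz_set [set t | zono (delta_mx ord0 ord0 :: ws) (row_of_tuple t)].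
Proof.
move=> h1 h2; have [K hK] := compact_box (@zono_compact _ (delta_mx ord0 ord0 :: ws)).
have E : [set t | zono (delta_mx ord0 ord0 :: ws) (row_of_tuple t)] =
    [set t | exists s : R, 0 <= s <= 1 /\ [set t | zono ws (row_of_tuple t)] (tsh (- s) t)].
  apply/seteqP; split=> t /= [s [s01 h]]; exists s; split=> //; move: h;
    by rewrite row_tsh scaleNr.
rewrite E; apply: (riesz_set_step (K := K)) => //.
- by rewrite -E; exact: zono_measurable.
- exact: zono_measurable.
- by rewrite -E.
- by move=> t a b c abc /=; rewrite !row_tsh; exact: (convex_line (@zono_convex _ ws) abc).
- move=> y [x0 hx0].
  (* The fibre over [y]; being compact, it has a highest point. *)
  pose C := zono ws `&` \bigcap_(j in [set: 'I_d]) ((fun z : 'rV[R]_d.+1 => z ord0 (lift ord0 j)) @^-1` [set tnth y j]).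
  have C0 : C (row_of_tuple (tcons (x0, y))).
    by split=> // j _; rewrite /= mxE tnthS.
  have cC : compact C.
    apply: compact_closedI; first exact: zono_compact.
    apply: closed_bigI => j _; apply: preimage_closed; last exact: closed_eq.
    by move=> z _; exact: coord_continuous.
  have [||c] := @compact_EVT_max _ R (fun z : 'rV[R]_d.+1 => z ord0 ord0) C _ cC.
  + by exists (row_of_tuple (tcons (x0, y))).
  + by apply: continuous_subspaceT => z; exact: coord_continuous.
  rewrite inE => -[hc1 hc2] hmax.
  have cE : c = row_of_tuple (tcons (c ord0 ord0, y)).
    apply/rowP => i; rewrite mxE; case: (unliftP ord0 i) => [j ->|->]; rewrite ?tnthS ?tnth0 //.
    exact: hc2.
  exists (c ord0 ord0); first by rewrite /= -cE.
  move=> x hx; have := hmax (row_of_tuple (tcons (x, y))); rewrite mxE tnth0; apply.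
  by rewrite inE; split=> // j _; rewrite /= mxE tnthS.
- rewrite (_ : [set y | _] = [set t | zono (map rtail ws) (row_of_tuple t)]) //.
  apply/seteqP; split=> y /=.
    move=> [x hx]; apply/(zono_map _ _ (@rtail_linear d)).
    by exists (row_of_tuple (tcons (x, y))) => //; exact: rtail_tcons.
  move=> /(zono_map _ _ (@rtail_linear d))[x hx xE]; exists (x ord0 ord0).
  rewrite (_ : row_of_tuple _ = x) //; apply/rowP => i; rewrite mxE.
  case: (unliftP ord0 i) => [j ->|->]; rewrite ?tnthS ?tnth0 //.
  by have /rowP/(_ j) := xE; rewrite !mxE.
Qed.

Section Shear.
Variables (d : nat) (v : 'rV[R]_d.+1).
Hypothesis v0 : v ord0 ord0 != 0.
Local Notation a := (v ord0 ord0).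
Let w : d.-tuple R := tuple_of_row (rtail v).
Let z : d.-tuple R := [tuple 0 | _ < d].
(* The inverse of [x |-> x + x_0 (v - e_0)], which maps [e_0] to [v]. *)
Let Psi (x : 'rV[R]_d.+1) := x - (x ord0 ord0 / a) *: (v - delta_mx ord0 ord0).

Let Psi_linear (b : R) x y : Psi (b *: x + y) = b *: Psi x + Psi y.
Proof. by apply/rowP => i; rewrite !mxE; field. Qed.

Let PsiK x y : Psi x = y <-> x = y + y ord0 ord0 *: (v - delta_mx ord0 ord0).
Proof.
split=> [<-|->]; apply/rowP => i; rewrite !mxE !eqxx /=; field; exact: v0.
Qed.

Let row_aff t : row_of_tuple (aff a 0 w z t) =
  row_of_tuple t + row_of_tuple t ord0 ord0 *: (v - delta_mx ord0 ord0).
Proof.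
have [x [y ->]] := tconsP t; rewrite aff_tcons; apply/rowP => i; rewrite !mxE tnth0.
case: (unliftP ord0 i) => [j ->|->]; rewrite ?tnthS ?tnth0 ?lift0F ?eqxx /=; last by ring.
by rewrite !tnth_mktuple !mxE subr0 addr0.
Qed.

Lemma riesz_set_shear vs : riesz_set [set t | zono (map Psi (v :: vs)) (row_of_tuple t)] ->
  riesz_set [set t | zono (v :: vs) (row_of_tuple t)].
Proof.
move=> [I [lam [u h]]].
pose A := [set t | zono (v :: vs) (row_of_tuple t)].
have AE : aff a 0 w z @^-1` A = [set t | zono (map Psi (v :: vs)) (row_of_tuple t)].
  apply/seteqP; split=> t; rewrite /A /preimage /=; rewrite row_aff.
    by move=> ht; apply/(zono_map (v :: vs) _ Psi_linear); eexists; [exact: ht|exact/PsiK].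
  by move=> /(zono_map (v :: vs) _ Psi_linear)[x hx /PsiK <-].
(* The map [aff] sends [e_0] to [(a, w)] and fixes the other unit vectors; [L] is its adjoint, and
   [L'] inverts [L] by solving for the first coordinate. *)
pose L (l : d.+1.-tuple R) : d.+1.-tuple R := tcons (dott l (tcons (a, w)), (tuncons l).2).
pose L' (m : d.+1.-tuple R) : d.+1.-tuple R :=
  tcons (((tuncons m).1 - dott (tuncons m).2 w) / a, (tuncons m).2).
rewrite -/A; have := cov_aff 0 w z v0 => cv.
exists I, (fun i => L' (lam i)); eexists.
apply: (rb_transport (gam := fun=> 0) (L := L) cv).
- move=> l t; have [x [y ->]] := tconsP t; have [b [m ->]] := tconsP l.
  rewrite aff_tcons /L tconsK !dott_tcons /= !addr0.
  have -> : dott m (tadd y (tlin w z x)) = dott m y + x * dott m w.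
    rewrite /dott mulr_sumr -big_split /=; apply: eq_bigr => j _.
    by rewrite !tnth_mktuple; ring.
  ring.
- move=> l; have [b [m ->]] := tconsP l; rewrite /L /L' !tconsK dott_tcons /=.
  by congr tcons; congr pair; rewrite /= divfK // subrK.
- move=> K; pose S : R := \sum_j `|tnth w j|.
  have S0 : 0 <= S by apply: sumr_ge0.
  pose M : R := K%:R / `|a| + (K%:R + K%:R / `|a| * S).
  have a0 : 0 < `|a| by rewrite normr_gt0.
  have Ka0 : 0 <= K%:R / `|a| by rewrite divr_ge0.
  have M0 : 0 <= M by rewrite !addr_ge0 // mulr_ge0.
  exists (Num.Def.archi_bound M) => t; have := archi_boundP M0.
  set L0 := Num.Def.archi_bound M => hM.
  have [x [y ->]] := tconsP t; rewrite /preimage /= aff_tcons => /box_tcons[].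
  rewrite addr0 => /andP[h1 h2] h3.
  have hx : `|x| <= K%:R / `|a|.
    by rewrite ler_pdivlMr // mulrC -normrM ler_norml; apply/andP; split; lra.
  have K0 := ler0n R K.
  apply/box_tcons; split.
    move: hx; rewrite ler_norml => /andP[x1 x2].
    have KS := mulr_ge0 Ka0 S0; rewrite /M in hM; apply/andP; split; lra.
  move=> j; have := h3 j; rewrite tnth_mktuple [tnth (tlin _ _ _) _]tnth_mktuple [tnth z _]tnth_mktuple addr0 => /andP[y1 y2].
  have : `|x * tnth w j| <= K%:R / `|a| * S.
    rewrite normrM; apply: ler_pM => //.
    by rewrite /S (bigD1 j) //= lerDl sumr_ge0.
  rewrite ler_norml => /andP[z1 z2]; rewrite /M in hM; apply/andP; split; lra.
- by apply: compact_box; exact: zono_compact.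
- by rewrite AE; exact: h.
Qed.

End Shear.

(** A generator with nonzero first coordinate is brought to the front and sheared to [e_0]; the rest
    and its projection both have fewer generators. If there is none, the zonotope lies in the
    hyperplane [x_0 = 0] and is null. In dimension 0 the space is a point and one frequency is
    enough. *)
Theorem riesz_zono d (vs : seq 'rV[R]_d) : riesz_set [set t | zono vs (row_of_tuple t)].
Proof.
have [n] := ubnP (size vs); elim: n d vs => // n IH d vs; rewrite ltnS => sn.
case: d vs sn => [|d] vs sn.
  rewrite (_ : [set t | _] = setT); first exact: riesz_set_dim0.
  apply/seteqP; split=> // t _ /=; rewrite (_ : row_of_tuple t = 0); first exact: zono0.
  by apply/rowP => -[].
case: (boolP (has (fun v : 'rV[R]_d.+1 => v ord0 ord0 != 0) vs)) => [/split_find|hn].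
  move=> h; move: sn; case: h => v ws1 ws2 v0 _ sn.
  rewrite cat_rcons zono_rot; apply: riesz_set_shear => //; rewrite map_cons.
  rewrite (_ : v - _ = delta_mx ord0 ord0); last by apply/rowP => i; rewrite !mxE; field.
  have sz : (size (ws1 ++ ws2) < n)%N.
    by move: sn; rewrite !size_cat size_rcons addSn.
  by apply: riesz_zono_step; apply: IH; rewrite !size_map.
apply: riesz_set_null => f lf; apply: thead0_null lf => t ht.
have := zono_coord (i := ord0) _ ht; rewrite mxE (_ : thead t = tnth t ord0) //; apply => v vv.
by apply/eqP; apply: contraNT hn => v0; apply/hasP; exists v.
Qed.

End Zonotope.

(** * Faces of centrally symmetric polytopes *)

Section Convexity.
Context {R : realType} {d : nat}.
Local Notation V := 'rV[R]_d.
Implicit Types (a b c x y z v p q : V) (P Q : seq V) (C : set V).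

Lemma dotpC x y : dotp x y = dotp y x.
Proof. by apply: eq_bigr => i _; rewrite mulrC. Qed.
Lemma dotpDr a x y : dotp a (x + y) = dotp a x + dotp a y.
Proof. by rewrite /dotp -big_split; apply: eq_bigr => i _; rewrite mxE mulrDr. Qed.
Lemma dotpZr a s x : dotp a (s *: x) = s * dotp a x.
Proof. by rewrite /dotp mulr_sumr; apply: eq_bigr => i _; rewrite mxE mulrCA. Qed.
Lemma dotpNr a x : dotp a (- x) = - dotp a x.
Proof. by rewrite -scaleN1r dotpZr mulN1r. Qed.
Lemma dotpBr a x y : dotp a (x - y) = dotp a x - dotp a y.
Proof. by rewrite dotpDr dotpNr. Qed.
Lemma dotpDl a b x : dotp (a + b) x = dotp a x + dotp b x.
Proof. by rewrite dotpC dotpDr !(dotpC x). Qed.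
Lemma dotpZl s a x : dotp (s *: a) x = s * dotp a x.
Proof. by rewrite dotpC dotpZr (dotpC x). Qed.
Lemma dotpNl a x : dotp (- a) x = - dotp a x.
Proof. by rewrite dotpC dotpNr (dotpC x). Qed.
Lemma dotpBl a b x : dotp (a - b) x = dotp a x - dotp b x.
Proof. by rewrite dotpDl dotpNl. Qed.
Lemma dotp0r a : dotp a 0 = 0.
Proof. by rewrite -(scale0r 0) dotpZr mul0r. Qed.
Lemma dotp0l a : dotp 0 a = 0.
Proof. by rewrite dotpC dotp0r. Qed.
Lemma dotp_sumr a (I : Type) (s : seq I) (F : I -> V) :
  dotp a (\sum_(i <- s) F i) = \sum_(i <- s) dotp a (F i).
Proof. by elim/big_rec2: _ => [|i x y _ <-]; rewrite ?dotp0r ?dotpDr. Qed.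

Lemma dotp_ge0 x : 0 <= dotp x x.
Proof. by apply: sumr_ge0 => i _; rewrite -expr2 sqr_ge0. Qed.
Lemma dotp_gt0 x : x != 0 -> 0 < dotp x x.
Proof.
move=> x0; rewrite lt_def dotp_ge0 andbT; apply: contraNneq x0 => h.
apply/eqP/rowP => i; rewrite mxE; apply/eqP; rewrite -sqrf_eq0 expr2.
have h' : \sum_(i < d) x ord0 i * x ord0 i == 0 by rewrite -/(dotp x x) h.
have h0 (j : 'I_d) : true -> 0 <= x ord0 j * x ord0 j by rewrite -expr2 sqr_ge0.
by have /allP/(_ i (mem_index_enum _)) := etrans (esym (psumr_eq0 _ h0)) h'.
Qed.

Lemma dotp_continuous a : continuous (dotp a).
Proof.
apply: continuous_big => [|i _ x]; first exact: add_continuous.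
by apply: continuousM; [exact: cst_continuous|exact: coord_continuous].
Qed.

(** The normal is [x - y0] with [y0] the point of [C] nearest to [x]: if it made an acute angle with
    [y - y0], a short move from [y0] towards [y] would come closer to [x]. *)
Lemma separation C x : compact C -> convex C -> C !=set0 -> ~ C x ->
  exists a, forall y, C y -> dotp a y < dotp a x.
Proof.
move=> kC cC C0 nCx; pose f y := dotp (x - y) (x - y).
have cf : continuous f.
  apply: continuous_big => [|i _ y]; first exact: add_continuous.
  have h : (x - y) ord0 i = (fun z : V => (x - z) ord0 i) y by [].
  have ct : {for y, continuous (fun z : V => (x - z) ord0 i)}.
    rewrite (_ : (fun z : V => _) = fun z : V => x ord0 i - z ord0 i); last first.
      by apply/funext => z; rewrite !mxE.
    by apply: continuousB; [exact: cst_continuous|exact: coord_continuous].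
  by apply: continuousM.
have [y0] := compact_EVT_min C0 kC (continuous_subspaceT cf).
rewrite inE => Cy0 hmin; exists (x - y0) => y Cy.
have n0 : x - y0 != 0.
  by rewrite subr_eq0; apply/eqP => xy; apply: nCx; rewrite xy.
have gap : 0 < dotp (x - y0) (x - y0) by exact: dotp_gt0.
suff h : dotp (x - y0) (y - y0) <= 0.
  by move: gap h; rewrite !(dotpBr (x - y0)); lra.
rewrite leNgt; apply/negP => pos.
set n := x - y0 in n0 gap pos *; set w := y - y0 in pos *.
have key (s : R) : 0 <= s <= 1 -> 0 <= s * (s * dotp w w - 2 * dotp n w).
  move=> s01; have Cz : C (s *: y + (1 - s) *: y0) by exact: cC.
  have := hmin (s *: y + (1 - s) *: y0); rewrite inE => /(_ Cz).
  rewrite /f (_ : x - (s *: y + (1 - s) *: y0) = n - s *: w); last first.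
    by apply/rowP => i; rewrite !mxE; ring.
  have e (p q : V) : dotp (p - s *: q) (p - s *: q) = dotp p p + s * (s * dotp q q - 2 * dotp p q).
    by rewrite !dotpBr !dotpBl !dotpZr !dotpZl (dotpC q p); ring.
  rewrite -/n e; lra.
have w0 : 0 <= dotp w w by exact: dotp_ge0.
(* Small enough for the quadratic term [s * dotp w w] to stay below the linear term
   [2 * dotp n w]. *)
pose s := Num.min 1 (dotp n w / (dotp w w + 1)).
have s0 : 0 < s by rewrite lt_min ltr01 /= divr_gt0 // ltr_wpDl.
have s1 : s <= 1 by rewrite ge_min lexx.
have s2 : s * (dotp w w + 1) <= dotp n w.
  by rewrite -ler_pdivlMr ?ltr_wpDl // /s ge_min lexx orbT.
have := key s; rewrite (ltW s0) s1 => /(_ isT); rewrite pmulr_rge0 //; nra.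
Qed.

Section Hull.

Lemma hull_mem P p : p \in P -> conv_hull P p.
Proof.
move=> pP; have hi : (index p P < size P)%N by rewrite index_mem.
exists (fun i => (i == Ordinal hi)%:R); split; first by move=> i; rewrite ler0n.
split; first by rewrite (bigD1 (Ordinal hi)) //= eqxx big1 ?addr0 // => i /negbTE ->.
rewrite (bigD1 (Ordinal hi)) //= eqxx scale1r nth_index // big1 ?addr0 // => i /negbTE ->.
by rewrite scale0r.
Qed.

Lemma hull_convex P : convex (conv_hull P).
Proof.
move=> x y s /andP[s0 s1] [w [w0 [w1 ->]]] [w' [w'0 [w'1 ->]]].
exists (fun i => s * w i + (1 - s) * w' i); split.
  by move=> i; rewrite addr_ge0 // mulr_ge0 // subr_ge0.
split; first by rewrite big_split /= -!mulr_sumr w1 w'1 !mulr1 addrC subrK.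
rewrite !scaler_sumr -big_split /=; apply: eq_bigr => i _.
by rewrite [RHS]scalerDl !scalerA.
Qed.

Lemma hull_le P a (m : R) x : (forall p, p \in P -> dotp a p <= m) -> conv_hull P x -> dotp a x <= m.
Proof.
move=> h [w [w0 [w1 ->]]]; rewrite dotp_sumr -[m]mul1r -w1 mulr_suml.
by apply: ler_sum => i _; rewrite dotpZr ler_wpM2l // h // mem_nth.
Qed.

Lemma hull_compact P : compact (conv_hull P).
Proof.
pose n := size P.
pose S := [set v : 'rV[R]_n | forall i, [set` `[(0 : R), 1]] (v ord0 i)] `&`
  (fun v : 'rV[R]_n => \sum_i v ord0 i) @^-1` [set 1].
have cS : compact S.
  apply: compact_closedI; first by apply: (@rV_compact R n (fun=> [set` `[0, 1]])) => i; exact: segment_compact.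
  apply: preimage_closed; last exact: closed_eq.
  move=> v _; apply: continuous_big => [|i _]; first exact: add_continuous.
  exact: coord_continuous.
rewrite (_ : conv_hull P = [set \sum_i v ord0 i *: P`_i | v in S]).
  apply: continuous_compact cS; apply: continuous_subspaceT.
  apply: continuous_big => [|i _ v]; first exact: add_continuous.
  have cv : {for v, continuous (fun z : 'rV[R]_n => z ord0 i)} by exact: coord_continuous.
  exact: (continuousZr_tmp cv).
apply/seteqP; split=> x.
  move=> [w [w0 [w1 xE]]]; exists (\row_i w i); last first.
    by rewrite xE; apply: eq_bigr => i _; rewrite mxE.
  split; last by rewrite /= -w1; apply: eq_bigr => i _; rewrite mxE.
  move=> i; rewrite /= mxE in_itv /= w0 /= -w1 (bigD1 i) //= lerDl.
  exact: sumr_ge0.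
move=> [v [h1 h2] <-]; exists (fun i => v ord0 i); split; last by [].
by move=> i; have := h1 i; rewrite /= in_itv /= => /andP[].
Qed.

(** A point of the hull outside [C] would be separated from [C], but a linear functional attains its
    maximum over the hull at a point of [P]. *)
Lemma hull_sub P C : compact C -> convex C -> (forall p, p \in P -> C p) -> conv_hull P `<=` C.
Proof.
move=> kC cC PC x hx; apply: contrapT => nx.
have C0 : C !=set0.
  case: P PC hx => [|p P] PC hx; last by exists p; apply: PC; rewrite mem_head.
  by case: hx => w [_ [/eqP]]; rewrite big_ord0 eq_sym oner_eq0.
have [a ha] := separation kC cC C0 nx.
have [p pP pm] : exists2 p, p \in P & forall q, q \in P -> dotp a q <= dotp a p.
  case: P hx {PC} => [|p P] hx.
    by case: hx => w [_ [/eqP]]; rewrite big_ord0 eq_sym oner_eq0.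
  elim: P p {hx} => [|q P IH] p.
    by exists p; rewrite ?mem_head // => r; rewrite inE => /eqP ->.
  have [r rP hr] := IH q; case: (lerP (dotp a r) (dotp a p)) => h.
    exists p; first exact: mem_head.
    by move=> t; rewrite inE => /orP[/eqP ->//|/hr h']; exact: le_trans h' h.
  exists r; first by rewrite inE rP orbT.
  by move=> t; rewrite inE => /orP[/eqP ->|/hr //]; exact: ltW.
have := hull_le pm hx; rewrite leNgt ha //; exact: PC.
Qed.

Lemma hull_seq_sub P Q : (forall p, p \in P -> conv_hull Q p) -> conv_hull P `<=` conv_hull Q.
Proof. by apply: hull_sub; [exact: hull_compact|exact: hull_convex]. Qed.

End Hull.
End Convexity.

Lemma min_nat (Q : nat -> Prop) : (exists n, Q n) -> exists2 n, Q n & forall m, Q m -> (n <= m)%N.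
Proof.
move=> [n Qn]; have ex : exists n, `[< Q n >] by exists n; apply/asboolP.
case: (ex_minnP ex) => m /asboolP Qm h; exists m => // k /asboolP; exact: h.
Qed.

(** Continuation along [0, 1]: the supremum of the times up to which [Q] holds can always be passed,
    hence equals 1 and is itself reached. *)
Lemma real_walk {R : realType} (Q : R -> Prop) :
  (exists2 e : R, 0 < e & forall s, 0 <= s <= e -> Q s) ->
  (forall t, 0 < t <= 1 -> (forall s, 0 <= s < t -> Q s) ->
    exists2 e : R, 0 < e & forall s, t <= s <= t + e -> Q s) -> Q 1.
Proof.
move=> [e0 e00 h0] hs.
pose E : set R := [set t | 0 <= t <= 1 /\ forall s, 0 <= s <= t -> Q s].
have E0 : E (Num.min 1 e0).
  split=> [|s /andP[s0]]; first by rewrite ge_min lexx le_min ler01 ltW.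
  by rewrite le_min => /andP[_ s1]; apply: h0; rewrite s0.
have hE : has_sup E by split; [exists (Num.min 1 e0)|exists 1 => t [/andP[]]].
pose t := sup E.
have t0 : 0 < t.
  apply: lt_le_trans (ub_le_sup hE.2 E0).
  by rewrite lt_min ltr01.
have t1 : t <= 1 by apply: ge_sup; [exact: hE.1 | move=> s [/andP[]]].
have below s : 0 <= s < t -> Q s.
  move=> /andP[s0 st]; have ts : 0 < t - s by rewrite subr_gt0.
  have [r [_ hr] hrs] := sup_adherent ts hE.
  by apply: hr; rewrite s0 /=; rewrite -/t in hrs; lra.
have [e e1 he] := hs t (introT andP (conj t0 t1)) below.
have : E (Num.min 1 (t + e)).
  split=> [|s /andP[s0]]; first by rewrite ge_min lexx le_min ler01 addr_ge0 // ltW.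
  rewrite le_min => /andP[s1 s2]; case: (ltP s t) => st; first by apply: below; rewrite s0.
  by apply: he; rewrite st.
move=> /(ub_le_sup hE.2); rewrite -/t => h.
have t1' : t = 1.
  apply/eqP; rewrite eq_le t1 /=; move: h; rewrite ge_min => /orP[//|]; lra.
by rewrite -t1'; apply: he; rewrite lexx lerDl ltW.
Qed.

Lemma affine_germ {R : realType} (a b : R) : exists2 e : R, 0 < e &
  (forall s, 0 <= s <= e -> a + s * b <= 0) \/ (forall s, 0 <= s <= e -> 0 <= a + s * b).
Proof.
case: (ltrgtP a 0) => [a0|a0|->].
- exists (- a / (`|b| + 1)); first by rewrite divr_gt0 ?oppr_gt0 // ltr_wpDl.
  left=> s /andP[s0 s1]; have b1 := ler_norm b.
  have : s * (`|b| + 1) <= - a by rewrite -ler_pdivlMr // ltr_wpDl.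
  nra.
- exists (a / (`|b| + 1)); first by rewrite divr_gt0 // ltr_wpDl.
  right=> s /andP[s0 s1]; have b1 := ler_norm (- b); rewrite normrN in b1.
  have : s * (`|b| + 1) <= a by rewrite -ler_pdivlMr // ltr_wpDl.
  nra.
- exists 1 => //; case: (lerP b 0) => b0; [left|right] => s /andP[s0 _]; nra.
Qed.

Section Faces.
Context {R : realType} {d : nat}.
Local Notation V := 'rV[R]_d.
Implicit Types (a b c e g x y z v p q r : V) (P : seq V).

(** Two affine functions of [s] keep their order on a short interval to the right of 0, so comparing
    the points of [P] one by one leaves one that is maximal on such an interval. *)
Lemma stable_max P a b : P != [::] -> exists2 p, p \in P & exists2 e : R, 0 < e &
  forall s q, 0 <= s <= e -> q \in P -> dotp (a + s *: b) q <= dotp (a + s *: b) p.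
Proof.
case: P => // p P _; elim: P p => [|q P IH] p.
  exists p; first exact: mem_head.
  by exists 1 => // s r _; rewrite inE => /eqP ->.
have [r rP [e e0 he]] := IH q.
have [e' e'0 he'] := affine_germ (dotp a (p - r)) (dotp b (p - r)).
have E s : dotp (a + s *: b) p - dotp (a + s *: b) r = dotp a (p - r) + s * dotp b (p - r).
  by rewrite -dotpBr dotpDl dotpZl.
have m0 : 0 < Num.min e e' by rewrite lt_min e0.
case: he' => h.
  exists r; first by rewrite inE rP orbT.
  exists (Num.min e e') => // s t /andP[s0]; rewrite le_min => /andP[s1 s2].
  rewrite inE => /orP[/eqP ->|tP]; last by apply: he => //; rewrite s0.
  by rewrite -subr_le0 E h // s0.
exists p; first exact: mem_head.
exists (Num.min e e') => // s t /andP[s0]; rewrite le_min => /andP[s1 s2].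
rewrite inE => /orP[/eqP -> //|tP]; apply: (@le_trans _ _ (dotp (a + s *: b) r)).
  by apply: he => //; rewrite s0.
by rewrite -subr_ge0 E h // s0.
Qed.

Definition maxs P a := [seq p <- P | all (fun q => dotp a q <= dotp a p) P].

Lemma maxsP P a p : p \in maxs P a <-> p \in P /\ forall q, q \in P -> dotp a q <= dotp a p.
Proof.
rewrite mem_filter; split=> [/andP[/allP h pP]|[pP h]]; first by split.
by rewrite pP andbT; apply/allP.
Qed.

(** A face of a face is a face: [a] tilted slightly towards [b] selects, among the maximizers of
    [a], those where [b] is largest. *)
Lemma maxs_refine P a b p q : p \in maxs P a ->
  (forall r, r \in maxs P a -> dotp b r <= dotp b p) -> q \in maxs P a -> dotp b q < dotp b p ->
  exists a', {subset maxs P a' <= maxs P a} /\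
    (forall r, r \in maxs P a' <-> r \in maxs P a /\ dotp b r = dotp b p).
Proof.
move=> pS pb qS qp.
have P0 : P != [::] by case: P pS {pb qS}.
have [r rP [e e0 he]] := stable_max a b P0.
have eb : 0 <= (0 : R) <= e by rewrite lexx ltW.
have rS : r \in maxs P a.
  by apply/maxsP; split=> // t tP; have := he 0 t eb tP; rewrite scale0r addr0.
have ra t : t \in maxs P a -> dotp a t = dotp a r.
  move=> /maxsP[tP ht]; apply/eqP; rewrite eq_le ht ?andbT //.
  by have /maxsP[_ ->] := rS.
have rb : dotp b r = dotp b p.
  apply/eqP; rewrite eq_le pb //=.
  have pP : p \in P by have /maxsP[] := pS.
  have := he e p _ pP; rewrite lexx ltW // => /(_ isT).
  by rewrite !dotpDl !dotpZl (ra p) // lerD2l ler_pM2l.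
(* [r] is maximal from time 0 to time [e], so a point that ties with it at the interior time [e / 2]
   ties at both ends. *)
have H t : t \in maxs P (a + (e / 2) *: b) <-> t \in maxs P a /\ dotp b t = dotp b p.
  have e2 : 0 <= e / 2 <= e by apply/andP; split; lra.
  split=> [/maxsP[tP ht]|[tS tb]]; last first.
    have tP : t \in P by have /maxsP[] := tS.
    apply/maxsP; split=> // q' q'P; apply: le_trans (he _ _ e2 q'P) _.
    by rewrite !dotpDl !dotpZl (ra t) // tb rb.
  have h1 : dotp (a + (e / 2) *: b) t = dotp (a + (e / 2) *: b) r.
    by apply/eqP; rewrite eq_le he // ht.
  have h2 := he 0 t eb tP; have h3 := he e t; rewrite lexx ltW // in h3.
  have {}h3 := h3 isT tP.
  move: h1 h2 h3; rewrite !dotpDl !dotpZl !mul0r !addr0 => h1 h2 h3.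
  have h4 : dotp a t = dotp a r by nra.
  have h5 : dotp b t = dotp b r by nra.
  split; last by rewrite h5.
  by apply/maxsP; split=> // q' q'P; rewrite h4; have /maxsP[_ ->] := rS.
by exists (a + (e / 2) *: b); split=> // t /H[].
Qed.

(* Tilting the functional exposing [p] towards the one exposing [q] until a tie occurs. *)
Lemma tie (S : seq V) (c e p q : V) : p \in S -> q \in S -> p != q ->
  (forall r, r \in S -> r != p -> dotp c r < dotp c p) ->
  (forall r, r \in S -> r != q -> dotp e r < dotp e q) ->
  exists2 l : R, 0 < l & (forall r, r \in S -> dotp (c + l *: e) r <= dotp (c + l *: e) p) /\
    exists2 y, y \in S & y != p /\ dotp (c + l *: e) y = dotp (c + l *: e) p.
Proof.
move=> pS qS pq hc he.
pose S' := [seq y <- S | 0 < dotp e (y - p)].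
(* The time at which [y] catches up with [p] under [c + l *: e]; the first point of [S'] to do so
   gives the tie. *)
pose f y := dotp c (p - y) / dotp e (y - p).
have qS' : q \in S' by rewrite mem_filter qS andbT dotpBr subr_gt0 he.
have [y yS' hy] : exists2 y, y \in S' & forall z, z \in S' -> f y <= f z.
  elim: S' q qS' {hc he pS qS pq} => [//|z S' IH] q _.
  case: (S' =P [::]) => [->|/eqP S0].
    by exists z; rewrite ?mem_head // => t; rewrite inE => /eqP ->.
  have [|y yS hy] := IH (head z S'); first by case: S' S0 {IH} => //= t S'; rewrite mem_head.
  case: (lerP (f z) (f y)) => h.
    exists z; first exact: mem_head.
    by move=> t; rewrite inE => /orP[/eqP ->//|/hy]; exact: le_trans h.
  exists y; first by rewrite inE yS orbT.
  by move=> t; rewrite inE => /orP[/eqP ->|/hy //]; exact: ltW.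
move: yS'; rewrite mem_filter => /andP[y0 yS].
have yp : y != p by apply: contraTneq y0 => ->; rewrite subrr dotp0r ltxx.
have l0 : 0 < f y by rewrite divr_gt0 // dotpBr subr_gt0 hc.
exists (f y) => //; split.
  move=> r rS; rewrite -subr_ge0 -dotpBr dotpDl dotpZl.
  case: (eqVneq r p) => [->|rp]; first by rewrite subrr !dotp0r mulr0 addr0.
  have c0 : 0 < dotp c (p - r) by rewrite dotpBr subr_gt0 hc.
  have eN : dotp e (p - r) = - dotp e (r - p) by rewrite !dotpBr opprB.
  case: (lerP (dotp e (r - p)) 0) => h; first by rewrite eN; nra.
  have : f y <= f r by apply: hy; rewrite mem_filter h.
  by rewrite {2}/f ler_pdivlMr // eN; lra.
exists y => //; split=> //; apply/eqP; rewrite -subr_eq0 -dotpBr dotpDl dotpZl.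
have -> : dotp c (y - p) = - dotp c (p - y) by rewrite !dotpBr opprB.
have en : dotp e (y - p) != 0 by rewrite gt_eqF.
by rewrite /f divfK // addNr.
Qed.

(** Take a face with the least number of points among those with at least two. By [maxs_refine] a
    functional whose maximum over this face is attained at two points is constant on it, and this
    excludes a third point. *)
Lemma exists_edge P : uniq P -> (1 < size P)%N ->
  (forall p, p \in P -> exists c, forall q, q \in P -> q != p -> dotp c q < dotp c p) ->
  exists a p q, [/\ p != q, p \in P, q \in P &
    forall r, (r \in maxs P a) = (r == p) || (r == q)].
Proof.
move=> uP sP hP.
have [|n [a [an n2]] hmin] := @min_nat (fun n => exists a, size (maxs P a) = n /\ (2 <= n)%N).
  exists (size (maxs P 0)), 0; split=> //; rewrite /maxs (_ : [seq p <- P | _] = P) //.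
  by apply/all_filterP/allP => p _; apply/allP => q _; rewrite !dotp0l.
set S := maxs P a in an.
have uS : uniq S by exact: filter_uniq.
have SP r : r \in S -> r \in P by move/maxsP => [].
have const b p y : p \in S -> (forall r, r \in S -> dotp b r <= dotp b p) ->
    y \in S -> y != p -> dotp b y = dotp b p -> forall r, r \in S -> dotp b r = dotp b p.
  move=> pS pb yS yp yb r rS; apply/eqP; rewrite eq_le pb //= leNgt; apply/negP => rb.
  have [a' [sub hS]] := maxs_refine pS pb rS rb.
  have ua : uniq (maxs P a') by exact: filter_uniq.
  have big : (2 <= size (maxs P a'))%N.
    have := @uniq_leq_size _ [:: p; y] (maxs P a'); rewrite /= inE eq_sym yp; apply=> // t.
    by rewrite !inE => /orP[] /eqP ->; apply/hS.
  have := hmin _ (ex_intro _ a' (conj erefl big)); rewrite -an leqNgt => /negP; apply.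
  have := @uniq_leq_size _ (r :: maxs P a') S; rewrite /=; apply.
    by rewrite ua andbT; apply/negP => /hS[_ rb']; rewrite rb' ltxx in rb.
  by move=> t; rewrite inE => /orP[/eqP ->//|]; exact: sub.
have : size S = 2.
  apply/eqP; rewrite eqn_leq an n2 andbT -an leqNgt; apply/negP.
  case E : S => [|p [|q [|r S']]] // _.
  have [pS qS rS] : [/\ p \in S, q \in S & r \in S] by rewrite E !inE !eqxx !orbT.
  have : uniq S by []; rewrite {1}E /= !inE !negb_or => /andP[/and3P[pq pr _] /andP[/andP[qr _] _]].
  have [c hc] := hP p (SP _ pS); have [e he] := hP q (SP _ qS); have [g hg] := hP r (SP _ rS).
  have hc' t : t \in S -> t != p -> dotp c t < dotp c p by move=> /SP; exact: hc.
  have he' t : t \in S -> t != q -> dotp e t < dotp e q by move=> /SP; exact: he.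
  have hg' t : t \in S -> t != r -> dotp g t < dotp g r by move=> /SP; exact: hg.
  (* Both [c + l *: e] and [c + m *: g] are constant on [S]. So [e], largest only at [q], makes [c]
     smallest only at [q], while [g] makes [c] smallest only at [r]. *)
  have [l l0 [h1 [y yS [yp yE]]]] := tie pS qS pq hc' he'.
  have [m m0 [h2 [z zS [zp zE]]]] := tie pS rS pr hc' hg'.
  have k1 := const _ _ _ pS h1 yS yp yE; have k2 := const _ _ _ pS h2 zS zp zE.
  have := k1 q qS; have := k1 r rS; have := k2 q qS; have := k2 r rS.
  have := he' r rS; rewrite eq_sym => /(_ qr); have := hg' q qS qr.
  rewrite !dotpDl !dotpZl -!(subr_gt0 (dotp _ _)) => /(mulr_gt0 m0) + /(mulr_gt0 l0).
  move: (dotp c p) (dotp c q) (dotp c r) (dotp e p) (dotp e q) (dotp e r)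
    (dotp g p) (dotp g q) (dotp g r) => x1 x2 x3 x4 x5 x6 x7 x8 x9.
  rewrite !mulrBr; lra.
case E : S => [|p [|q []]] // _; exists a, p, q.
have : uniq S by []; rewrite {1}E /= inE andbT => pq.
split=> //; try by apply: SP; rewrite E !inE eqxx ?orbT.
by move=> r; rewrite -/S E !inE.
Qed.

End Faces.

(** * Symmetric faces and splitting off a segment *)

Section SymmetricPolytopes.
Context {R : realType} {d : nat}.
Local Notation V := 'rV[R]_d.
Implicit Types (a b c x y z v p q r : V) (P : seq V) (C Om : set V).

Definition csym C := exists c, forall x, C x -> C (c - x).

Lemma csymP C : centrally_symmetric C <-> csym C.
Proof.
split=> -[c h].
  exists (- c) => x Cx; have : [set - x | x in C] (- x) by exists x.
  by rewrite h => -[y Cy yx]; rewrite (_ : - c - x = y) // -yx addrC addrK.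
exists (- c); apply/seteqP; split=> y [x Cx <-].
  by exists (c - x); [exact: h|rewrite addrC addKr].
by exists (c - x); [exact: h|rewrite opprB].
Qed.

Definition top Om a y := Om y /\ forall x, Om x -> dotp a x <= dotp a y.
Definition csym_faces Om := forall a (m : R), (forall x, Om x -> dotp a x <= m) ->
  csym (Om `&` [set x | dotp a x = m]).

Lemma top_sym Om a : csym_faces Om -> (exists y, top Om a y) ->
  exists c, forall x, top Om a x -> top Om a (c - x).
Proof.
move=> hF [y [Oy hy]]; have [c hc] := hF a _ hy; exists c => x [Ox hx].
have e : dotp a x = dotp a y by apply/eqP; rewrite eq_le hy // hx.
by have [|h1 /= h2] := hc x; [split | split=> // z Oz; rewrite h2; exact: hy].
Qed.

Section Walk.
Variables (P : seq V) (a0 p q : V).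
Let Om := conv_hull P.
Hypotheses (pP : p \in P) (edge : forall r, (r \in maxs P a0) = (r == p) || (r == q)).
Hypothesis faces : csym_faces Om.
Let v := q - p.

Let top_max a r : r \in P -> (forall t, t \in P -> dotp a t <= dotp a r) -> top Om a r.
Proof. by move=> rP h; split; [exact: hull_mem | move=> x; exact: hull_le]. Qed.

Let stable a b : exists2 r, r \in P & exists2 e : R, 0 < e &
  forall s, 0 <= s <= e -> top Om (a + s *: b) r.
Proof.
have [|r rP [e e0 he]] := stable_max a b (P := P); first by case: P pP.
by exists r => //; exists e => // s s0e; apply: top_max => // t; exact: he.
Qed.

(** The difference of the values at [x] and at [r] is affine in the parameter and nonpositive on
    [[0, e]]; vanishing at an interior point, it vanishes identically. *)
Let interior a b r (e s : R) x : (forall s, 0 <= s <= e -> top Om (a + s *: b) r) ->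
  0 < s < e -> top Om (a + s *: b) x -> top Om a x /\ dotp b x = dotp b r.
Proof.
move=> h /andP[s0 se] [Ox hx].
have e0 : 0 < e by exact: lt_trans s0 se.
have [Or h0] := h 0 (introT andP (conj (lexx _) (ltW e0))).
have [_ he] := h e (introT andP (conj (ltW e0) (lexx _))).
have [_ hs] := h s (introT andP (conj (ltW s0) (ltW se))).
have := h0 x Ox; have := he x Ox; have := hs x Ox; have := hx r Or.
rewrite !dotpDl !dotpZl !mul0r !addr0 => i1 i2 i3 i4.
have be : dotp b x = dotp b r.
  have i5 : 0 <= (e - s) * (dotp b r - dotp b x) by lra.
  have i6 : 0 <= s * (dotp b x - dotp b r) by lra.
  rewrite !pmulr_rge0 ?subr_gt0 // in i5 i6; lra.
split=> //; split=> // z Oz; have := h0 z Oz.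
rewrite scale0r addr0; rewrite be in i1 i2; lra.
Qed.

(* Along the segment from [a0] to [a], the face of [Om] changes only at finitely many functionals;
   there the faces just before and just after are opposite faces of the face at the critical
   functional, hence exchanged by its central symmetry. *)
Lemma face_translate a : dotp a v = 0 -> exists y, top Om a y /\ top Om a (y + v).
Proof.
move=> av; pose b := a - a0.
have [pS qS] : p \in maxs P a0 /\ q \in maxs P a0 by rewrite !edge !eqxx orbT.
have tp : top Om a0 p by have /maxsP[? ?] := pS; exact: top_max.
have tq : top Om a0 q by have /maxsP[? ?] := qS; exact: top_max.
have a0v : dotp a0 v = 0.
  by rewrite dotpBr; apply/eqP; rewrite subr_eq0 eq_le (tp.2 _ tq.1) (tq.2 _ tp.1).
have bv : dotp b v = 0 by rewrite dotpBl av a0v subrr.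
have pv : p + v = q by rewrite addrC subrK.
pose Q (s : R) := exists y, top Om (a0 + s *: b) y /\ top Om (a0 + s *: b) (y + v).
suff : Q 1.
  by rewrite /Q (_ : a0 + 1 *: b = a) // scale1r addrC subrK.
have dv (s : R) y : dotp (a0 + s *: b) (y + v) = dotp (a0 + s *: b) y.
  by rewrite dotpDr [dotp _ v]dotpDl dotpZl a0v bv mulr0 !addr0.
apply: real_walk.
  (* The point maximal for small [s] is maximal at 0, hence is [p] or [q]; these two tie all along
     the path because [v] is orthogonal to [a0] and [b]. *)
  have [r rP [e e0 he]] := stable a0 b; exists e => // s s0e; exists p; rewrite pv.
  have rS : r \in maxs P a0.
    have := he 0 (introT andP (conj (lexx _) (ltW e0))); rewrite scale0r addr0 => -[_ h].
    by apply/maxsP; split=> // t tP; apply: h; exact: hull_mem.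
  have er : dotp (a0 + s *: b) r = dotp (a0 + s *: b) p.
    by move: rS; rewrite edge => /orP[] /eqP -> //; rewrite -pv dv.
  have [_ hr] := he s s0e.
  by split; (split; [exact: tp.1 || exact: tq.1|]) => x /hr; rewrite er // -pv dv.
move=> t /andP[t0 t1] hQ; set A := a0 + t *: b.
have [p1 p1P [e1 e10 h1]] := stable A b; have [p2 p2P [e2 e20 h2]] := stable A (- b).
(* [t - s] is a time just before [t] at which [p2] is still maximal. *)
pose s := Num.min e2 t / 2.
have m0 : 0 < Num.min e2 t by rewrite lt_min e20.
have [m1 m2] : Num.min e2 t <= e2 /\ Num.min e2 t <= t by rewrite !ge_min !lexx orbT.
have [|y [ty tyv]] := hQ (t - s); first by rewrite /s; apply/andP; split; lra.
have AE : a0 + (t - s) *: b = A + s *: - b by rewrite /A scalerBl scalerN addrA.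
rewrite AE in ty tyv.
have s0e : 0 < s < e2 by rewrite /s; apply/andP; split; lra.
have [Ty by2] := interior h2 s0e ty; have [Tyv _] := interior h2 s0e tyv.
have Tp1 : top Om A p1.
  by have := h1 0 (introT andP (conj (lexx _) (ltW e10))); rewrite scale0r addr0.
have Tp2 : top Om A p2.
  by have := h2 0 (introT andP (conj (lexx _) (ltW e20))); rewrite scale0r addr0.
have topE x z : top Om A x -> top Om A z -> dotp A x = dotp A z.
  by move=> [x1 x2] [z1 z2]; apply/eqP; rewrite eq_le z2 // x2.
have [c hc] := top_sym faces (ex_intro _ p1 Tp1).
(* On the critical face [y] has the least value of [b], since it belongs to the face just before
   [t]. Its reflection therefore has the largest value, that of [p1]. *)
have bz : dotp b (c - y) = dotp b p1.
  apply/eqP; rewrite eq_le; apply/andP; split.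
    have [Oz _] := hc _ Ty; have [_ h] := h1 e1 (introT andP (conj (ltW e10) (lexx _))).
    have := h _ Oz; rewrite !(dotpDl A) !dotpZl (topE _ _ (hc _ Ty) Tp1) lerD2l ler_pM2l //.
  have [Oz _] := hc _ Tp1; have [_ h] := h2 e2 (introT andP (conj (ltW e20) (lexx _))).
  have := h _ Oz; rewrite !(dotpDl A) !dotpZl (topE _ _ (hc _ Tp1) Tp2) lerD2l ler_pM2l // -by2.
  by rewrite !dotpNl !dotpBr; lra.
(* The reflection reverses the segment: its lower end [c - (y + v)] is the image of the upper end
   [y + v]. *)
exists e1 => // r /andP[tr re]; exists (c - (y + v)).
have rE : a0 + r *: b = A + (r - t) *: b by apply/rowP => i; rewrite !mxE; ring.
have cyv : c - (y + v) + v = c - y by apply/rowP => i; rewrite !mxE; ring.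
have r0 : 0 <= r - t <= e1 by apply/andP; split; lra.
have [_ hr] := h1 _ r0.
have val : dotp (A + (r - t) *: b) (c - y) = dotp (A + (r - t) *: b) p1.
  by rewrite !(dotpDl A) !dotpZl bz (topE _ _ (hc _ Ty) Tp1).
have top2 : top Om (a0 + r *: b) (c - y).
  by split; [exact: (hc _ Ty).1 | move=> x /hr; rewrite rE val].
rewrite cyv; split=> //; split; first exact: (hc _ Tyv).1.
by move=> x /top2.2; rewrite -cyv dv.
Qed.

End Walk.

Section Summand.
Variables (C : set V) (v : V).
Hypotheses (kC : compact C) (cC : convex C) (v0 : v != 0).
Hypothesis htop : forall a, dotp a v = 0 -> exists y, top C a y /\ top C a (y + v).
Let K : set V := C `&` [set x | C (x + v)].

Lemma summand_convex : convex K.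
Proof.
move=> x y s s01 [x1 x2] [y1 y2]; split; first exact: cC.
have := cC s01 x2 y2; rewrite /= (_ : s *: (x + v) + _ = s *: x + (1 - s) *: y + v) //.
by apply/rowP => i; rewrite !mxE; ring.
Qed.

Lemma summand_compact : compact K.
Proof.
apply: compact_closedI => //; apply: preimage_closed; last first.
  apply: (compact_closed _ kC); exact: norm_hausdorff.
move=> x _; apply: (@continuousD _ _ _ (fun z : V => z) (fun=> v)); first by move=> U hU; exact: hU.
exact: cst_continuous.
Qed.

(** The projection [pi] along [v] is self-adjoint, so a functional separating [pi x] from [pi K] may
    be replaced by one orthogonal to [v]. That functional is maximal over [C] at a point of [K],
    which is absurd; hence [x] lies on a line in the direction [v] through a point of [K]. *)
Lemma summandP x : C x <-> exists s : R, 0 <= s <= 1 /\ K (x - s *: v).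
Proof.
split=> [Cx|[s [/andP[s0 s1] [h1 h2]]]]; last first.
  rewrite -[x](subrK (s *: v)); apply: (convex_line (s := 0) (r := 1)) => //.
  - by rewrite s0.
  - by rewrite scale0r addr0.
  - by rewrite scale1r.
pose pi z := z - (dotp v z / dotp v v) *: v.
have vv : 0 < dotp v v by exact: dotp_gt0.
have pi_convex : convex [set pi z | z in K].
  move=> _ _ s s01 [y Ky <-] [z Kz <-]; exists (s *: y + (1 - s) *: z).
    exact: summand_convex.
  rewrite /pi dotpDr !dotpZr; apply/rowP => i; rewrite !mxE; field; rewrite gt_eqF //.
have pi_compact : compact [set pi z | z in K].
  apply: continuous_compact summand_compact; apply: continuous_subspaceT => z.
  have cd : {for z, continuous (dotp v)} by exact: dotp_continuous.
  have c2 : {for z, continuous (fun z => dotp v z / dotp v v)}.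
    by apply: continuousM => //; exact: cst_continuous.
  apply: (@continuousB _ _ _ (fun z : V => z)); first by move=> U hU; exact: hU.
  exact: (continuousZr_tmp c2).
have [|k0 [kC0 kC1]] := htop (a := 0); first exact: dotp0l.
have K0 : [set pi z | z in K] !=set0.
  by exists (pi k0); exists k0 => //; split; [exact: kC0.1|exact: kC1.1].
have piE a z : dotp (pi a) z = dotp a (pi z).
  by rewrite /pi dotpBl dotpBr dotpZl dotpZr (dotpC a v); ring.
have piv : pi v = 0 by rewrite /pi divff ?gt_eqF // scale1r subrr.
have [k Kk kx] : [set pi z | z in K] (pi x).
  apply: contrapT => n; have [a ha] := separation pi_compact pi_convex K0 n.
  have [|y [ty tyv]] := htop (a := pi a); first by rewrite piE piv dotp0r.
  have Ky : [set pi z | z in K] (pi y) by exists y => //; split; [exact: ty.1|exact: tyv.1].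
  by have := ty.2 x Cx; rewrite !piE leNgt ha.
have [s xE] : exists s, x = k + s *: v.
  exists (dotp v x / dotp v v - dotp v k / dotp v v).
  move: kx; rewrite /pi => /eqP; rewrite subr_eq => /eqP kE.
  by rewrite {1}kE scalerBl; apply/rowP => i; rewrite !mxE; ring.
have [k1 k2] := Kk.
have line (r t u : R) : r <= t <= u -> C (k + r *: v) -> C (k + u *: v) -> C (k + t *: v).
  exact: convex_line.
have Ck0 : C (k + 0 *: v) by rewrite scale0r addr0.
have Ck1 : C (k + 1 *: v) by rewrite scale1r.
have Cks : C (k + s *: v) by rewrite -xE.
have eq1 (r : R) : k + r *: v + v = k + (r + 1) *: v by rewrite -addrA scalerDl scale1r.
(* The position [s] relative to [k] may leave [0, 1]. By convexity on the line, [x] itself is in [K]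
   if [s < 0], and [x - v] is if [s > 1]. *)
case: (ltP s 0) => s0.
  exists 0; rewrite lexx ler01; split=> //; rewrite scale0r subr0 xE; split=> //=.
  rewrite eq1; apply: line Cks Ck1; apply/andP; split; lra.
case: (ltP 1 s) => s1.
  exists 1; rewrite lexx ler01; split=> //; rewrite scale1r.
  have -> : x - v = k + (s - 1) *: v by rewrite xE scalerBl scale1r addrA.
  split; first by apply: line Ck0 Cks; apply/andP; split; lra.
  by rewrite /= eq1 subrK.
by exists s; rewrite s0 s1; split=> //; rewrite xE addrK.
Qed.

(** If [dotp a v] is negative, the face of [K] is the face [F] of [C] in direction [a]; if positive,
    it is [F - v]. If zero, it consists of the [x] with [x] and [x + v] in [F], and the symmetry of
    [F] exchanges these two conditions. *)
Lemma summand_faces : csym_faces C -> csym_faces K.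
Proof.
move=> hF a m hm.
case: (pselect (exists k, K k /\ dotp a k = m)) => [[k0 [Kk0 km]]|n]; last first.
  by exists 0 => x [Kx xm]; case: n; exists x.
have inC x : C x -> exists s k, [/\ 0 <= s <= 1, K k & x = k + s *: v].
  by move=> /summandP[s [s01 h]]; exists s, (x - s *: v); rewrite subrK.
case: (ltrgtP (dotp a v) 0) => av.
- have hC x : C x -> dotp a x <= m.
    move=> /inC[s [k [/andP[s0 s1] Kk ->]]]; rewrite dotpDr dotpZr; have := hm _ Kk; nra.
  have KE x : (C x /\ dotp a x = m) -> K x.
    move=> [/inC[s [k [/andP[s0 s1] Kk ->]]]]; rewrite dotpDr dotpZr => e.
    have -> : s = 0; last by rewrite scale0r addr0.
    by apply/eqP; rewrite eq_le s0 andbT leNgt; apply/negP => sp; have := hm _ Kk; nra.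
  have [c hc] := hF a m hC; exists c => x [[Cx _] xm].
  by have [h1 h2] := hc x (conj Cx xm); split=> //; apply: KE.
- have hC x : C x -> dotp a x <= m + dotp a v.
    move=> /inC[s [k [/andP[s0 s1] Kk ->]]]; rewrite dotpDr dotpZr; have := hm _ Kk; nra.
  have KE x : C x -> dotp a x = m + dotp a v -> K (x - v).
    move=> /inC[s [k [/andP[s0 s1] Kk ->]]]; rewrite dotpDr dotpZr => e.
    have -> : s = 1; last by rewrite scale1r addrK.
    by apply/eqP; rewrite eq_le s1 leNgt; apply/negP => sp; have := hm _ Kk; nra.
  have [c hc] := hF a _ hC; exists (c - v - v) => x [[Cx Cxv] xm].
  have [|h1 h2] := hc (x + v); first by split=> //=; rewrite dotpDr xm.
  have e : c - v - v - x = c - (x + v) - v by apply/rowP => i; rewrite !mxE; ring.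
  by rewrite e; split; [exact: KE|rewrite /= dotpBr h2 addrK].
- have hC x : C x -> dotp a x <= m.
    by move=> /inC[s [k [/andP[s0 s1] Kk ->]]]; rewrite dotpDr dotpZr av mulr0 addr0 hm.
  have [c hc] := hF a m hC; exists (c - v) => x [[Cx Cxv] xm].
  have [h1 h2] := hc x (conj Cx xm).
  have [|h3 h4] := hc (x + v); first by split=> //=; rewrite dotpDr xm av addr0.
  have e1 : c - v - x = c - (x + v) by apply/rowP => i; rewrite !mxE; ring.
  split; last by rewrite /= e1.
  split; rewrite /= e1 //.
  by rewrite opprD addrA subrK.
Qed.

End Summand.
End SymmetricPolytopes.

(** * Polytopes with symmetric faces are zonotopes *)

Section PolytopeZonotope.
Context {R : realType} {d : nat}.
Local Notation V := 'rV[R]_d.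
Implicit Types (a b c x y z v p q r : V) (P : seq V) (C Om : set V).

(** In a generating list of minimal length no point lies in the hull of the others, and separation
    from that hull exposes it strictly. *)
Lemma min_hull P : exists Q, [/\ conv_hull Q = conv_hull P, (size Q <= size P)%N, uniq Q &
  forall p, p \in Q -> exists c, forall q, q \in Q -> q != p -> dotp c q < dotp c p].
Proof.
have [|n [Q [QP sQ]] hmin] := @min_nat (fun n => exists Q, conv_hull Q = conv_hull P /\ size Q = n).
  by exists (size P), P.
have nP : (n <= size P)%N by apply: hmin; exists P.
have hull_eq Q' Q'' : (forall p, p \in Q' -> conv_hull Q'' p) -> (forall p, p \in Q'' -> conv_hull Q' p) ->
    conv_hull Q' = conv_hull Q'' by move=> h1 h2; apply/seteqP; split; exact: hull_seq_sub.
have uE : conv_hull (undup Q) = conv_hull Q.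
  by apply: hull_eq => p; rewrite ?mem_undup => h; apply: hull_mem; rewrite ?mem_undup.
have su : (size (undup Q) <= n)%N by rewrite -sQ size_undup.
exists (undup Q); split; rewrite ?undup_uniq ?uE //; first exact: leq_trans su nP.
move=> p pQ; pose Q' := [seq q <- undup Q | q != p].
case: (pselect (conv_hull Q' p)) => [hp|np].
  have : (n <= size Q')%N.
    apply: hmin; exists Q'; split=> //; rewrite -QP -uE; apply: hull_eq => q.
      by rewrite mem_filter => /andP[_ h]; exact: hull_mem.
    move=> qQ; case: (eqVneq q p) => [->//|qp]; apply: hull_mem.
    by rewrite mem_filter qp.
  have : (size Q' < size (undup Q))%N.
    rewrite size_filter -(count_predC (fun q => q != p) (undup Q)) -[ltnLHS]addn0 ltn_add2l.
    by rewrite -has_count; apply/hasP; exists p => //=; rewrite eqxx.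
  by move=> h1 h2; have := leq_trans (leq_ltn_trans h2 h1) su; rewrite ltnn.
case: (pselect (conv_hull Q' !=set0)) => [Q'0|Q'0].
  have [c hc] := separation (@hull_compact _ _ Q') (@hull_convex _ _ Q') Q'0 np.
  by exists c => q qQ qp; apply/hc/hull_mem; rewrite mem_filter qp.
exists 0 => q qQ qp; case: Q'0; exists q; apply: hull_mem; rewrite mem_filter qp //.
Qed.

Lemma exposed_extreme P p c : p \in P -> (forall q, q \in P -> q != p -> dotp c q < dotp c p) ->
  forall x, conv_hull P x -> dotp c p <= dotp c x -> x = p.
Proof.
move=> pP hc x hx cx; apply: contrapT => xp.
have le q : q \in P -> dotp c q <= dotp c p.
  by move=> qP; case: (eqVneq q p) => [->//|qp]; exact/ltW/hc.
case: hx cx xp => w [w0 [w1 ->]]; rewrite dotp_sumr => cx xp; apply: xp.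
have z (i : 'I_(size P)) : P`_i != p -> w i = 0.
  move=> ip; apply/eqP; rewrite eq_le w0 andbT leNgt; apply/negP => wi.
  suff : \sum_i dotp c (w i *: P`_i) < dotp c p by rewrite ltNge cx.
  rewrite -[ltRHS]mul1r -w1 mulr_suml (bigD1 i) //= [ltRHS](bigD1 i) //=.
  apply: ltr_leD; first by rewrite dotpZr ltr_pM2l // hc // mem_nth.
  by apply: ler_sum => j _; rewrite dotpZr ler_wpM2l // le // mem_nth.
rewrite -[RHS]scale1r -w1 scaler_suml; apply: eq_bigr => i _.
by case: (eqVneq P`_i p) => [->//|/z ->]; rewrite !scale0r.
Qed.

(** Induction on the number of generating points. After an edge [[p, q]] is split off, the summand
    [K] is generated by the images of [P] under [f], which sends [p] and [q] to the same point. *)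
Theorem polytope_zono n P Om : (size P <= n)%N -> Om = conv_hull P -> Om !=set0 -> csym_faces Om ->
  exists c vs, Om = [set x | zono vs (x - c)].
Proof.
elim: n P Om => [|n IH] P0 Om sP OmE Om0 hF.
  case: Om0 => x; rewrite OmE; case: P0 sP {OmE} => // _ [w [_ [/eqP]]].
  by rewrite big_ord0 eq_sym oner_eq0.
have [P [PE sPP uP hP]] := min_hull P0; rewrite -PE in OmE.
have {}sP := leq_trans sPP sP.
case: (ltnP 1 (size P)) => [P2|P1]; last first.
  case: P P1 OmE {PE sPP uP hP sP} => [|p [|//]] _ OmE.
    by case: Om0 => x; rewrite OmE => -[w [_ [/eqP]]]; rewrite big_ord0 eq_sym oner_eq0.
  exists p, [::]; rewrite OmE; apply/seteqP; split=> x /=.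
    move=> [w [_ [w1 ->]]]; rewrite big_ord1 in w1; by rewrite big_ord1 w1 scale1r subrr.
  move=> /eqP; rewrite subr_eq0 => /eqP ->; apply: hull_mem; exact: mem_head.
have [a0 [p [q [pq pP qP edge]]]] := exists_edge uP P2 hP.
pose v := q - p; have v0 : v != 0 by rewrite subr_eq0 eq_sym.
have hF' : csym_faces (conv_hull P) by rewrite -OmE.
have htop a : dotp a v = 0 -> exists y, top Om a y /\ top Om a (y + v).
  by rewrite OmE; exact: face_translate pP edge hF' a.
have kC : compact Om by rewrite OmE; exact: hull_compact.
have cC : convex Om by rewrite OmE; exact: hull_convex.
pose K := Om `&` [set x | Om (x + v)].
have KP x : Om x <-> exists s : R, 0 <= s <= 1 /\ K (x - s *: v) by exact: summandP.
have hFK : csym_faces K by exact: summand_faces.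
have kK : compact K by exact: summand_compact.
have cK : convex K by exact: summand_convex.
(* A point of [P] is extreme, so it is an end of the translate of [[0, v]] in [Om] through it;
   accordingly [r] or [r - v] belongs to [K]. *)
pose f r := if `[< Om (r - v) >] then r - v else r.
have OmP r : r \in P -> Om r by rewrite OmE; exact: hull_mem.
have extreme r x (s : R) : r \in P -> Om (x + 0 *: v) -> Om (x + 1 *: v) -> 0 <= s <= 1 -> r = x + s *: v ->
    s = 0 \/ s = 1.
  move=> rP h0 h1 /andP[s0 s1] rE; have [c hc] := hP r rP.
  have ex y : Om y -> dotp c r <= dotp c y -> y = r by rewrite OmE; exact: exposed_extreme.
  case: (lerP 0 (dotp c v)) => cv.
    right; have := ex _ h1; rewrite {1}rE !dotpDr !dotpZr => /(_ _).
    have h : dotp c x + s * dotp c v <= dotp c x + 1 * dotp c v by nra.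
    move=> /(_ h); rewrite rE => /addrI /eqP; rewrite -subr_eq0 -scalerBl scaler_eq0 (negbTE v0) orbF subr_eq0.
    by move=> /eqP.
  left; have := ex _ h0; rewrite {1}rE !dotpDr !dotpZr => /(_ _).
  have h : dotp c x + s * dotp c v <= dotp c x + 0 * dotp c v by nra.
  move=> /(_ h); rewrite rE => /addrI /eqP; rewrite -subr_eq0 -scalerBl scaler_eq0 (negbTE v0) orbF subr_eq0.
  by move=> /eqP.
have fK r : r \in P -> K (f r).
  move=> rP; have Or := OmP r rP; rewrite /f; case: asboolP => h.
    by split=> //; rewrite /= subrK.
  have [s [s01 Ks]] := (KP r).1 Or; have [k1 k2] := Ks.
  have := extreme r (r - s *: v) s rP; rewrite scale0r addr0 scale1r subrK => /(_ k1 k2 s01 erefl).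
  move=> [s0|s1]; first by move: Ks; rewrite s0 scale0r subr0.
  by case: h; move: k1; rewrite s1 scale1r.
pose P' := undup (map f P).
have KE : K = conv_hull P'.
  apply/seteqP; split; last first.
    by apply: hull_sub => // r; rewrite mem_undup => /mapP[r' r'P ->]; exact: fK.
  move=> x Kx; apply: contrapT => nx.
  have P'0 : conv_hull P' !=set0 by exists (f p); apply: hull_mem; rewrite mem_undup map_f.
  have [a ha] := separation (@hull_compact _ _ P') (@hull_convex _ _ P') P'0 nx.
  have Pn : P != [::] by apply/eqP => Pnil; rewrite Pnil in P2.
  (* With direction 0 this merely picks a maximizer of [a] over [P]. *)
  have [r rP [e e0 he]] := stable_max a 0 Pn.
  have rm y : Om y -> dotp a y <= dotp a r.
    rewrite OmE; apply: hull_le => t tP; have := he 0 t _ tP.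
    by rewrite scale0r addr0 lexx ltW // => /(_ isT).
  have : dotp a x <= dotp a (f r); last by rewrite leNgt ha //; apply: hull_mem; rewrite mem_undup map_f.
  have [Ox Oxv] := Kx; rewrite /f; case: asboolP => h; last first.
    case: (lerP (dotp a v) 0) => av; first exact: rm.
    have [s [s01 Ks]] := (KP r).1 (OmP r rP); have [k1 k2] := Ks.
    have := rm _ k2; rewrite dotpDr dotpBr dotpZr => hs.
    have s1 : s = 1 by apply/eqP; rewrite eq_le; case/andP: s01 => s0 s1; rewrite s1 /=; nra.
    by case: h; move: k1; rewrite s1 scale1r.
  rewrite dotpBr; case: (lerP 0 (dotp a v)) => av.
    by have := rm _ Oxv; rewrite dotpDr; lra.
  by have := rm _ h; rewrite dotpBr; lra.
have sP' : (size P' <= n)%N.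
  (* If [p - v] were in [Om], the functional exposing [p] would have to decrease both along [v],
     towards [q], and along [- v]. *)
  have fp : f p = p.
    rewrite /f; case: asboolP => // h.
    have [c hc] := hP p pP; have := hc q qP; rewrite eq_sym pq => /(_ isT) cq.
    have cp : dotp c (p - v) < dotp c p.
      rewrite ltNge; apply/negP => cp; have := exposed_extreme pP hc (x := p - v).
      rewrite -OmE => /(_ h cp) /eqP; rewrite -subr_eq0 addrAC subrr add0r oppr_eq0.
      by rewrite (negbTE v0).
    by exfalso; move: cq cp; rewrite /v !dotpBr; lra.
  have fq : f q = p by rewrite /f /v subKr asboolT //; exact: OmP.
  rewrite -ltnS; apply: leq_trans sP; rewrite -(size_map f P) ltn_size_undup.
  apply/negP => /(uniqP (f p)) /(_ (index p P) (index q P)).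
  rewrite !inE size_map !index_mem !(nth_map p) ?index_mem // !nth_index // fp fq.
  move=> /(_ pP qP erefl) /(congr1 (nth p P)); rewrite !nth_index // => pq'.
  by rewrite pq' eqxx in pq.
have K0 : K !=set0 by exists (f p); exact: fK.
have [c [vs cvs]] := IH P' K sP' KE K0 hFK.
exists c, (v :: vs); apply/seteqP; split=> x.
  move=> /KP[s [s01]]; rewrite cvs /= => h; exists s; split=> //.
  by rewrite addrAC.
by move=> /= [s [s01 h]]; apply/KP; exists s; split=> //; rewrite cvs /= addrAC.
Qed.

End PolytopeZonotope.

(** * From frequency sets to the invertible operator *)

Section Operators.
Context {R : realType} {X : lmodType R[i]} {ip : X -> X -> R[i]} {I : choiceType}.
Hypothesis H : hilb ip.
Local Notation nrm := (nrm (ip := ip)).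
Implicit Types (e u h : I -> X) (T S : X -> X).

Definition bounded_map T :=
  (forall f g, nrm (f - g) = 0 -> nrm (T f - T g) = 0) /\
  (forall a f g, nrm (T (a *: f + g) - (a *: T f + T g)) = 0) /\
  exists C : R, forall f, nrm (T f) <= C * nrm f.

(** [T f] is chosen as a solution of a moment problem. Linearity holds up to norm zero because both
    sides have the same coefficients against [h]. *)
Lemma transfer u h (C A C' A' : R) : riesz u C A (ip := ip) -> riesz h C' A' (ip := ip) ->
  exists2 T, bounded_map T & forall f i, ip (T f) (h i) = ip f (u i).
Proof.
move=> [_ _ bu _ _] [_ A0 _ lh ih].
have /choice[T hT] : forall f, exists g, forall i, ip g (h i) = ip f (u i).
  by move=> f; exact: ih _ _ (bu f).
exists T => //; split; [|split].
- move=> f g fg; apply: (lowerb_eq0 H lh) => i.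
  by rewrite (ipBl H) !hT -(ipBl H) (ip_eq0 H).
- move=> a f g; apply: (lowerb_eq0 H lh) => i.
  by rewrite (ipBl H) !(ipDl H) !(ipZl H) !hT (ipDl H) (ipZl H) subrr.
- exists (A' * C) => f; rewrite -mulrA; apply: lh => s us.
  by under eq_bigr do rewrite hT; exact: bu.
Qed.

(** Against the dual family [h] of [e], the element [e i] has the same coefficients as [u i] has
    against [u]. So the operator that keeps coefficients from [u] to [h] sends [u i] to [e i], and
    the transfer from [h] to [u] inverts it. *)
Lemma riesz_operator e u (C A : R) : riesz e C A (ip := ip) -> biorth u u (ip := ip) ->
  (forall f, (forall i, ip f (u i) = 0) -> nrm f = 0) ->
  exists T S, [/\ bounded_map T, bounded_map S, (forall f, nrm (S (T f) - f) = 0 /\ nrm (T (S f) - f) = 0) &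
    forall i, nrm (T (u i) - e i) = 0].
Proof.
move=> re o cu; have ru := onb_riesz H o cu.
have [h bh] := riesz_biorth re; have rh := riesz_dual H re bh.
have [T bT hT] := transfer ru rh; have [S bS hS] := transfer rh ru.
exists T, S; split=> // [f|i]; first split.
- by apply: (lowerb_eq0 H (riesz_lower ru)) => i; rewrite (ipBl H) hS hT subrr.
- by apply: (lowerb_eq0 H (riesz_lower rh)) => i; rewrite (ipBl H) hT hS subrr.
- apply: (lowerb_eq0 H (riesz_lower rh)) => j; rewrite (ipBl H) hT o.
  rewrite (ip_conj H (h j)) bh eq_sym; case: eqP => _; rewrite ?conjc1 ?conjc0 subrr //.
Qed.

End Operators.

(** * Back to the spaces and operators of the statement *)

Section ConcreteSpace.
Context {R : realType} {d : nat} {K : nat}.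
Local Notation V := 'rV[R]_d.
Local Notation row := (@row_of_tuple R d).
Variable Om : set V.
Let A : set (d.-tuple R) := [set t | Om (row t)].
Hypotheses (mA : measurable A) (AK : A `<=` box K).
Local Notation X := (XA A).
Local Notation nrmX := (nrm (ip := ipA (A := A))).
Implicit Types (f g : V -> R[i]) (F G : X).

Definition rsrow f (t : d.-tuple R) : R[i] := restr Om f (row t).

Lemma leb_int_tmu (g : V -> \bar R) : measurable_fun setT (g \o row) -> (forall x, 0 <= g x)%E ->
  leb_int g = (\int[tmu d]_t g (row t))%E.
Proof. by move=> mg g0; rewrite /leb_int iintE. Qed.

Lemma leb_sqmod f : mfunc (rsrow f) ->
  leb_int (fun x => (sqmod (restr Om f x))%:E) = (\int[tmu d]_t (sqmod (rsrow f t))%:E)%E.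
Proof.
move=> mf; rewrite leb_int_tmu // => [|x]; first exact: mfunc_Esqmod mf.
by rewrite lee_fin sqmod_ge0.
Qed.

Lemma L2P f : L2 Om f <-> L2mu (tmu d) (rsrow f).
Proof.
split=> [[m1 [m2 h]]|[[m1 m2] h]].
  have mf : mfunc (rsrow f) by [].
  by split=> //; rewrite -leb_sqmod.
by split=> //; split=> //; rewrite leb_sqmod.
Qed.

Lemma norm2E f : L2 Om f -> norm2 Om f = nr (rsrow f).
Proof. by move=> /L2P[mf _]; rewrite /norm2 leb_sqmod. Qed.

Lemma rsrowB f g : rsrow (fun x => f x - g x) = fun t => rsrow f t - rsrow g t.
Proof. by apply/funext => t; rewrite /rsrow /restr; case: ifP; rewrite ?subr0. Qed.

Lemma eqHE f g : L2 Om f -> L2 Om g -> eqH Om f g <-> nr (fun t => rsrow f t - rsrow g t) = 0.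
Proof.
move=> /L2P lf /L2P lg; have lB := L2muB lf lg.
rewrite /eqH leb_sqmod rsrowB; last exact: lB.1.
by rewrite (nrE lB); split=> [[]|->].
Qed.

Lemma Rint_tmu (g : V -> R) : measurable_fun setT (g \o row) ->
  (tmu d).-integrable setT (EFin \o (g \o row)) -> Defs.Rint g = \int[tmu d]_t g (row t).
Proof.
move=> mg ig; rewrite /Defs.Rint /Rintegral integralE.
have m1 : measurable_fun setT ((fun x => (Num.max (g x) 0)%:E) \o row).
  by apply/measurable_EFinP; exact: measurable_maxr.
have m2 : measurable_fun setT ((fun x => (Num.max (- g x) 0)%:E) \o row).
  by apply/measurable_EFinP; apply: measurable_maxr => //; exact: measurable_funN.
rewrite !leb_int_tmu //; try (by move=> x; rewrite lee_fin le_max lexx orbT).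
have h1 := integrable_pos_fin_num measurableT ig.
have h2 := integrable_neg_fin_num measurableT ig.
have e1 : (\int[tmu d]_t (Num.max (g (row t)) 0)%:E = \int[tmu d]_t (EFin \o (g \o row))^\+ t)%E.
  by apply: eq_integral => t _; rewrite funeposE /= EFin_max.
have e2 : (\int[tmu d]_t (Num.max (- g (row t)) 0)%:E = \int[tmu d]_t (EFin \o (g \o row))^\- t)%E.
  by apply: eq_integral => t _; rewrite funenegE /= EFin_max EFinN.
by rewrite e1 e2; apply/esym/fineB.
Qed.

Lemma innerE f g : L2 Om f -> L2 Om g -> inner Om f g = pr (rsrow f) (rsrow g).
Proof.
move=> /L2P lf /L2P lg; have ci := L2mu_cintegrable lf lg.
have [m1 m2] := cintegrable_mfunc ci; have [c1 c2] := ci.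
by rewrite /inner /pr /L2ip /cint !Rint_tmu.
Qed.

(** Operators of the statement are maps on all functions, so [toXA] is total, with the default value
    0 off L^2. *)
Definition toXA f : X := if pselect (L2mu (tmu d) (rsrow f)) is left h
  then @mkL2 R _ _ (tmu d) (d.-tuple R) idfun A (f \o row) h else 0.
Definition ofXA F : V -> R[i] := (l2val F : d.-tuple R -> R[i]) \o tuple_of_row.

Lemma l2val_toXA f : L2 Om f -> l2val (toXA f) = f \o row.
Proof. by move=> /L2P lf; rewrite /toXA; case: pselect. Qed.

Lemma rsrow_ofXA F : rsrow (ofXA F) = rs A (l2val F).
Proof. by apply/funext => t; rewrite /rsrow /restr /ofXA /rs /= row_tupleK. Qed.

Lemma L2_ofXA F : L2 Om (ofXA F).
Proof. by apply/L2P; rewrite rsrow_ofXA; exact: l2inP F. Qed.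

Lemma ofXAK F : toXA (ofXA F) = F.
Proof.
apply: val_inj; rewrite /= l2val_toXA; last exact: L2_ofXA.
by apply/funext => t; rewrite /ofXA /= row_tupleK.
Qed.

Lemma nrm_toXA f g : L2 Om f -> L2 Om g -> nrmX (toXA f - toXA g) = nr (fun t => rsrow f t - rsrow g t).
Proof.
move=> lf lg; rewrite nrm_XA -rsrowB; congr nr; apply/funext => t.
rewrite (_ : l2val (toXA f - toXA g) = fun t => l2val (toXA f) t - l2val (toXA g) t) //.
by rewrite /rs !l2val_toXA.
Qed.

Lemma eqHX f g : L2 Om f -> L2 Om g -> eqH Om f g <-> nrmX (toXA f - toXA g) = 0.
Proof. by move=> lf lg; rewrite nrm_toXA // eqHE. Qed.

Lemma norm2X f : L2 Om f -> norm2 Om f = nrmX (toXA f).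
Proof. by move=> lf; rewrite norm2E // nrm_XA l2val_toXA. Qed.

Lemma innerX f g : L2 Om f -> L2 Om g -> inner Om f g = ipA (toXA f) (toXA g).
Proof. by move=> lf lg; rewrite innerE // /ipA /l2ip /sip !l2val_toXA. Qed.

Lemma L2_lin (a : R[i]) f g : L2 Om f -> L2 Om g -> L2 Om (fun x => a * f x + g x).
Proof.
move=> /L2P lf /L2P lg; apply/L2P.
rewrite (_ : rsrow _ = fun t => a * rsrow f t + rsrow g t).
  by apply: L2muD => //; exact: L2muZ.
by apply/funext => t; rewrite /rsrow /restr; case: ifP; rewrite ?mulr0 ?addr0.
Qed.

Lemma toXA_lin (a : R[i]) f g : L2 Om f -> L2 Om g -> toXA (fun x => a * f x + g x) = a *: toXA f + toXA g.
Proof.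
move=> lf lg; apply: val_inj; rewrite /= l2val_toXA; last exact: L2_lin.
by rewrite !l2val_toXA.
Qed.

Lemma bounded_op_X (T : X -> X) : bounded_map T (ip := ipA (A := A)) -> bounded_op Om (fun f => ofXA (T (toXA f))).
Proof.
move=> [b1 [b2 [C hC]]]; split; [|split; [|split]].
- by move=> f _; exact: L2_ofXA.
- move=> f g lf lg /(eqHX lf lg) fg; apply/eqHX; try exact: L2_ofXA.
  by rewrite !ofXAK; exact: b1.
- move=> a f g lf lg; apply/eqHX; [exact: L2_ofXA|by apply: L2_lin; exact: L2_ofXA|].
  by rewrite !toXA_lin ?ofXAK //; exact: L2_ofXA.
- by exists C => f lf; rewrite !norm2X ?ofXAK //; exact: L2_ofXA.
Qed.

Lemma expo_ch l t : expo l (row t) = ch (tuple_of_row l) t.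
Proof.
rewrite /expo /ch ch1E (_ : dotp l (row t) = dott (tuple_of_row l) t) //.
by apply: eq_bigr => i _; rewrite mxE tnth_mktuple.
Qed.

Lemma L2_expo l : L2 Om (expo l).
Proof.
apply/L2P; have := ch_L2S mA AK (tuple_of_row l); congr (L2mu _ _).
by apply/funext => t; rewrite /rsrow /restr /rs -expo_ch.
Qed.

Theorem riesz_basis_of_rb (I : choiceType) (lam : I -> d.-tuple R) u : rb A lam u ->
  riesz_basis Om [set row (lam i) | i in setT] (@expo R d).
Proof.
move=> [hu ho hc hb [B B0 hl] hi]; have [C C0 hC] := hb K.
have re := chX_riesz mA AK C0 B0 hC hl hi.
(* A function solving the moment problem for delta data at [i] tells [lam i] from every other
   frequency, so the index can be replaced by the frequency itself. *)
have lam_inj i j : row (lam i) = row (lam j) -> i = j.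
  move=> /(can_inj (@row_tupleK R d)) lij; have [f _ hf] := hi _ _ (@delta_ell2 R I i).
  apply/eqP; have := hf i; rewrite lij hf eqxx eq_sym; case: eqP => // _ /eqP.
  by rewrite eq_sym oner_eq0.
pose U i : X := mkL2 (L2on_L2S (hu i)).
have ipU F i : ipA F (U i) = pr (rs A (l2val F)) (u i).
  by rewrite /ipA /l2ip /sip /= (rsA (hu i).2).
have oU : biorth U U (ip := ipA (A := A)) by move=> i j; rewrite ipU /= (rsA (hu i).2) ho.
have cU F : (forall i, ipA F (U i) = 0) -> nrmX F = 0.
  by move=> F0; rewrite nrm_XA; apply: hc => [|i]; [exact: XA_L2on|rewrite -ipU].
have [T [S [bT bS TS Te]]] := riesz_operator (HA A) re oU cU.
(* The orthonormal basis indexed by frequencies, with the default value 0 at other points. *)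
pose W (l : V) : V -> R[i] := if pselect (exists i, row (lam i) = l) is left ex
  then ofXA (U (sval (cid ex))) else fun=> 0.
have WE i : W (row (lam i)) = ofXA (U i).
  rewrite /W; case: pselect => [ex|[]]; last by exists i.
  by case: (cid ex) => j /= /lam_inj ->.
exists W, (fun f => ofXA (T (toXA f))); split; [|split].
- split; [|split].
  + by move=> _ [i _ <-]; rewrite WE; exact: L2_ofXA.
  + move=> _ _ [i _ <-] [j _ <-]; rewrite !WE innerX; try exact: L2_ofXA.
    rewrite !ofXAK oU; congr (if _ then _ else _).
    by apply/eqP/eqP => [->//|/lam_inj].
  + move=> f lf f0; have l0 : L2 Om (fun=> 0).
      apply/L2P; rewrite (_ : rsrow _ = fun=> 0); first exact: L2mu0.
      by apply/funext => t; rewrite /rsrow /restr; case: ifP.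
    apply/eqHX => //; have -> : toXA (fun=> 0) = 0.
      by apply: val_inj; rewrite /= l2val_toXA.
    rewrite subr0; apply: cU => i.
    by have := f0 _ (imageT _ i); rewrite WE innerX ?ofXAK //; exact: L2_ofXA.
- split; first exact: bounded_op_X.
  exists (fun f => ofXA (S (toXA f))); split; first exact: bounded_op_X.
  move=> f lf; have [h1 h2] := TS (toXA f).
  have key G : nrmX (G - toXA f) = 0 -> eqH Om (ofXA G) f.
    by move=> hG; apply/(eqHX (L2_ofXA G) lf); rewrite ofXAK; exact: hG.
  rewrite (ofXAK (T (toXA f))) (ofXAK (S (toXA f))); split; [exact: (key _ h1)|exact: (key _ h2)].
- move=> _ [i _ <-]; rewrite WE; apply/eqHX; [exact: L2_ofXA|exact: L2_expo|].
  rewrite !ofXAK; have := Te i; congr (nrmX (_ - _) = 0); apply: val_inj => /=.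
  rewrite l2val_toXA; last exact: L2_expo.
  by apply/funext => t; rewrite /= expo_ch row_tupleK.
Qed.

End ConcreteSpace.

Lemma riesz_set_translate {R : realType} d (A : set 'rV[R]_d) c : compact A ->
  riesz_set [set t | A (row_of_tuple t)] ->
  riesz_set [set t | A (row_of_tuple t - c)].
Proof.
move=> kA [I [lam [u h]]]; pose A' := [set t | A (row_of_tuple t - c)].
pose s : d.-tuple R := tuple_of_row c; have cv := cov_tadd s.
have rowD t : row_of_tuple (tadd t s) = row_of_tuple t + c.
  by apply/rowP => i; rewrite !mxE !tnth_mktuple.
have hA : rb ((fun t => tadd t s) @^-1` A') lam u.
  suff <- : [set t | A (row_of_tuple t)] = (fun t => tadd t s) @^-1` A' by exact: h.
  by apply/seteqP; split=> t; rewrite /A' /preimage /= rowD addrK.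
pose M : R := \sum_j `|tnth s j|.
have M0 : 0 <= M by apply: sumr_ge0.
have sM i : `|tnth s i| <= M by rewrite /M (bigD1 i) //= lerDl sumr_ge0.
have := archi_boundP M0; set K' := Num.Def.archi_bound M => hK.
have hdott l t : dott l (tadd t s) = dott (id l) t + dott l s.
  by rewrite /dott -big_split /=; apply: eq_bigr => i _; rewrite tnth_mktuple mulrDr.
have hbox K : exists L, (fun t => tadd t s) @^-1` box K `<=` @box R d L.
  exists (K + K')%N => t /= ht i; have := ht i; rewrite tnth_mktuple natrD => /andP[h1 h2].
  by have := sM i; rewrite ler_norml => /andP[h3 h4]; apply/andP; split; lra.
have kA' : exists K, A' `<=` box K.
  have [K hK'] := compact_box kA; exists (K + K')%N => t ht i.
  have : [set t | A (row_of_tuple t)] (tuple_of_row (row_of_tuple t - c)) by rewrite /= tuple_rowK.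
  move=> /hK' /(_ i); rewrite tnth_mktuple !mxE natrD => /andP[h1 h2].
  by have := sM i; rewrite tnth_mktuple ler_norml => /andP[h3 h4]; apply/andP; split; lra.
exact: (ex_intro _ I (ex_intro _ _ (ex_intro _ _ (rb_transport cv hdott (fun=> erefl) hbox kA' hA)))).
Qed.

Theorem theorem1p1 (R : realType) (d : nat) (Om : set 'rV[R]_d) :
  (1 <= d)%N ->
  is_polytope Om ->
  interior Om !=set0 ->
  centrally_symmetric Om ->
  (forall F, face_of Om F -> centrally_symmetric F) ->
  exists Lam : set 'rV[R]_d, riesz_basis Om Lam (@expo R d).
Proof.
move=> _ [P OmP] Om0 _ hF.
have hC : csym_faces Om by move=> a m am; apply/csymP; apply: hF; exists a, m.
have Omne : Om !=set0 by case: Om0 => x /interior_subset ?; exists x.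
have [c [vs OmE]] := polytope_zono (leqnn _) OmP Omne hC.
have kO : compact Om by rewrite OmP; exact: hull_compact.
have mA : measurable [set t | Om (row_of_tuple t)].
  by apply: measurable_closed; apply: compact_closed kO; exact: norm_hausdorff.
have [K hK] := compact_box kO.
have : riesz_set [set t | Om (row_of_tuple t)].
  by rewrite OmE; apply: riesz_set_translate; [exact: zono_compact|exact: riesz_zono].
move=> [I [lam [u h]]]; eexists; exact: (riesz_basis_of_rb mA hK h).
Qed.
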